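(* Let $R>0$ and $\gamma>1$ be constants, and let $\tau,\mu,\kappa:\mathbb{R}^+\to\mathbb{R}^+$ be any positive $C^2$ functions. For every left-end state $(v_-,u_-,\theta_-)\in\mathbb{R}^+\times\mathbb{R}\times\mathbb{R}^+$ there exists a constant $\varepsilon_0>0$ such that the following holds for every right-end state $(v_+,u_+,\theta_+)\in\mathbb{R}^+\times\mathbb{R}\times\mathbb{R}^+$ which satisfies, together with the left-end state, the Rankine–Hugoniot and Lax conditions stated in the context, and for which $\varepsilon:=|v_--v_+|\in(0,\varepsilon_0)$. There exists a traveling wave solution $(\tilde v_\varepsilon,\tilde u_\varepsilon,\tilde\theta_\varepsilon):\mathbb{R}\to\mathbb{R}^+\times\mathbb{R}\times\mathbb{R}^+$ of the Brenner–Navier–Stokes–Fourier system connecting $(v_-,u_-,\theta_-)$ to $(v_+,u_+,\theta_+)$ (i.e. a solution of the profile ODE problem in the context), each of whose three components is monotone. It is unique, up to translation in $\xi$, among such solutions with monotone components. Moreover, it satisfies, for all $\xi\in\mathbb{R}$, $$\tilde v_\varepsilon'(\xi)<0,\quad \tilde u_\varepsilon'(\xi)<0,\quad \tilde\theta_\varepsilon'(\xi)>0\qquad\text{if } v_->v_+,$$ and $$\tilde v_\varepsilon'(\xi)>0,\quad \tilde u_\varepsilon'(\xi)<0,\quad \tilde\theta_\varepsilon'(\xi)<0\qquad\text{if } v_-<v_+.$$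
   Context: Notation: $\mathbb{R}^+=(0,\infty)$. The pressure is $p(v,\theta)=R\theta/v$, and the total energy is $E=\frac{R}{\gamma-1}\theta+\frac{u^2}{2}$. The one-dimensional Brenner–Navier–Stokes–Fourier (BNSF) system in Lagrangian mass coordinates is $$v_t-u_x=\Big(\tau(\theta)\frac{v_x}{v}\Big)_x,\qquad u_t+p(v,\theta)_x=\Big(\mu(\theta)\frac{u_x}{v}\Big)_x,\qquad E_t+(p(v,\theta)u)_x=\Big(\kappa(\theta)\frac{\theta_x}{v}\Big)_x+\Big(\mu(\theta)\frac{u u_x}{v}\Big)_x .$$ Write $p_\pm=p(v_\pm,\theta_\pm)$ and $E_\pm=\frac{R}{\gamma-1}\theta_\pm+\frac{u_\pm^2}{2}$. Rankine–Hugoniot and Lax conditions: there exists $\sigma\in\mathbb{R}$ such that $$-\sigma(v_+-v_-)-(u_+-u_-)=0,\quad -\sigma(u_+-u_-)+p_+-p_-=0,\quad -\sigma(E_+-E_-)+p_+u_+-p_-u_-=0,$$ and either ($v_->v_+$, $u_->u_+$, $\theta_-<\theta_+$) or ($v_-<v_+$, $u_->u_+$, $\theta_->\theta_+$). Profile ODE problem: a traveling wave solution $(\tilde v,\tilde u,\tilde\theta)(\xi)$, $\xi=x-\sigma t$, connecting the two end states is a classical solution on $\mathbb{R}$ (with $'=d/d\xi$) of $$-\sigma\tilde v'-\tilde u'=\Big(\tau(\tilde\theta)\frac{\tilde v'}{\tilde v}\Big)',\qquad -\sigma\tilde u'+p(\tilde v,\tilde\theta)'=\Big(\mu(\tilde\theta)\frac{\tilde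 u'}{\tilde v}\Big)',$$ $$-\sigma\Big(\frac{R}{\gamma-1}\tilde\theta+\frac{\tilde u^2}{2}\Big)'+(p(\tilde v,\tilde\theta)\tilde u)'=\Big(\kappa(\tilde\theta)\frac{\tilde\theta'}{\tilde v}\Big)'+\Big(\mu(\tilde\theta)\frac{\tilde u\tilde u'}{\tilde v}\Big)',$$ $$\lim_{\xi\to\pm\infty}(\tilde v,\tilde u,\tilde\theta)(\xi)=(v_\pm,u_\pm,\theta_\pm),$$ where $\sigma=-\sqrt{-\frac{p_+-p_-}{v_+-v_-}}$ if $v_->v_+$ (1-shock) and $\sigma=\sqrt{-\frac{p_+-p_-}{v_+-v_-}}$ if $v_-<v_+$ (3-shock). *)

(* Defs.v *)
From Stdlib Require Export Reals.
From Coquelicot Require Export Coquelicot.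
Open Scope R_scope.

(* Specific volume, velocity and absolute temperature. *)
Record state : Type := State { vol : R; vel : R; temp : R }.

Definition physical (s : state) : Prop := 0 < vol s /\ 0 < temp s.

(* [Rg] is the gas constant, [R] being the type of real numbers. *)
Definition pressure (Rg : R) (s : state) : R := Rg * temp s / vol s.

Definition energy (Rg gamma : R) (s : state) : R :=
  Rg / (gamma - 1) * temp s + vel s ^ 2 / 2.

(* [ex_derive_n f 2 x] alone does not entail [ex_derive f x], since [Derive] is
   a total operator; hence every order up to 2 is required. *)
Definition C2_at (f : R -> R) (x : R) : Prop :=
  (forall k : nat, (k <= 2)%nat -> ex_derive_n f k x) /\
  continuous (Derive_n f 2) x.

(* Transport coefficients are functions on (0, +oo); their values elsewhere
   are junk and never used. *)
Definition positive_C2 (f : R -> R) : Prop :=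
  forall x : R, 0 < x -> 0 < f x /\ C2_at f x.

Definition Rankine_Hugoniot (Rg gamma : R) (sm sp : state) : Prop :=
  exists sigma : R,
    - sigma * (vol sp - vol sm) - (vel sp - vel sm) = 0 /\
    - sigma * (vel sp - vel sm) + pressure Rg sp - pressure Rg sm = 0 /\
    - sigma * (energy Rg gamma sp - energy Rg gamma sm)
      + pressure Rg sp * vel sp - pressure Rg sm * vel sm = 0.

Definition Lax (sm sp : state) : Prop :=
  (vol sm > vol sp /\ vel sm > vel sp /\ temp sm < temp sp) \/
  (vol sm < vol sp /\ vel sm > vel sp /\ temp sm > temp sp).

(* Negative for a 1-shock, positive for a 3-shock. *)
Definition shock_speed (Rg : R) (sm sp : state) : R :=
  let s := sqrt (- ((pressure Rg sp - pressure Rg sm) / (vol sp - vol sm))) in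
  if Rlt_dec (vol sp) (vol sm) then - s else s.

Definition connects (W : R -> state) (sm sp : state) : Prop :=
  (is_lim (fun x => vol (W x)) m_infty (vol sm) /\
   is_lim (fun x => vel (W x)) m_infty (vel sm) /\
   is_lim (fun x => temp (W x)) m_infty (temp sm)) /\
  (is_lim (fun x => vol (W x)) p_infty (vol sp) /\
   is_lim (fun x => vel (W x)) p_infty (vel sp) /\
   is_lim (fun x => temp (W x)) p_infty (temp sp)).

(* C^2 regularity together with positivity of volume and temperature makes
   every [Derive] below a genuine derivative. *)
Definition profile_solution (Rg gamma : R) (tau mu kappa : R -> R)
    (sm sp : state) (W : R -> state) : Prop :=
  let sigma := shock_speed Rg sm sp in
  let v := fun x => vol (W x) in
  let u := fun x => vel (W x) in
  let th := fun x => temp (W x) in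
  (forall x : R, physical (W x)) /\
  (forall x : R, C2_at v x /\ C2_at u x /\ C2_at th x) /\
  (forall x : R,
     - sigma * Derive v x - Derive u x
     = Derive (fun y => tau (th y) * (Derive v y / v y)) x) /\
  (forall x : R,
     - sigma * Derive u x + Derive (fun y => pressure Rg (W y)) x
     = Derive (fun y => mu (th y) * (Derive u y / v y)) x) /\
  (forall x : R,
     - sigma * Derive (fun y => energy Rg gamma (W y)) x
     + Derive (fun y => pressure Rg (W y) * u y) x
     = Derive (fun y => kappa (th y) * (Derive th y / v y)) x
       + Derive (fun y => mu (th y) * (u y * Derive u y / v y)) x) /\
  connects W sm sp.

Definition monotone (f : R -> R) : Prop :=
  (forall x y : R, x <= y -> f x <= f y) \/
  (forall x y : R, x <= y -> f y <= f x).

Definition monotone_components (W : R -> state) : Prop :=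
  monotone (fun x => vol (W x)) /\ monotone (fun x => vel (W x)) /\
  monotone (fun x => temp (W x)).

(* Main.v *)
Require Import Defs.
From Stdlib Require Import Lra Lia List IndefiniteDescription.
Import ListNotations.
Open Scope R_scope.

(** Integrated once, the profile problem is a first-order system for (v, u, theta)
with rest points the two end states.  Reflecting xi -> -xi, u -> -u exchanges 1- and
3-shocks, so let sigma > 0 and write v = v_- (1 + x), u = u_- - sigma v_- y,
theta = theta_- (1 - (gamma - 1) z).  Then x' = a G1, y' = b G2, z' = d G3 with
positive coefficients and polynomial G1, G2, G3 whose only common zeros are the two
end states.

Cooperativity: along solutions each G_i satisfies G_i' >= - K G_i as long as all are
nonnegative, and so do the distances to the upper end state.  Hence the set of states
between the rest points at which all G_i are positive is forward invariant, and
orbits in it are monotone.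

Cone condition: for the difference of two solutions in the small box between the rest
points put g = dy - dx, h = dy - dz and Q = g^2 + (gamma - 1) h^2 - m dx^2, m small.  For weak shocks
Q' <= - k Q wherever Q >= 0, so two solutions with equal x at time 0 separate
exponentially backward in time.  This gives uniqueness among monotone profiles; and,
applied to orbits starting ever closer to the left end state, shifted so that
x(0) = X / 2, it makes their states at time 0 a Cauchy sequence, whose limit lies
on the connecting orbit. *)

(** The obstacle is degeneracy. As X tends to 0 the two rest points merge and, with r = gamma - 1,
    the linear part becomes x' = a (y - x), y' = b (x + r z - (1 + r) y), z' = d (y - z), whose
    kernel is the diagonal. Nothing orders tau, mu and kappa, so no variable is fast or slow. But g
    and h vanish exactly on the diagonal, and the weight r is the one for which the linear part
    contributes - b (g + r h)^2 - a g^2 - r d h^2 to half the derivative of g^2 + r h^2: a negative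
    definite form whatever the positive a, b, d. All other terms are O(X) times the size of the
    difference. The term - m dx^2 restricts the estimate to differences not dominated by the
    degenerate direction.

    Cooperativity is seen on the G_i and not on x', y', z', so that derivatives of the coefficients
    a, b, d never enter. Up to positive factors the off-diagonal terms are 1, r and 1 - s y, where s
    = sigma^2 v_- / p_-; the last one is positive in the box for weak shocks. *)

(** * Differential inequalities and persistence of positivity *)

Lemma is_derive_nondecreasing (f df : R -> R) (a b : R) :
  a <= b -> (forall t, a <= t <= b -> is_derive f t (df t)) ->
  (forall t, a <= t <= b -> 0 <= df t) -> f a <= f b.
Proof.
intros [Hab | ->] Hd Hp; [| lra].
destruct (MVT_cor2 f df a b Hab) as [c [Hc1 Hc2]].
{ intros c Hc; apply is_derive_Reals, Hd, Hc. }
assert (0 <= df c) by (apply Hp; lra).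
nra.
Qed.

(** Gronwall from below: [f t] times [exp (K * (t - b))] is nondecreasing. No sign of [f] is
    assumed, so applied to [- f] it also yields upper bounds. *)
Lemma exp_growth_lower (f df : R -> R) (K a b : R) :
  a <= b -> (forall t, a <= t <= b -> is_derive f t (df t)) ->
  (forall t, a <= t <= b -> - K * f t <= df t) ->
  f a * exp (- K * (b - a)) <= f b.
Proof.
intros Hab Hd Hp.
assert (H : f a * exp (K * (a - b)) <= f b * exp (K * (b - b))).
{ apply (is_derive_nondecreasing (fun t => f t * exp (K * (t - b)))
    (fun t => (df t + K * f t) * exp (K * (t - b)))); [exact Hab | |].
  - intros t Ht.
    evar_last.
    + apply (is_derive_mult f (fun t => exp (K * (t - b)))).
      * apply Hd, Ht.
      * instantiate (1 := K * exp (K * (t - b))). auto_derive; [exact I | unfold Rminus; ring].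
      * intros; apply Rmult_comm.
    + unfold plus, mult; simpl. ring.
  - intros t Ht. apply Rmult_le_pos; [specialize (Hp t Ht); lra | left; apply exp_pos]. }
replace (K * (b - b)) with 0 in H by ring. rewrite exp_0 in H.
replace (- K * (b - a)) with (K * (a - b)) by ring. lra.
Qed.

(** The continuity method: the supremum of the r such that [P] holds on [0, r] is attained by the
    last hypothesis, and the one before it excludes a supremum below [T]. *)
Lemma real_induction (P : R -> Prop) (T : R) :
  0 <= T -> P 0 ->
  (forall t, 0 <= t < T -> P t ->
    exists d, 0 < d /\ forall q, t < q < t + d -> P q) ->
  (forall t, 0 < t <= T -> (forall q, 0 <= q < t -> P q) -> P t) ->
  forall t, 0 <= t <= T -> P t.
Proof.
intros HT P0 Hr Hl.
set (E := fun r => 0 <= r <= T /\ forall q, 0 <= q <= r -> P q).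
assert (E0 : E 0).
{ split; [lra |]. intros q Hq. replace q with 0 by lra. exact P0. }
destruct (completeness E) as [m [Hm1 Hm2]].
{ exists T. intros r [Hr1 _]. lra. }
{ exists 0. exact E0. }
assert (Hm0 : 0 <= m) by (apply Hm1, E0).
assert (HmT : m <= T) by (apply Hm2; intros r [Hr1 _]; lra).
assert (Hbelow : forall q, 0 <= q < m -> P q).
{ intros q Hq.
  destruct (Classical_Prop.classic (exists r, E r /\ q < r)) as [[r [[_ Hr2] Hqr]] | Hn].
  - apply Hr2; lra.
  - exfalso. assert (m <= q); [| lra]. apply Hm2. intros r Er.
    destruct (Rle_lt_dec r q) as [H | H]; [exact H |]. exfalso; apply Hn; eauto. }
assert (Pm : P m).
{ destruct (Req_dec m 0) as [-> | Hne]; [exact P0 |]. apply Hl; [lra | exact Hbelow]. }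
assert (Em : forall q, 0 <= q <= m -> P q).
{ intros q Hq. destruct (Req_dec q m) as [-> | Hne]; [exact Pm | apply Hbelow; lra]. }
destruct (Rle_lt_dec T m) as [HTm | HmT'].
{ intros t Ht. apply Em. lra. }
exfalso.
destruct (Hr m) as [d [Hd Hq]]; [lra | exact Pm |].
set (r := Rmin T (m + d / 2)).
assert (r <= m + d / 2) by apply Rmin_r.
assert (r <= T) by apply Rmin_l.
assert (m < r) by (apply Rmin_glb_lt; lra).
assert (r <= m); [| lra]. apply Hm1. split; [lra |].
intros q Hq'. destruct (Rle_lt_dec q m); [apply Em; lra | apply Hq; lra].
Qed.

Lemma continuous_pos_locally (f : R -> R) (t : R) :
  continuous f t -> 0 < f t ->
  exists d, 0 < d /\ forall q, Rabs (q - t) < d -> 0 < f q.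
Proof.
intros Hc Hp.
destruct (Hc (fun y => 0 < y)) as [d Hd].
{ exists (mkposreal _ Hp). intros y Hy.
  apply (Rabs_def2 (y - f t)) in Hy. simpl in Hy. lra. }
exists d. split; [apply cond_pos |]. intros q Hq. apply Hd. exact Hq.
Qed.

(* The pairs in [l] are (function, derivative). *)
Lemma quasipositive (l : list ((R -> R) * (R -> R))) (K T : R) :
  0 <= T ->
  (forall t, 0 <= t <= T -> Forall (fun s => is_derive (fst s) t (snd s t)) l) ->
  Forall (fun s => 0 < fst s 0) l ->
  (forall t, 0 <= t <= T -> Forall (fun s => 0 < fst s t) l ->
     Forall (fun s => - K * fst s t <= snd s t) l) ->
  forall t, 0 <= t <= T ->
  Forall (fun s => 0 < fst s t /\ fst s 0 * exp (- K * t) <= fst s t) l.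
Proof.
intros HT Hd H0 Hq.
(* If nothing vanished before t, Gronwall holds on [0, q] for each q < t, and continuity carries the
   bound to t itself. The bound is positive, so t is not a time of first vanishing. *)
assert (Hlow : forall t, 0 <= t <= T ->
  (forall q, 0 <= q < t -> Forall (fun s => 0 < fst s q) l) ->
  Forall (fun s => fst s 0 * exp (- K * t) <= fst s t) l).
{ intros t Ht Hpos. rewrite Forall_forall. intros s Hs.
  assert (Hd' : forall q, 0 <= q <= T -> is_derive (fst s) q (snd s q)).
  { intros q Hq'. specialize (Hd q Hq'). rewrite Forall_forall in Hd. apply Hd, Hs. }
  assert (Hbefore : forall q, 0 <= q < t -> fst s 0 * exp (- K * q) <= fst s q).
  { intros q Hq'. replace (- K * q) with (- K * (q - 0)) by ring.
    apply exp_growth_lower with (df := snd s); [lra | intros; apply Hd'; lra |].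
    intros r Hr. assert (Hr' : 0 <= r < t) by lra.
    specialize (Hq r ltac:(lra) (Hpos r Hr')). rewrite Forall_forall in Hq. apply Hq, Hs. }
  destruct (Rle_lt_dec (fst s 0 * exp (- K * t)) (fst s t)) as [Hle | Hlt]; [exact Hle |].
  exfalso.
  destruct (Req_dec t 0) as [-> | Hne].
  { rewrite Rmult_0_r, exp_0 in Hlt. lra. }
  destruct (continuous_pos_locally (fun q => fst s 0 * exp (- K * q) - fst s q) t) as [d [Hdp Hdq]].
  { apply (continuous_minus (fun q => fst s 0 * exp (- K * q))).
    - apply (ex_derive_continuous (fun q => fst s 0 * exp (- K * q))). auto_derive. exact I.
    - apply (ex_derive_continuous (fst s)). eexists. apply Hd'. lra. }
  { lra. }
  set (q := Rmax 0 (t - d / 2)).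
  assert (0 <= q) by apply Rmax_l. assert (t - d / 2 <= q) by apply Rmax_r.
  assert (q < t) by (apply Rmax_lub_lt; lra).
  specialize (Hdq q). specialize (Hbefore q).
  rewrite Rabs_left in Hdq by lra. assert (d / 2 < d) by lra.
  specialize (Hdq ltac:(lra)). specialize (Hbefore ltac:(lra)). lra. }
assert (Hall : forall t, 0 <= t <= T -> Forall (fun s => 0 < fst s t) l).
{ apply real_induction; [exact HT | exact H0 | |].
  - intros t Ht HP.
    assert (Hdt := Hd t ltac:(lra)). clear - Hdt HP.
    induction l as [| s l IH].
    { exists 1. split; [lra |]. constructor. }
    inversion_clear Hdt as [| ? ? Hs Hl]. inversion_clear HP as [| ? ? Ps Pl].
    destruct (IH Pl Hl) as [d1 [Hd1 Hq1]].
    destruct (continuous_pos_locally (fst s) t) as [d2 [Hd2 Hq2]].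
    { apply (ex_derive_continuous (fst s)). eexists; exact Hs. }
    { exact Ps. }
    exists (Rmin d1 d2). split; [apply Rmin_glb_lt; assumption |].
    intros q Hq. assert (Rmin d1 d2 <= d1) by apply Rmin_l.
    assert (Rmin d1 d2 <= d2) by apply Rmin_r.
    constructor; [apply Hq2; rewrite Rabs_pos_eq; lra | apply Hq1; lra].
  - intros t Ht HP. specialize (Hlow t ltac:(lra) HP).
    rewrite Forall_forall in Hlow, H0 |- *. intros s Hs.
    specialize (Hlow s Hs). specialize (H0 s Hs).
    assert (0 < exp (- K * t)) by apply exp_pos. nra. }
intros t Ht.
specialize (Hlow t Ht). assert (Ht' := Hall t Ht).
rewrite Forall_forall in Ht' |- *. rewrite Forall_forall in Hlow.
- intros s Hs. split; [apply Ht', Hs | apply Hlow, Hs].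
- intros q Hq'. apply Hall. lra.
Qed.

(** * Monotone limits, and limits of derivatives at infinity *)

Lemma nondecreasing_lim_p (f : R -> R) (t0 M : R) :
  (forall x y, t0 <= x <= y -> f x <= f y) -> (forall x, t0 <= x -> f x <= M) ->
  exists l : R, is_lim f p_infty l /\ (forall x, t0 <= x -> f x <= l) /\ l <= M.
Proof.
intros Hm Hb.
set (E := fun z => exists x, t0 <= x /\ z = f x).
destruct (completeness E) as [l [Hl1 Hl2]].
{ exists M. intros z [x [Hx ->]]. apply Hb, Hx. }
{ exists (f t0), t0. split; [lra | reflexivity]. }
exists l.
assert (Hle : forall x, t0 <= x -> f x <= l) by (intros x Hx; apply Hl1; exists x; auto).
split; [| split; [exact Hle | apply Hl2; intros z [x [Hx ->]]; apply Hb, Hx]].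
apply is_lim_spec. intros eps.
destruct (Classical_Prop.classic (exists x, t0 <= x /\ l - eps < f x)) as [[x [Hx Hfx]] | Hn].
- exists x. intros y Hy. assert (f x <= f y) by (apply Hm; lra).
  assert (f y <= l) by (apply Hle; lra).
  rewrite Rabs_left1; lra.
- exfalso. assert (l <= l - eps); [| destruct eps; simpl in *; lra].
  apply Hl2. intros z [x [Hx ->]].
  destruct (Rle_lt_dec (f x) (l - eps)) as [H | H]; [exact H |]. exfalso; apply Hn; eauto.
Qed.

Lemma is_lim_opp_arg_m (f : R -> R) (l : Rbar) :
  is_lim (fun t => f (- t)) p_infty l -> is_lim f m_infty l.
Proof.
intros H. apply is_lim_ext with (fun t => f (- - t)).
{ intros t. f_equal. ring. }
apply (is_lim_comp (fun t => f (- t)) (fun t => - t) m_infty l p_infty H).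
- apply (is_lim_opp (fun t => t) m_infty m_infty). apply is_lim_id.
- exists 0. intros y Hy Habs. discriminate Habs.
Qed.

Lemma is_lim_opp_arg_p (f : R -> R) (l : Rbar) :
  is_lim f m_infty l -> is_lim (fun t => f (- t)) p_infty l.
Proof.
intros H.
apply (is_lim_comp f (fun t => - t) p_infty l m_infty H).
- apply (is_lim_opp (fun t => t) p_infty p_infty). apply is_lim_id.
- exists 0. intros y Hy Habs. discriminate Habs.
Qed.

Lemma is_lim_opp_arg_m' (f : R -> R) (l : Rbar) :
  is_lim f p_infty l -> is_lim (fun t => f (- t)) m_infty l.
Proof.
intros H. apply is_lim_opp_arg_m. apply is_lim_ext with f; [| exact H].
intros t. f_equal. ring.
Qed.

Lemma nondecreasing_lim_m (f : R -> R) (M : R) :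
  (forall x y, x <= y -> f x <= f y) -> (forall x, M <= f x) ->
  exists l : R, is_lim f m_infty l /\ (forall x, l <= f x) /\ M <= l.
Proof.
intros Hm Hb.
destruct (nondecreasing_lim_p (fun t => - f (- t)) 0 (- M)) as [l [Hl1 [Hl2 Hl3]]].
{ intros x y Hxy. apply Ropp_le_contravar, Hm. lra. }
{ intros x _. apply Ropp_le_contravar, Hb. }
exists (- l). repeat split; [| | lra].
- apply is_lim_opp_arg_m. apply is_lim_opp in Hl1. simpl in Hl1.
  revert Hl1. apply is_lim_ext. intros t; ring.
- intros x. destruct (Rle_lt_dec x 0) as [H | H].
  + specialize (Hl2 (- x) ltac:(lra)). rewrite Ropp_involutive in Hl2. lra.
  + specialize (Hl2 0 ltac:(lra)). rewrite Ropp_0 in Hl2.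
    assert (f 0 <= f x) by (apply Hm; lra). lra.
Qed.

Lemma bounded_derive_lower (f df : R -> R) (t0 M c : R) :
  (forall t, t0 <= t -> is_derive f t (df t)) ->
  (forall t, t0 <= t -> f t <= M) -> (forall t, t0 <= t -> c <= df t) -> c <= 0.
Proof.
intros Hd Hb Hc. destruct (Rle_lt_dec c 0) as [H | H]; [exact H |]. exfalso.
(* At [t1] a growth of slope [c] has gained [Rabs (M - f t0) + 1], which is beyond the bound [M]. *)
set (t1 := t0 + (Rabs (M - f t0) + 1) / c).
assert (Habs : M - f t0 <= Rabs (M - f t0)) by apply Rle_abs.
assert (Hp := Rabs_pos (M - f t0)).
assert (Ht : c * (t1 - t0) = Rabs (M - f t0) + 1).
{ unfold t1. field. lra. }
assert (Ht1 : t0 <= t1) by (apply Rnot_lt_le; intros Hlt; nra).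
assert (f t0 - c * t0 <= f t1 - c * t1).
{ apply (is_derive_nondecreasing (fun t => f t - c * t) (fun t => df t - c)); [exact Ht1 | |].
  - intros t Ht2. apply (is_derive_minus f (fun t => c * t)); [apply Hd; lra |].
    auto_derive; [exact I | ring].
  - intros t Ht2. specialize (Hc t ltac:(lra)). lra. }
specialize (Hb t1 Ht1). nra.
Qed.

Lemma is_lim_pos_p (g : R -> R) (l : R) :
  is_lim g p_infty l -> 0 < l -> exists T, forall t, T <= t -> l / 2 <= g t.
Proof.
intros Hl Hp. apply is_lim_spec in Hl.
destruct (Hl (mkposreal (l / 2) ltac:(lra))) as [T HT].
exists (T + 1). intros t Ht. specialize (HT t ltac:(lra)). simpl in HT.
apply Rabs_def2 in HT. lra.
Qed.

(** A positive [l] would make [f] grow at a rate of at least [lo * (l / 2)] eventually, past its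
    bound. With [w] a coefficient and [g] a field G_i, this identifies the limit of a bounded
    monotone orbit as a rest point. *)
Lemma bounded_drift_lim_p (f g w : R -> R) (t0 M lo l : R) :
  0 < lo ->
  (forall t, t0 <= t -> is_derive f t (w t * g t)) ->
  (forall t, t0 <= t -> lo <= w t) -> (forall t, t0 <= t -> f t <= M) ->
  is_lim g p_infty l -> l <= 0.
Proof.
intros Hlo Hd Hw Hb Hl. apply Rnot_lt_le. intros Hp.
destruct (is_lim_pos_p g l Hl Hp) as [T HT].
assert (H : lo * (l / 2) <= 0).
{ apply (bounded_derive_lower f (fun t => w t * g t) (Rmax t0 T) M).
  - intros t Ht. apply Hd. eapply Rle_trans; [apply Rmax_l | exact Ht].
  - intros t Ht. apply Hb. eapply Rle_trans; [apply Rmax_l | exact Ht].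
  - intros t Ht.
    assert (t0 <= t) by (eapply Rle_trans; [apply Rmax_l | exact Ht]).
    assert (T <= t) by (eapply Rle_trans; [apply Rmax_r | exact Ht]).
    apply Rmult_le_compat; [lra | lra | apply Hw; assumption | apply HT; assumption]. }
nra.
Qed.

Lemma is_derive_comp_opp (f : R -> R) (t d : R) :
  is_derive f (- t) d -> is_derive (fun q => f (- q)) t (- d).
Proof.
intros H. evar_last.
- apply (is_derive_comp f (fun q => - q) t d (- 1) H). auto_derive; [exact I | ring].
- unfold scal; simpl; unfold mult; simpl. ring.
Qed.

Lemma bounded_drift_lim_m (f g w : R -> R) (M lo l : R) :
  0 < lo ->
  (forall t, is_derive f t (w t * g t)) ->
  (forall t, lo <= w t) -> (forall t, M <= f t) ->
  is_lim g m_infty l -> l <= 0.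
Proof.
intros Hlo Hd Hw Hb Hl.
apply (bounded_drift_lim_p (fun t => - f (- t)) (fun t => g (- t)) (fun t => w (- t)) 0 (- M) lo).
- exact Hlo.
- intros t _. evar_last.
  + apply (is_derive_opp (fun q => f (- q))). apply is_derive_comp_opp, Hd.
  + unfold opp; simpl. ring.
- intros t _. apply Hw.
- intros t _. apply Ropp_le_contravar, Hb.
- apply is_lim_opp_arg_p, Hl.
Qed.

Lemma is_lim_mult_finite (f g : R -> R) (p : Rbar) (l m : R) :
  is_lim f p l -> is_lim g p m -> is_lim (fun t => f t * g t) p (l * m).
Proof. intros Hf Hg. apply (is_lim_mult f g p l m Hf Hg I). Qed.

Lemma is_lim_p_ge_0 (f : R -> R) (t0 l : R) :
  (forall t, t0 <= t -> 0 <= f t) -> is_lim f p_infty l -> 0 <= l.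
Proof.
intros Hf Hl. apply Rnot_lt_le. intros Hn.
apply (is_lim_opp f p_infty l) in Hl.
destruct (is_lim_pos_p (fun t => - f t) (- l) Hl) as [T HT]; [lra |].
specialize (HT (Rmax t0 T) (Rmax_r _ _)). specialize (Hf (Rmax t0 T) (Rmax_l _ _)). lra.
Qed.

Lemma is_lim_m_ge_0 (f : R -> R) (l : R) :
  (forall t, 0 <= f t) -> is_lim f m_infty l -> 0 <= l.
Proof.
intros Hf Hl. apply (is_lim_p_ge_0 (fun t => f (- t)) 0); [intros; apply Hf |].
apply is_lim_opp_arg_p, Hl.
Qed.

Lemma exp_growth_unbounded (k M : R) : 0 < k -> exists n : nat, M < exp (k * INR n).
Proof.
intros Hk. destruct (archimed_cor1 (k / (Rabs M + 1))) as [n [Hn Hn']].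
{ apply Rdiv_lt_0_compat; [exact Hk |]. pose proof (Rabs_pos M). lra. }
exists n. assert (HM := Rabs_pos M). pose proof (Rle_abs M).
assert (Hi : 0 < INR n) by (apply lt_0_INR, Hn').
pose proof (exp_ineq1_le (k * INR n)).
assert (Rabs M + 1 < k * INR n); [| lra].
apply (Rmult_lt_compat_r (INR n * (Rabs M + 1))) in Hn; [| apply Rmult_lt_0_compat; lra].
replace (/ INR n * (INR n * (Rabs M + 1))) with (Rabs M + 1) in Hn by (field; lra).
replace (k / (Rabs M + 1) * (INR n * (Rabs M + 1))) with (k * INR n) in Hn by (field; lra).
exact Hn.
Qed.

Lemma is_lim_seq_of_sqr_bound (u e : nat -> R) (l : R) :
  (forall n, (u n - l) ^ 2 <= e n) -> is_lim_seq e 0 -> is_lim_seq u l.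
Proof.
intros H He. apply is_lim_seq_spec. intros eps.
apply is_lim_seq_spec in He.
destruct (He (mkposreal (eps * eps) (Rmult_lt_0_compat _ _ (cond_pos eps) (cond_pos eps)))) as [N HN].
exists N. intros n Hn. specialize (HN n Hn). simpl in HN. rewrite Rminus_0_r in HN.
specialize (H n). pose proof (Rle_abs (e n)). pose proof (cond_pos eps).
rewrite <- (Rabs_pos_eq eps) by lra. apply Rsqr_lt_abs_0. unfold Rsqr. lra.
Qed.

Lemma is_lim_seq_ge_0 (u : nat -> R) (l : R) (N : nat) :
  (forall n, (N <= n)%nat -> 0 <= u n) -> is_lim_seq u l -> 0 <= l.
Proof.
intros Hu Hl.
apply (is_lim_seq_le_loc (fun _ => 0) u 0 l); [exists N; exact Hu | apply is_lim_seq_const | exact Hl].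
Qed.

(** A positive value before [t0] would, by Gronwall, still be positive at [t0]. The time [t] is
    strictly earlier so that [f] vanishes on a whole neighbourhood of it, whence the claim on
    [df]. *)
Lemma vanishing_backward (f df : R -> R) (K t0 t : R) :
  (forall t, is_derive f t (df t)) -> (forall t, - K * f t <= df t) -> (forall t, 0 <= f t) ->
  f t0 = 0 -> t < t0 -> f t = 0 /\ df t = 0.
Proof.
intros Hder Hlow Hpos H0 Ht.
assert (Hz : forall q, q <= t0 -> f q = 0).
{ intros q Hq. apply Rle_antisym; [| apply Hpos].
  assert (H := exp_growth_lower f df K q t0 Hq (fun p _ => Hder p) (fun p _ => Hlow p)).
  rewrite H0 in H. pose proof (exp_pos (- K * (t0 - q))).
  apply Rnot_lt_le. intros Hp. pose proof (Rmult_lt_0_compat _ _ Hp H1). lra. }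
split; [apply Hz; lra |].
rewrite <- (is_derive_unique f t (df t) (Hder t)).
apply is_derive_unique. apply (is_derive_ext_loc (fun _ => 0)); [| apply (is_derive_const 0)].
exists (mkposreal (t0 - t) ltac:(lra)). intros q Hq. symmetry. apply Hz.
apply (Rabs_def2 (q - t)) in Hq. simpl in Hq. lra.
Qed.

(** * The Picard iteration *)

Lemma lipschitz_continuous (f : R -> R) (K x : R) :
  (forall s t, Rabs (f s - f t) <= K * Rabs (s - t)) -> continuous f x.
Proof.
intros H P [eps HP].
assert (HK : 0 < Rabs K + 1) by (pose proof (Rabs_pos K); lra).
assert (Hd : 0 < eps / (Rabs K + 1)) by (apply Rdiv_lt_0_compat; [apply cond_pos | exact HK]).
exists (mkposreal _ Hd). intros y Hy. apply HP.
unfold ball in *; simpl in *. unfold AbsRing_ball, abs, minus, plus, opp in *; simpl in *.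
fold (y - x) in Hy. fold (f y - f x).
eapply Rle_lt_trans; [apply H |].
apply Rle_lt_trans with ((Rabs K + 1) * Rabs (y - x)).
{ apply Rmult_le_compat_r; [apply Rabs_pos |]. pose proof (Rle_abs K); lra. }
apply (Rmult_lt_compat_l (Rabs K + 1)) in Hy; [| exact HK].
replace ((Rabs K + 1) * (eps / (Rabs K + 1))) with (pos eps) in Hy by (field; lra).
exact Hy.
Qed.

(** Bielecki's weight: integration gains 1 / (2 L) in the norm weighted by exp (2 L |t|). Against an
    [L]-Lipschitz field the Picard map then contracts by 1/2 on the whole line at once, and no local
    solutions have to be glued. *)
Lemma RInt_exp_bound (f : R -> R) (K L t : R) :
  0 < L -> (forall s, continuous f s) ->
  (forall s, Rabs (f s) <= K * exp (2 * L * Rabs s)) ->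
  Rabs (RInt f 0 t) <= K / (2 * L) * exp (2 * L * Rabs t).
Proof.
intros HL.
assert (HK : forall g : R -> R, (forall s, Rabs (g s) <= K * exp (2 * L * Rabs s)) -> 0 <= K).
{ intros g Hg. specialize (Hg 0). rewrite Rabs_R0, Rmult_0_r, exp_0 in Hg.
  pose proof (Rabs_pos (g 0)). lra. }
assert (Hpos : forall g q, 0 <= q -> (forall s, continuous g s) ->
  (forall s, Rabs (g s) <= K * exp (2 * L * Rabs s)) ->
  Rabs (RInt g 0 q) <= K / (2 * L) * exp (2 * L * q)).
{ intros g q Hq Hc Hb.
  assert (HI : is_RInt (fun s => K * exp (2 * L * s)) 0 q
    (K / (2 * L) * exp (2 * L * q) - K / (2 * L) * exp (2 * L * 0))).
  { apply (is_RInt_derive (fun s => K / (2 * L) * exp (2 * L * s))).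
    - intros s _. auto_derive; [exact I |]. field. lra.
    - intros s _. apply (ex_derive_continuous (fun s => K * exp (2 * L * s))).
      auto_derive. exact I. }
  eapply Rle_trans.
  - apply (norm_RInt_le g (fun s => K * exp (2 * L * s)) 0 q); [exact Hq | | | exact HI].
    + intros s Hs. specialize (Hb s). rewrite (Rabs_pos_eq s) in Hb by lra. exact Hb.
    + apply (RInt_correct g), (ex_RInt_continuous g). intros; apply Hc.
  - rewrite Rmult_0_r, exp_0. specialize (HK g Hb).
    assert (0 <= K / (2 * L)) by (apply Rdiv_le_0_compat; lra). lra. }
intros Hc Hb. destruct (Rle_lt_dec 0 t) as [Ht | Ht].
- rewrite (Rabs_pos_eq t Ht). apply Hpos; assumption.
- rewrite (Rabs_left t Ht).
  assert (E : RInt f 0 t = - RInt (fun s => f (- s)) 0 (- t)).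
  { assert (H : is_RInt f (- 0) (- - t) (RInt f 0 t)).
    { rewrite Ropp_0, Ropp_involutive. apply (RInt_correct f), (ex_RInt_continuous f).
      intros; apply Hc. }
    apply is_RInt_comp_opp, is_RInt_opp in H.
    rewrite <- (Ropp_involutive (RInt f 0 t)). apply Ropp_eq_compat. symmetry.
    apply (is_RInt_unique (fun s => f (- s))). revert H. apply is_RInt_ext.
    intros s _. apply Ropp_involutive. }
  rewrite E, Rabs_Ropp. apply Hpos; [lra | |].
  + intros s. apply (continuous_comp Ropp f); [| apply Hc].
    apply (ex_derive_continuous Ropp). auto_derive. exact I.
  + intros s. specialize (Hb (- s)). rewrite Rabs_Ropp in Hb. exact Hb.
Qed.

Lemma geometric_limit (u : nat -> R) (C : R) :
  (forall n, Rabs (u (S n) - u n) <= C * (1 / 2) ^ n) ->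
  forall n, Rabs (Lim_seq u - u n) <= 2 * C * (1 / 2) ^ n.
Proof.
intros Hu.
(* The exact geometric sum is kept, since the induction on [k] does not close with its upper bound
   alone. *)
assert (Hk : forall n k, Rabs (u (n + k)%nat - u n) <= 2 * C * ((1 / 2) ^ n - (1 / 2) ^ (n + k))).
{ intros n k. induction k as [| k IH].
  - rewrite Nat.add_0_r. replace (u n - u n) with 0 by ring. rewrite Rabs_R0. lra.
  - rewrite Nat.add_succ_r.
    replace (u (S (n + k)) - u n) with ((u (S (n + k)) - u (n + k)%nat) + (u (n + k)%nat - u n)) by ring.
    eapply Rle_trans; [apply Rabs_triang |]. specialize (Hu (n + k)%nat).
    change ((1 / 2) ^ S (n + k)) with (1 / 2 * (1 / 2) ^ (n + k)). lra. }
assert (HC : 0 <= C).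
{ specialize (Hu 0%nat). pose proof (Rabs_pos (u 1%nat - u 0%nat)). simpl in Hu. lra. }
assert (Hhalf : forall n, 0 < (1 / 2) ^ n) by (intros n; apply pow_lt; lra).
assert (Hg : is_lim_seq (fun n => 2 * C * (1 / 2) ^ n) 0).
{ replace (Finite 0) with (Rbar_mult (2 * C) 0) by (simpl; f_equal; ring).
  apply is_lim_seq_scal_l, is_lim_seq_geom. rewrite Rabs_pos_eq; lra. }
assert (Hlim : ex_finite_lim_seq u).
{ apply ex_lim_seq_cauchy_corr. intros eps.
  apply is_lim_seq_spec in Hg. destruct (Hg (pos_div_2 eps)) as [N HN].
  exists N. intros p q Hp Hq.
  specialize (HN N (Nat.le_refl N)).
  rewrite Rminus_0_r, Rabs_pos_eq in HN by (apply Rmult_le_pos; [lra | left; apply Hhalf]).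
  assert (Hn : forall m, (N <= m)%nat -> Rabs (u m - u N) < eps / 2).
  { intros m Hm. replace m with (N + (m - N))%nat by lia.
    eapply Rle_lt_trans; [apply Hk |]. simpl in HN.
    assert (0 < (1 / 2) ^ (N + (m - N))) by apply Hhalf. nra. }
  replace (u p - u q) with ((u p - u N) - (u q - u N)) by ring.
  apply Rle_lt_trans with (Rabs (u p - u N) + Rabs (u q - u N)).
  - unfold Rminus at 1. eapply Rle_trans; [apply Rabs_triang |]. rewrite Rabs_Ropp. lra.
  - pose proof (Hn p Hp). pose proof (Hn q Hq). lra. }
apply Lim_seq_correct' in Hlim.
intros n.
assert (H : is_lim_seq (fun k => Rabs (u (k + n)%nat - u n)) (Rabs (Lim_seq u - u n))).
{ apply (is_lim_seq_abs (fun k => u (k + n)%nat - u n) (Lim_seq u - u n)).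
  apply is_lim_seq_minus'; [| apply is_lim_seq_const].
  apply (is_lim_seq_incr_n u n). exact Hlim. }
apply (is_lim_seq_le _ (fun _ => 2 * C * (1 / 2) ^ n) _ (2 * C * (1 / 2) ^ n)) in H.
- exact H.
- intros k. rewrite Nat.add_comm. eapply Rle_trans; [apply Hk |].
  assert (0 < (1 / 2) ^ (n + k)) by apply Hhalf. nra.
- apply is_lim_seq_const.
Qed.

(** Relations between Picard limits are proved by approximating both sides within C (1/2)^n; limit
    and integral are never exchanged. *)
Lemma lim_zero_of_geometric_bound (z C : R) :
  (forall n : nat, Rabs z <= C * (1 / 2) ^ n) -> z = 0.
Proof.
intros H.
assert (Hg : is_lim_seq (fun n => C * (1 / 2) ^ n) 0).
{ replace (Finite 0) with (Rbar_mult C 0) by (simpl; f_equal; ring).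
  apply is_lim_seq_scal_l, is_lim_seq_geom. rewrite Rabs_pos_eq; lra. }
assert (H0 : Rbar_le (Rabs z) 0).
{ apply (is_lim_seq_le (fun _ => Rabs z) _ _ _ H); [apply is_lim_seq_const | exact Hg]. }
simpl in H0. pose proof (Rabs_pos z).
apply Rabs_eq_0. lra.
Qed.

Section Picard.

Variables (I : Type) (F : (I -> R) -> I -> R) (L M : R) (w0 : I -> R).
Hypothesis HL : 0 < L.
Hypothesis F_lip : forall x y d, (forall i, Rabs (x i - y i) <= d) ->
  forall i, Rabs (F x i - F y i) <= L * d.
Hypothesis F_bd : forall x i, Rabs (F x i) <= M.

Fixpoint picard_iter (n : nat) (t : R) (i : I) : R :=
  match n with
  | O => w0 i
  | S n => w0 i + RInt (fun s => F (picard_iter n s) i) 0 t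
  end.

Definition picard_limit (t : R) (i : I) : R := Lim_seq (fun n => picard_iter n t i).

Lemma field_along_lipschitz_continuous (X : R -> I -> R) (i : I) (s : R) :
  (forall s t i, Rabs (X s i - X t i) <= M * Rabs (s - t)) ->
  continuous (fun s => F (X s) i) s.
Proof.
intros HX. apply lipschitz_continuous with (L * M). intros p q.
rewrite Rmult_assoc. apply F_lip. intros j. apply HX.
Qed.

Lemma field_integral_lipschitz (X : R -> I -> R) (i : I) (s t : R) :
  (forall s t i, Rabs (X s i - X t i) <= M * Rabs (s - t)) ->
  Rabs (RInt (fun s => F (X s) i) 0 s - RInt (fun s => F (X s) i) 0 t) <= M * Rabs (s - t).
Proof.
intros HX.
assert (Hex : forall a b, ex_RInt (fun s => F (X s) i) a b).
{ intros a b. apply (ex_RInt_continuous (fun s => F (X s) i)).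
  intros; apply field_along_lipschitz_continuous, HX. }
assert (Hle : forall p q, p <= q ->
  Rabs (RInt (fun s => F (X s) i) p q) <= M * Rabs (q - p)).
{ intros p q Hpq. rewrite (Rabs_pos_eq (q - p)), (Rmult_comm M) by lra.
  apply abs_RInt_le_const; [exact Hpq | apply Hex | intros; apply F_bd]. }
assert (Hch := RInt_Chasles (fun s => F (X s) i) 0 t s (Hex _ _) (Hex _ _)).
unfold plus in Hch; simpl in Hch. rewrite <- Hch.
rewrite Rplus_minus_l.
destruct (Rle_lt_dec t s) as [Hts | Hst]; [apply Hle, Hts |].
rewrite <- (opp_RInt_swap (fun s => F (X s) i)) by apply Hex.
unfold opp; simpl. rewrite Rabs_Ropp, Rabs_minus_sym. apply Hle. lra.
Qed.

Lemma picard_bound_nonneg (i : I) : 0 <= M.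
Proof. eapply Rle_trans; [apply Rabs_pos | apply (F_bd w0 i)]. Qed.

(** The bound [M] on the field gives all iterates one Lipschitz constant in time. It makes the
    integrands continuous and survives in the limit. *)
Lemma picard_iter_lipschitz (n : nat) :
  forall s t i, Rabs (picard_iter n s i - picard_iter n t i) <= M * Rabs (s - t).
Proof.
induction n as [| n IH]; intros s t i; simpl.
- replace (w0 i - w0 i) with 0 by ring. rewrite Rabs_R0.
  apply Rmult_le_pos; [apply (picard_bound_nonneg i) | apply Rabs_pos].
- rewrite Rminus_plus_l_l.
  apply (field_integral_lipschitz (picard_iter n)). exact IH.
Qed.

(** The contraction: a factor [L] from the field and 1 / (2 L) from the weighted integral. *)
Lemma field_integral_diff (X Y : R -> I -> R) (K : R) (i : I) (t : R) :
  (forall s t i, Rabs (X s i - X t i) <= M * Rabs (s - t)) ->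
  (forall s t i, Rabs (Y s i - Y t i) <= M * Rabs (s - t)) ->
  (forall s i, Rabs (X s i - Y s i) <= K * exp (2 * L * Rabs s)) ->
  Rabs (RInt (fun s => F (X s) i) 0 t - RInt (fun s => F (Y s) i) 0 t)
  <= K / 2 * exp (2 * L * Rabs t).
Proof.
intros HX HY HXY.
assert (Hex : forall X, (forall s t i, Rabs (X s i - X t i) <= M * Rabs (s - t)) ->
  ex_RInt (fun s => F (X s) i) 0 t).
{ intros Z HZ. apply (ex_RInt_continuous (fun s => F (Z s) i)).
  intros; apply field_along_lipschitz_continuous, HZ. }
assert (E := RInt_minus _ _ _ _ (Hex X HX) (Hex Y HY)).
unfold minus at 2, plus, opp in E; simpl in E. unfold Rminus. rewrite <- E.
replace (K / 2) with (L * K / (2 * L)) by (field; lra).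
apply RInt_exp_bound; [exact HL | |].
- intros s. apply (continuous_minus (fun s => F (X s) i) (fun s => F (Y s) i));
    apply field_along_lipschitz_continuous; assumption.
- intros s. unfold minus, plus, opp; simpl. rewrite Rmult_assoc. apply F_lip.
  intros j. apply HXY.
Qed.

Lemma picard_iter_step (n : nat) : forall t i,
  Rabs (picard_iter (S n) t i - picard_iter n t i)
  <= M / (2 * L) * exp (2 * L * Rabs t) * (1 / 2) ^ n.
Proof.
induction n as [| n IH]; intros t i.
- simpl. rewrite Rmult_1_r.
  rewrite Rplus_minus_l.
  apply RInt_exp_bound; [exact HL | |].
  + intros s. apply (continuous_const (F (fun i => w0 i) i)).
  + intros s. eapply Rle_trans; [apply F_bd |].
    rewrite <- (Rmult_1_r M) at 1. apply Rmult_le_compat_l; [apply (picard_bound_nonneg i) |].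
    pose proof (exp_ineq1_le (2 * L * Rabs s)). pose proof (Rabs_pos s). nra.
- set (K := M / (2 * L) * (1 / 2) ^ n).
  assert (H := field_integral_diff (picard_iter (S n)) (picard_iter n) K i t
    (picard_iter_lipschitz (S n)) (picard_iter_lipschitz n)).
  match type of H with _ -> Rabs (?a - ?b) <= _ =>
    change (picard_iter (S (S n)) t i) with (w0 i + a);
    change (picard_iter (S n) t i) with (w0 i + b);
    rewrite (Rminus_plus_l_l (w0 i) a b)
  end.
  eapply Rle_trans; [apply H |].
  + intros s j. eapply Rle_trans; [apply IH |]. unfold K. right; ring.
  + unfold K. simpl. right; field. lra.
Qed.

Lemma picard_iter_limit (n : nat) (t : R) (i : I) :
  Rabs (picard_limit t i - picard_iter n t i)
  <= 2 * (M / (2 * L)) * (1 / 2) ^ n * exp (2 * L * Rabs t).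
Proof.
eapply Rle_trans.
- apply (geometric_limit (fun n => picard_iter n t i)
    (M / (2 * L) * exp (2 * L * Rabs t))). intros k. apply picard_iter_step.
- right; ring.
Qed.

Lemma picard_limit_lipschitz : forall s t i,
  Rabs (picard_limit s i - picard_limit t i) <= M * Rabs (s - t).
Proof.
intros s t i. apply Rnot_lt_le. intros Hlt.
set (C := 2 * (M / (2 * L)) * (exp (2 * L * Rabs s) + exp (2 * L * Rabs t))).
assert (Hz : Rabs (picard_limit s i - picard_limit t i) - M * Rabs (s - t) = 0).
{ apply lim_zero_of_geometric_bound with C. intros n.
  rewrite Rabs_pos_eq by lra.
  pose proof (picard_iter_limit n s i) as H1. pose proof (picard_iter_limit n t i) as H2.
  pose proof (picard_iter_lipschitz n s t i) as H3.
  replace (picard_limit s i - picard_limit t i) with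
    ((picard_limit s i - picard_iter n s i) + (picard_iter n s i - picard_iter n t i)
     - (picard_limit t i - picard_iter n t i)) by ring.
  assert (Hab : forall a b c, Rabs (a + b - c) <= Rabs a + Rabs b + Rabs c).
  { intros a b c. unfold Rminus. eapply Rle_trans; [apply Rabs_triang |].
    rewrite Rabs_Ropp. pose proof (Rabs_triang a b). lra. }
  eapply Rle_trans with (_ + _ + _ - _); [apply Rplus_le_compat_r, Hab |].
  unfold C. lra. }
lra.
Qed.

Lemma picard_limit_fixpoint (t : R) (i : I) :
  picard_limit t i = w0 i + RInt (fun s => F (picard_limit s) i) 0 t.
Proof.
apply Rminus_diag_uniq.
apply lim_zero_of_geometric_bound with (2 * (M / (2 * L)) * exp (2 * L * Rabs t)).
intros n.
pose proof (picard_iter_limit (S n) t i) as H1.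
set (K := 2 * (M / (2 * L)) * (1 / 2) ^ n).
assert (H := field_integral_diff picard_limit (picard_iter n) K i t
    picard_limit_lipschitz (picard_iter_lipschitz n) (picard_iter_limit n)).
match type of H with Rabs (?a - ?b) <= _ =>
  change (picard_iter (S n) t i) with (w0 i + b) in H1;
  replace (picard_limit t i - (w0 i + a)) with ((picard_limit t i - (w0 i + b)) - (a - b)) by ring
end.
unfold Rminus at 1. eapply Rle_trans; [apply Rabs_triang |]. rewrite Rabs_Ropp.
unfold K in H. simpl in H1. lra.
Qed.

Lemma picard_existence :
  exists X : R -> I -> R, (forall i, X 0 i = w0 i) /\
  forall t i, is_derive (fun s => X s i) t (F (X t) i).
Proof.
exists picard_limit. split.
- intros i. rewrite picard_limit_fixpoint, RInt_point. unfold zero; simpl. ring.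
- intros t i.
  apply is_derive_ext with (fun t => w0 i + RInt (fun s => F (picard_limit s) i) 0 t).
  { intros s. symmetry. apply picard_limit_fixpoint. }
  evar_last.
  + apply (is_derive_plus (fun _ => w0 i)); [apply (is_derive_const (w0 i)) |].
    apply (is_derive_RInt (fun s => F (picard_limit s) i) _ 0).
    * exists (mkposreal 1 Rlt_0_1). intros s _. apply (RInt_correct (fun s => F (picard_limit s) i)).
      apply (ex_RInt_continuous (fun s => F (picard_limit s) i)).
      intros; apply field_along_lipschitz_continuous, picard_limit_lipschitz.
    * apply field_along_lipschitz_continuous, picard_limit_lipschitz.
  + unfold plus, zero; simpl. ring.
Qed.

End Picard.

(** * The normalised profile system *)

Ltac eta_functions :=
  repeat match goal with f : R -> R |- _ => progress change (fun x : R => f x) with f end.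

Lemma Rabs_prod_diff (a1 a2 p1 p2 : R) :
  Rabs (a1 * p1 - a2 * p2) <= Rabs a1 * Rabs (p1 - p2) + Rabs (a1 - a2) * Rabs p2.
Proof.
replace (a1 * p1 - a2 * p2) with (a1 * (p1 - p2) + (a1 - a2) * p2) by ring.
eapply Rle_trans; [apply Rabs_triang |]. rewrite !Rabs_mult. lra.
Qed.

Lemma Rmult_range (a b A B : R) : 0 <= a <= A -> 0 <= b <= B -> 0 <= a * b <= A * B.
Proof. intros. split; [apply Rmult_le_pos | apply Rmult_le_compat]; lra. Qed.

(** With m = lo / (4 hi), the error terms in the cone estimate are at most (2 + 2 r + m) w N^2,
    where N = |x| + |g| + |h|, and inside the cone N^2 <= 3 (1/m + 1 + 1/r) P, where P = g^2 + r
    h^2. The threshold is the value of w at which their product is (lo / 4) P. *)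
Definition cone_threshold (r lo hi : R) : R :=
  lo / 4 / (3 * (2 + 2 * r + lo / (4 * hi)) * (1 / (lo / (4 * hi)) + 1 + 1 / r)).

Lemma cone_threshold_pos (r lo hi : R) :
  0 < r -> 0 < lo -> lo <= hi -> 0 < cone_threshold r lo hi.
Proof.
intros Hr Hlo Hhi. unfold cone_threshold.
assert (0 < lo / (4 * hi)) by (apply Rdiv_lt_0_compat; lra).
assert (0 < 1 / (lo / (4 * hi))) by (apply Rdiv_lt_0_compat; lra).
assert (0 < 1 / r) by (apply Rdiv_lt_0_compat; lra).
apply Rdiv_lt_0_compat; [lra |]. apply Rmult_lt_0_compat; lra.
Qed.

(* Inside the cone [m x^2 <= g^2 + r h^2] the transverse part [(g, h)] of the
   difference of two solutions dominates, and there the linear part is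
   dissipative. *)
Lemma cone_decay (r lo hi a b d e1 e2 e3 x g h w : R) :
  0 < r -> 0 < lo -> lo <= hi ->
  lo <= a <= hi -> lo <= b -> lo <= d ->
  0 <= w <= cone_threshold r lo hi ->
  Rabs e1 <= w * (Rabs x + Rabs g + Rabs h) ->
  Rabs e2 <= w * (Rabs x + Rabs g + Rabs h) ->
  Rabs e3 <= w * (Rabs x + Rabs g + Rabs h) ->
  lo / (4 * hi) * x ^ 2 <= g ^ 2 + r * h ^ 2 ->
  (g + r * h) * (- b * (g + r * h) + e2) - g * (a * g + e1) - r * h * (d * h + e3)
    - lo / (4 * hi) * (x * (a * g + e1))
  <= - (lo / 4) * (g ^ 2 + r * h ^ 2 - lo / (4 * hi) * x ^ 2).
Proof.
intros Hr Hlo Hhi Ha Hb Hd Hw He1 He2 He3 HQ.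
set (m := lo / (4 * hi)) in *.
assert (Hm : 0 < m) by (apply Rdiv_lt_0_compat; lra).
assert (Hmh : m * hi = lo / 4) by (unfold m; field; lra).
set (P := g ^ 2 + r * h ^ 2) in *.
set (N := Rabs x + Rabs g + Rabs h) in *.
assert (HN : 0 <= N) by (unfold N; pose proof (Rabs_pos x); pose proof (Rabs_pos g); pose proof (Rabs_pos h); lra).
assert (HP : 0 <= P) by (unfold P; pose proof (pow2_ge_0 g); pose proof (pow2_ge_0 h); nra).
assert (Hx2 : x ^ 2 <= P * (1 / m)).
{ apply (Rmult_le_reg_l m); [exact Hm |]. replace (m * (P * (1 / m))) with P by (field; lra). exact HQ. }
assert (Hg2 : g ^ 2 <= P) by (unfold P; pose proof (pow2_ge_0 h); nra).
assert (Hh2 : h ^ 2 <= P * (1 / r)).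
{ apply (Rmult_le_reg_l r); [exact Hr |]. replace (r * (P * (1 / r))) with P by (field; lra).
  unfold P. pose proof (pow2_ge_0 g). lra. }
assert (HN2 : N ^ 2 <= 3 * (P * (1 / m + 1 + 1 / r))).
{ apply Rle_trans with (3 * (x ^ 2 + g ^ 2 + h ^ 2)); [| lra].
  unfold N. rewrite <- (pow2_abs x), <- (pow2_abs g), <- (pow2_abs h).
  pose proof (pow2_ge_0 (Rabs x - Rabs g)). pose proof (pow2_ge_0 (Rabs x - Rabs h)).
  pose proof (pow2_ge_0 (Rabs g - Rabs h)). lra. }
assert (Herr : (g + r * h) * e2 - g * e1 - r * h * e3 - m * (x * e1) <= lo / 4 * P).
{ apply Rle_trans with ((2 + 2 * r + m) * (w * N ^ 2)).
  - assert (Hprod : forall u e c, 0 <= c -> Rabs u <= c * N -> Rabs e <= w * N -> Rabs (u * e) <= c * (w * N ^ 2)).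
    { intros u e c Hc Hu He. rewrite Rabs_mult. replace (c * (w * N ^ 2)) with ((c * N) * (w * N)) by ring.
      apply Rmult_le_compat; auto using Rabs_pos. }
    assert (Hgr : Rabs (g + r * h) <= (1 + r) * N).
    { eapply Rle_trans; [apply Rabs_triang |]. rewrite Rabs_mult, (Rabs_pos_eq r) by lra.
      assert (Rabs g <= N /\ Rabs h <= N) as [A1 A2] by (unfold N; pose proof (Rabs_pos x); pose proof (Rabs_pos g); pose proof (Rabs_pos h); lra).
      nra. }
    assert (H1 := Hprod (g + r * h) e2 (1 + r) ltac:(lra) Hgr He2).
    assert (H2 := Hprod g e1 1 ltac:(lra) ltac:(unfold N; pose proof (Rabs_pos x); pose proof (Rabs_pos h); lra) He1).
    assert (H3 := Hprod h e3 1 ltac:(lra) ltac:(unfold N; pose proof (Rabs_pos x); pose proof (Rabs_pos g); lra) He3).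
    assert (H4 := Hprod x e1 1 ltac:(lra) ltac:(unfold N; pose proof (Rabs_pos g); pose proof (Rabs_pos h); lra) He1).
    apply Rabs_le_between in H1, H2, H3, H4. nra.
  - apply Rle_trans with ((2 + 2 * r + m) * (cone_threshold r lo hi * (3 * (P * (1 / m + 1 + 1 / r))))).
    + apply Rmult_le_compat_l; [lra |]. apply Rmult_le_compat; [lra | apply pow2_ge_0 | lra | exact HN2].
    + right. unfold cone_threshold. fold m. field.
      repeat split; try lra. nra. }
(* The choice of [m] comes from here: after completing the square the remainder a m (m x^2) is at
   most hi m P in the cone, and hi m = lo / 4. *)
assert (Hcross : - m * (x * (a * g)) <= a * g ^ 2 / 4 + lo / 4 * P).
{ apply Rle_trans with (a * g ^ 2 / 4 + a * m * (m * x ^ 2)).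
  - assert (0 <= a * (g / 2 + m * x) ^ 2) by (apply Rmult_le_pos; [lra | apply pow2_ge_0]). lra.
  - assert (a * m * (m * x ^ 2) <= hi * m * P); [| nra].
    apply Rmult_le_compat; [apply Rmult_le_pos; lra | apply Rmult_le_pos; [lra | apply pow2_ge_0] | apply Rmult_le_compat_r; lra | exact HQ]. }
(* Balance: the cross term uses a quarter of a g^2, so a dissipation of at least (3/4) lo P remains;
   error and cross term return lo / 4 each, which leaves - (lo / 4) P. *)
assert (0 <= b * (g + r * h) ^ 2) by (apply Rmult_le_pos; [lra | apply pow2_ge_0]).
assert (lo * g ^ 2 <= a * g ^ 2) by (apply Rmult_le_compat_r; [apply pow2_ge_0 | lra]).
assert (lo * (r * h ^ 2) <= d * (r * h ^ 2)) by (apply Rmult_le_compat_r; [apply Rmult_le_pos; [lra | apply pow2_ge_0] | lra]).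
assert (0 <= lo / 4 * (m * x ^ 2)) by (apply Rmult_le_pos; [lra | apply Rmult_le_pos; [lra | apply pow2_ge_0]]).
assert (HlP : lo * P = lo * g ^ 2 + lo * (r * h ^ 2)) by (unfold P; ring).
pose proof (pow2_ge_0 h). assert (0 <= r * h ^ 2) by (apply Rmult_le_pos; lra).
assert (0 <= lo * (r * h^2)) by (apply Rmult_le_pos; lra).
lra.
Qed.

(* [r] is gamma - 1 and [X] the relative jump of the specific volume; the
   states [0] and [(X, X, z_end)] are the two rest points. *)
Definition slope (r X : R) : R := 2 * (1 + r) / (2 + (r + 2) * X).
Definition z_end (r X : R) : R := X - slope r X * X ^ 2 / 2.

(** Integrated balances of mass, momentum and energy in the variables (x, y, z), with positive
    factors removed. In [G2] the pressure, proportional to (1 - r z) / (1 + x), has been multiplied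
    by 1 + x to make it polynomial; [s] stands for sigma^2 v_- / p_-. *)
Definition G1 (x y : R) : R := y - x.
Definition G2 (r s x y z : R) : R := x + r * z - s * (1 + x) * y.
Definition G3 (s y z : R) : R := y - z - s / 2 * y ^ 2.

Definition normalised_solution (r X : R) (a b d : R -> R -> R) (x y z : R -> R) : Prop :=
  forall t,
  is_derive x t (a (x t) (z t) * G1 (x t) (y t)) /\
  is_derive y t (b (x t) (z t) * G2 r (slope r X) (x t) (y t) (z t)) /\
  is_derive z t (d (x t) (z t) * G3 (slope r X) (y t) (z t)).

Definition in_box (r X x y z : R) : Prop :=
  0 <= x <= X /\ 0 <= y <= X /\ 0 <= z <= z_end r X.

Definition clamp (m x : R) : R := Rmax 0 (Rmin x m).

Lemma clamp_range (m x : R) : 0 <= m -> 0 <= clamp m x <= m.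
Proof.
intros Hm. unfold clamp. split; [apply Rmax_l |].
apply Rmax_lub; [exact Hm | apply Rmin_r].
Qed.

Lemma clamp_id (m x : R) : 0 <= x <= m -> clamp m x = x.
Proof. intros H. unfold clamp. rewrite Rmin_left, Rmax_right by lra. reflexivity. Qed.

Lemma clamp_lipschitz (m x y : R) : Rabs (clamp m x - clamp m y) <= Rabs (x - y).
Proof.
unfold clamp, Rmax, Rmin, Rabs.
repeat destruct Rle_dec; repeat destruct Rcase_abs; lra.
Qed.

Inductive coord : Type := Cx | Cy | Cz.

Definition coefficient_ok (lo hi L X Z : R) (a : R -> R -> R) : Prop :=
  (forall x z, 0 <= x <= X -> 0 <= z <= Z -> lo <= a x z <= hi) /\
  (forall x z x' z', 0 <= x <= X -> 0 <= z <= Z -> 0 <= x' <= X -> 0 <= z' <= Z ->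
     Rabs (a x z - a x' z') <= L * (Rabs (x - x') + Rabs (z - z'))).

Section Normalised.

Variables (r lo hi L X : R) (a b d : R -> R -> R).
Hypothesis Hr : 0 < r.
Hypothesis Hlo : 0 < lo.
Hypothesis Hhi : lo <= hi.
Hypothesis HL : 0 <= L.
Hypothesis HX : 0 < X.
Hypothesis HXr : (1 + r) * X <= 1.
Hypothesis HXc : (hi + L) * ((1 + r) * (r + 6)) * X <= cone_threshold r lo hi.

Let s := slope r X.
Let Z := z_end r X.

Hypothesis Ha : coefficient_ok lo hi L X Z a.
Hypothesis Hb : coefficient_ok lo hi L X Z b.
Hypothesis Hd : coefficient_ok lo hi L X Z d.

Lemma slope_eq : s * (2 + (r + 2) * X) = 2 * (1 + r).
Proof. unfold s, slope. field. nra. Qed.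

Lemma slope_bounds : 0 < s <= 1 + r.
Proof.
pose proof slope_eq as H. assert (Hk : 0 < (r + 2) * X) by (apply Rmult_lt_0_compat; lra).
assert (Hs : 0 < s).
{ apply (Rmult_lt_reg_r (2 + (r + 2) * X)); lra. }
split; [exact Hs |]. assert (0 < s * ((r + 2) * X)) by (apply Rmult_lt_0_compat; lra). lra.
Qed.

Lemma slope_X_le_1 : s * X <= 1.
Proof. pose proof slope_bounds. nra. Qed.

Lemma X_lt_1 : X < 1.
Proof. nra. Qed.

Lemma z_end_eq : Z = X - s * X ^ 2 / 2.
Proof. reflexivity. Qed.

Lemma z_end_bounds : X / 2 <= Z <= X.
Proof. rewrite z_end_eq. pose proof slope_X_le_1. pose proof slope_bounds. split; nra. Qed.

Lemma rest_point_eq : X + r * Z = s * (1 + X) * X.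
Proof.
rewrite z_end_eq. pose proof slope_eq as H.
assert (E : X / 2 * (2 * (1 + r) - s * (2 + (r + 2) * X)) = 0) by (rewrite H; ring).
replace (X + r * (X - s * X ^ 2 / 2)) with
 (X / 2 * (2 * (1 + r) - s * (2 + (r + 2) * X)) + s * (1 + X) * X) by field. lra.
Qed.

(** Eliminating y = x and z = x - s x^2 / 2 turns twice [G2] into s (r + 2) x (X - x), by the
    equation that defines the slope. *)
Lemma rest_points (x y z : R) :
  G1 x y = 0 -> G2 r s x y z = 0 -> G3 s y z = 0 -> x = 0 \/ x = X.
Proof.
unfold G1, G2, G3. intros H1 H2 H3.
assert (y = x) by lra. subst y.
assert (Hz : z = x - s / 2 * x ^ 2) by lra. subst z.
pose proof slope_eq as H. pose proof slope_bounds.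
assert (E : x * (s * (r + 2) * (X - x)) = 0).
{ replace (x * (s * (r + 2) * (X - x))) with
    (2 * (x + r * (x - s / 2 * x ^ 2) - s * (1 + x) * x)
     - x * (2 * (1 + r) - s * (2 + (r + 2) * X))) by field.
  rewrite H2, H. ring. }
apply Rmult_integral in E. destruct E as [E | E]; [left; exact E | right].
assert (0 < s * (r + 2)) by (apply Rmult_lt_0_compat; lra).
apply Rmult_integral in E. destruct E as [E | E]; lra.
Qed.

Lemma G_bounds (x y z : R) : in_box r X x y z ->
  Rabs (G1 x y) <= X /\ Rabs (G2 r s x y z) <= 3 * (1 + r) * X /\ Rabs (G3 s y z) <= 2 * X.
Proof.
intros (Hx & Hy & Hz). fold Z in Hz. unfold G1, G2, G3.
pose proof slope_bounds. pose proof z_end_bounds. pose proof X_lt_1. pose proof slope_X_le_1.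
assert (Hsy : 0 <= s * y <= (1 + r) * X) by (apply Rmult_range; lra).
assert (0 <= s * y * x <= ((1 + r) * X) * 1) by (apply Rmult_range; lra).
assert (0 <= (s * y) * y <= 1 * X) by (apply Rmult_range; [split; nra | lra]).
assert (0 <= r * z <= r * X) by (apply Rmult_range; lra).
assert (0 <= r * X) by nra.
replace (s / 2 * y ^ 2) with (s * y * y / 2) by field.
replace (s * (1 + x) * y) with (s * y + s * y * x) by ring.
repeat split; apply Rabs_le; split; lra.
Qed.

Lemma G2_diff (x1 y1 z1 x2 y2 z2 : R) :
  G2 r s x1 y1 z1 - G2 r s x2 y2 z2
  = (x1 - x2) + r * (z1 - z2) - s * (1 + x1) * (y1 - y2) - s * y2 * (x1 - x2).
Proof. unfold G2. ring. Qed.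

Lemma G3_diff (y1 z1 y2 z2 : R) :
  G3 s y1 z1 - G3 s y2 z2 = (y1 - y2) - (z1 - z2) - s / 2 * (y1 + y2) * (y1 - y2).
Proof. unfold G3. field. Qed.

(** * Well-posedness of the clamped system *)

(** The coefficients are controlled only in the box, outside of which the temperature may even be
    negative. Projecting the arguments to the box gives a bounded, globally Lipschitz field with
    global solutions; for an orbit inside the box the two systems agree. *)
Definition clamped_field (w : coord -> R) (i : coord) : R :=
  let x := clamp X (w Cx) in let y := clamp X (w Cy) in let z := clamp Z (w Cz) in
  match i with
  | Cx => a x z * G1 x y
  | Cy => b x z * G2 r s x y z
  | Cz => d x z * G3 s y z
  end.

Lemma clamped_in_box (x y z : R) : in_box r X (clamp X x) (clamp X y) (clamp Z z).
Proof.
pose proof z_end_bounds. repeat split; apply clamp_range; fold Z; lra.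
Qed.

(** The product rule gives hi Lip(G) + 2 L sup |G|; the worst field is [G2], with Lip(G) = 4 (1 + r)
    and sup |G| at most 3 (1 + r). *)
Definition lip : R := 6 * (hi + L) * (1 + r).

Lemma lip_pos : 0 < lip.
Proof. unfold lip. repeat apply Rmult_lt_0_compat; lra. Qed.

Lemma field_lipschitz (x1 y1 z1 x2 y2 z2 e : R) :
  in_box r X x1 y1 z1 -> in_box r X x2 y2 z2 ->
  Rabs (x1 - x2) <= e -> Rabs (y1 - y2) <= e -> Rabs (z1 - z2) <= e ->
  Rabs (a x1 z1 * G1 x1 y1 - a x2 z2 * G1 x2 y2) <= lip * e /\
  Rabs (b x1 z1 * G2 r s x1 y1 z1 - b x2 z2 * G2 r s x2 y2 z2) <= lip * e /\
  Rabs (d x1 z1 * G3 s y1 z1 - d x2 z2 * G3 s y2 z2) <= lip * e.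
Proof.
intros B1 B2 Ex Ey Ez.
destruct (G_bounds x2 y2 z2 B2) as (g1 & g2 & g3).
destruct B1 as (Bx1 & By1 & Bz1). destruct B2 as (Bx2 & By2 & Bz2).
fold Z in Bz1, Bz2.
pose proof slope_bounds. pose proof X_lt_1. pose proof slope_X_le_1.
assert (He : 0 <= e) by (pose proof (Rabs_pos (x1 - x2)); lra).
assert (Hc : forall q p1 p2 A B, coefficient_ok lo hi L X Z q ->
  0 <= A -> Rabs (p1 - p2) <= A * e -> Rabs p2 <= B ->
  Rabs (q x1 z1 * p1 - q x2 z2 * p2) <= (hi * A + 2 * L * B) * e).
{ intros q p1 p2 A B [Q1 Q2] HA Hp HB.
  eapply Rle_trans; [apply Rabs_prod_diff |].
  specialize (Q1 x1 z1 Bx1 Bz1). specialize (Q2 x1 z1 x2 z2 Bx1 Bz1 Bx2 Bz2).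
  rewrite (Rabs_pos_eq (q x1 z1)) by lra.
  assert (q x1 z1 * Rabs (p1 - p2) <= hi * (A * e)).
  { apply Rmult_le_compat; [lra | apply Rabs_pos | lra | exact Hp]. }
  assert (Rabs (q x1 z1 - q x2 z2) * Rabs p2 <= (L * (2 * e)) * B).
  { apply Rmult_le_compat; [apply Rabs_pos | apply Rabs_pos | | exact HB].
    eapply Rle_trans; [exact Q2 |]. apply Rmult_le_compat_l; lra. }
  lra. }
apply Rabs_le_between in Ex, Ey, Ez.
assert (0 <= s * y2 <= 1 + r) by (split; nra).
assert (Hsy : 0 <= s * (1 + x1) <= 2 * (1 + r)) by (split; nra).
assert (Hs3 : 0 <= s / 2 * (y1 + y2) <= 1) by (split; nra).
assert (Hfin : forall A B, 0 <= A <= 6 * (1 + r) -> 0 <= B <= 3 * (1 + r) -> (hi * A + 2 * L * B) * e <= lip * e).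
{ intros A B HA HB. apply Rmult_le_compat_r; [exact He |]. unfold lip. nra. }
repeat split.
- eapply Rle_trans; [apply (Hc a _ _ 2 1 Ha); [lra | | lra] | apply Hfin; lra].
  unfold G1. apply Rabs_le; lra.
- eapply Rle_trans; [apply (Hc b _ _ (4 * (1 + r)) (3 * (1 + r)) Hb); [lra | | nra] | apply Hfin; lra].
  rewrite G2_diff. apply Rabs_le. split; nra.
- eapply Rle_trans; [apply (Hc d _ _ 3 2 Hd); [lra | | nra] | apply Hfin; lra].
  rewrite G3_diff. apply Rabs_le. split; nra.
Qed.

Definition clamped_solution (x y z : R -> R) : Prop :=
  forall t,
  let x' := clamp X (x t) in let y' := clamp X (y t) in let z' := clamp Z (z t) in
  is_derive x t (a x' z' * G1 x' y') /\
  is_derive y t (b x' z' * G2 r s x' y' z') /\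
  is_derive z t (d x' z' * G3 s y' z').

Lemma clamped_solution_exists (x0 y0 z0 : R) :
  exists x y z, clamped_solution x y z /\ x 0 = x0 /\ y 0 = y0 /\ z 0 = z0.
Proof.
destruct (picard_existence coord clamped_field lip (3 * hi * (1 + r))
  (fun i => match i with Cx => x0 | Cy => y0 | Cz => z0 end)) as [W [W0 HW]].
- apply lip_pos.
- intros p q e He i.
  destruct (field_lipschitz (clamp X (p Cx)) (clamp X (p Cy)) (clamp Z (p Cz))
    (clamp X (q Cx)) (clamp X (q Cy)) (clamp Z (q Cz)) e) as (F1 & F2 & F3);
    try apply clamped_in_box;
    try (eapply Rle_trans; [apply clamp_lipschitz | apply He]).
  destruct i; assumption.
- intros p i.
  pose proof (clamped_in_box (p Cx) (p Cy) (p Cz)) as B.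
  destruct (G_bounds _ _ _ B) as (g1 & g2 & g3). pose proof X_lt_1.
  destruct B as (Bx & By & Bz). fold Z in Bz.
  assert (Hc : forall q g, coefficient_ok lo hi L X Z q -> Rabs g <= 3 * (1 + r) * X ->
    Rabs (q (clamp X (p Cx)) (clamp Z (p Cz)) * g) <= 3 * hi * (1 + r)).
  { intros q g [Q1 _] Hg. specialize (Q1 _ _ Bx Bz). rewrite Rabs_mult, (Rabs_pos_eq (q _ _)) by lra.
    replace (3 * hi * (1 + r)) with (hi * (3 * (1 + r))) by ring.
    apply Rmult_le_compat; [lra | apply Rabs_pos | lra |]. nra. }
  destruct i; simpl; apply Hc; try assumption; nra.
- exists (fun t => W t Cx), (fun t => W t Cy), (fun t => W t Cz).
  split; [| split; [apply (W0 Cx) | split; [apply (W0 Cy) | apply (W0 Cz)]]].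
  intros t. split; [apply (HW t Cx) | split; [apply (HW t Cy) | apply (HW t Cz)]].
Qed.

Lemma clamped_of_normalised (x y z : R -> R) :
  normalised_solution r X a b d x y z -> (forall t, in_box r X (x t) (y t) (z t)) ->
  clamped_solution x y z.
Proof.
intros H B t. destruct (B t) as (Bx & By & Bz). fold Z in Bz.
simpl. rewrite !clamp_id by assumption. apply H.
Qed.

Lemma clamped_solution_at (x y z : R -> R) (t : R) :
  clamped_solution x y z -> in_box r X (x t) (y t) (z t) ->
  is_derive x t (a (x t) (z t) * G1 (x t) (y t)) /\
  is_derive y t (b (x t) (z t) * G2 r s (x t) (y t) (z t)) /\
  is_derive z t (d (x t) (z t) * G3 s (y t) (z t)).
Proof.
intros H (Bx & By & Bz). fold Z in Bz. specialize (H t). simpl in H.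
rewrite !clamp_id in H by assumption. exact H.
Qed.

Lemma clamped_shift (x y z : R -> R) (h : R) :
  clamped_solution x y z ->
  clamped_solution (fun t => x (t + h)) (fun t => y (t + h)) (fun t => z (t + h)).
Proof.
assert (Hs : forall (f : R -> R) (t l : R), is_derive f (t + h) l -> is_derive (fun t => f (t + h)) t l).
{ intros f t l Hf. evar_last.
  - apply (is_derive_comp f (fun t => t + h) t l 1 Hf). auto_derive; [exact I | ring].
  - unfold scal; simpl; unfold mult; simpl. ring. }
intros H t. destruct (H (t + h)) as (D1 & D2 & D3).
split; [| split]; apply Hs; assumption.
Qed.

(** Gronwall for the squared distance E in both time directions. With e the sum of the absolute
    differences, |E'| <= 2 lip e^2 and e^2 <= 3 E, hence the factor 6. *)
Lemma clamped_dependence (x1 y1 z1 x2 y2 z2 : R -> R) (t : R) :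
  clamped_solution x1 y1 z1 -> clamped_solution x2 y2 z2 ->
  (x1 t - x2 t) ^ 2 + (y1 t - y2 t) ^ 2 + (z1 t - z2 t) ^ 2
  <= ((x1 0 - x2 0) ^ 2 + (y1 0 - y2 0) ^ 2 + (z1 0 - z2 0) ^ 2) * exp (6 * lip * Rabs t).
Proof.
intros S1 S2.
set (E := fun t => (x1 t - x2 t) ^ 2 + (y1 t - y2 t) ^ 2 + (z1 t - z2 t) ^ 2).
change (E t <= E 0 * exp (6 * lip * Rabs t)).
set (dE := fun t => 2 * (x1 t - x2 t) * (Derive x1 t - Derive x2 t)
  + 2 * (y1 t - y2 t) * (Derive y1 t - Derive y2 t)
  + 2 * (z1 t - z2 t) * (Derive z1 t - Derive z2 t)).
assert (HE : forall t, is_derive E t (dE t)).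
{ intros q. destruct (S1 q) as (D1 & D2 & D3). destruct (S2 q) as (D4 & D5 & D6).
  unfold E, dE. auto_derive.
  - repeat split; eexists; eassumption.
  - eta_functions. unfold Rminus; ring. }
assert (HdE : forall t, Rabs (dE t) <= 6 * lip * E t).
{ intros q. destruct (S1 q) as (D1 & D2 & D3). destruct (S2 q) as (D4 & D5 & D6).
  unfold dE.
  rewrite (is_derive_unique x1 q _ D1), (is_derive_unique y1 q _ D2), (is_derive_unique z1 q _ D3),
    (is_derive_unique x2 q _ D4), (is_derive_unique y2 q _ D5), (is_derive_unique z2 q _ D6).
  set (dx := x1 q - x2 q). set (dy := y1 q - y2 q). set (dz := z1 q - z2 q).
  set (e := Rabs dx + Rabs dy + Rabs dz).
  pose proof (Rabs_pos dx). pose proof (Rabs_pos dy). pose proof (Rabs_pos dz).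
  destruct (field_lipschitz (clamp X (x1 q)) (clamp X (y1 q)) (clamp Z (z1 q))
    (clamp X (x2 q)) (clamp X (y2 q)) (clamp Z (z2 q)) e) as (F1 & F2 & F3);
    try apply clamped_in_box;
    try (eapply Rle_trans; [apply clamp_lipschitz |]; fold dx dy dz; unfold e; lra).
  match type of F1 with Rabs ?u <= _ => set (f1 := u) in * end.
  match type of F2 with Rabs ?u <= _ => set (f2 := u) in * end.
  match type of F3 with Rabs ?u <= _ => set (f3 := u) in * end.
  assert (He2 : e * e <= 3 * E q).
  { unfold E. fold dx dy dz. rewrite <- (pow2_abs dx), <- (pow2_abs dy), <- (pow2_abs dz). unfold e.
    pose proof (pow2_ge_0 (Rabs dx - Rabs dy)). pose proof (pow2_ge_0 (Rabs dx - Rabs dz)).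
    pose proof (pow2_ge_0 (Rabs dy - Rabs dz)). lra. }
  pose proof lip_pos as Hl.
  assert (Hp : forall u f, Rabs f <= lip * e -> Rabs (2 * u * f) <= 2 * Rabs u * (lip * e)).
  { intros u f Hf. rewrite !Rabs_mult, (Rabs_pos_eq 2) by lra.
    apply Rmult_le_compat_l; [pose proof (Rabs_pos u); lra | exact Hf]. }
  apply Rle_trans with (2 * Rabs dx * (lip * e) + 2 * Rabs dy * (lip * e) + 2 * Rabs dz * (lip * e)).
  - eapply Rle_trans; [apply Rabs_triang |]. apply Rplus_le_compat; [| apply Hp; exact F3].
    eapply Rle_trans; [apply Rabs_triang |]. apply Rplus_le_compat; apply Hp; assumption.
  - replace (2 * Rabs dx * (lip * e) + 2 * Rabs dy * (lip * e) + 2 * Rabs dz * (lip * e))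
      with (2 * lip * (e * e)) by (unfold e; ring). nra. }
destruct (Rle_lt_dec 0 t) as [Ht | Ht].
- rewrite (Rabs_pos_eq t Ht).
  assert (H : (- E 0) * exp (- - (6 * lip) * (t - 0)) <= - E t).
  { apply (exp_growth_lower (fun t => - E t) (fun t => - dE t)); [exact Ht | |].
    - intros q _. apply (is_derive_opp E). apply HE.
    - intros q _. specialize (HdE q). apply Rabs_le_between in HdE. lra. }
  rewrite Ropp_involutive, Rminus_0_r in H. lra.
- rewrite (Rabs_left t Ht).
  assert (H : E t * exp (- (6 * lip) * (0 - t)) <= E 0).
  { apply (exp_growth_lower E dE); [lra | |].
    - intros q _. apply HE.
    - intros q _. specialize (HdE q). apply Rabs_le_between in HdE. lra. }
  apply (Rmult_le_compat_r (exp (6 * lip * - t))) in H; [| left; apply exp_pos].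
  rewrite Rmult_assoc, <- exp_plus in H.
  replace (- (6 * lip) * (0 - t) + 6 * lip * - t) with (0) in H by ring.
  rewrite exp_0 in H. lra.
Qed.

Lemma clamped_unique (x1 y1 z1 x2 y2 z2 : R -> R) (t0 t : R) :
  clamped_solution x1 y1 z1 -> clamped_solution x2 y2 z2 ->
  x1 t0 = x2 t0 -> y1 t0 = y2 t0 -> z1 t0 = z2 t0 ->
  x1 t = x2 t /\ y1 t = y2 t /\ z1 t = z2 t.
Proof.
intros S1 S2 Ex Ey Ez.
pose proof (clamped_dependence _ _ _ _ _ _ (t - t0) (clamped_shift _ _ _ t0 S1) (clamped_shift _ _ _ t0 S2)) as H.
simpl in H. rewrite Rplus_0_l, Ex, Ey, Ez in H. replace (t - t0 + t0) with t in H by ring.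
rewrite !Rmult_1_r in H. 
match type of H with _ <= ?u => replace u with 0 in H by ring end.
pose proof (Rle_0_sqr (x1 t - x2 t)) as Q1. pose proof (Rle_0_sqr (y1 t - y2 t)) as Q2.
pose proof (Rle_0_sqr (z1 t - z2 t)) as Q3. unfold Rsqr in *.
repeat split; apply Rminus_diag_uniq, Rsqr_0_uniq; unfold Rsqr; lra.
Qed.

(** * The region of monotone motion and its forward invariance *)

(** Keeps the off-diagonal factor 1 - s y strictly positive in the box, as strict monotonicity of
    the profile requires. *)
Lemma slope_X_lt_1 : s * X < 1.
Proof.
pose proof slope_eq as H. pose proof slope_bounds as [Hs _].
assert (0 < (r + 2) * X) by (apply Rmult_lt_0_compat; lra).
assert (0 < s * ((r + 2) * X)) by (apply Rmult_lt_0_compat; lra).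
assert (s < 1 + r) by lra.
apply Rlt_le_trans with ((1 + r) * X); [apply Rmult_lt_compat_r; lra | exact HXr].
Qed.

Lemma is_derive_G1 (x y : R -> R) (t dx dy : R) :
  is_derive x t dx -> is_derive y t dy ->
  is_derive (fun t => G1 (x t) (y t)) t (dy - dx).
Proof. intros Dx Dy. apply (is_derive_minus y x); assumption. Qed.

Lemma is_derive_G2 (x y z : R -> R) (t dx dy dz : R) :
  is_derive x t dx -> is_derive y t dy -> is_derive z t dz ->
  is_derive (fun t => G2 r s (x t) (y t) (z t)) t
    (dx + r * dz - s * (1 + x t) * dy - s * y t * dx).
Proof.
intros Dx Dy Dz. unfold G2. auto_derive.
- repeat split; eexists; eassumption.
- eta_functions. rewrite (is_derive_unique _ _ _ Dx), (is_derive_unique _ _ _ Dy), (is_derive_unique _ _ _ Dz).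
  ring.
Qed.

Lemma is_derive_G3 (y z : R -> R) (t dy dz : R) :
  is_derive y t dy -> is_derive z t dz ->
  is_derive (fun t => G3 s (y t) (z t)) t (dy - dz - s * y t * dy).
Proof.
intros Dy Dz. unfold G3. auto_derive.
- repeat split; eexists; eassumption.
- eta_functions. rewrite (is_derive_unique _ _ _ Dy), (is_derive_unique _ _ _ Dz). field.
Qed.

Definition monotone_region (x y z : R) : Prop :=
  in_box r X x y z /\ 0 <= G1 x y /\ 0 <= G2 r s x y z /\ 0 <= G3 s y z.

Definition open_region (x y z : R) : Prop :=
  (0 < x < X /\ 0 < y < X /\ 0 < z < Z) /\ 0 < G1 x y /\ 0 < G2 r s x y z /\ 0 < G3 s y z.

Lemma open_monotone_region (x y z : R) : open_region x y z -> monotone_region x y z.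
Proof.
intros ((Hx & Hy & Hz) & H1 & H2 & H3). unfold monotone_region, in_box. fold Z.
repeat split; lra.
Qed.

(** Bounds the damping in all three fields; the largest term is s (1 + x) b in the derivative of
    [G2], with s <= 1 + r, 1 + x <= 2 and b <= hi. *)
Definition rate : R := 2 * hi * (1 + r).

(* The system is cooperative: the derivatives of the three fields along a
   solution are combinations of the fields with nonnegative off-diagonal
   coefficients. *)
Lemma field_derivative_bounds (x y z : R) :
  monotone_region x y z ->
  let dx := a x z * G1 x y in let dy := b x z * G2 r s x y z in
  let dz := d x z * G3 s y z in
  - rate * G1 x y <= dy - dx /\
  - rate * G2 r s x y z <= dx + r * dz - s * (1 + x) * dy - s * y * dx /\
  - rate * G3 s y z <= dy - dz - s * y * dy.
Proof.
intros ((Bx & By & Bz) & H1 & H2 & H3). fold Z in Bz. simpl.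
destruct Ha as [Ba _]. destruct Hb as [Bb _]. destruct Hd as [Bd _].
specialize (Ba x z Bx Bz). specialize (Bb x z Bx Bz). specialize (Bd x z Bx Bz).
pose proof slope_bounds. pose proof X_lt_1. pose proof slope_X_lt_1.
set (g1 := G1 x y) in *. set (g2 := G2 r s x y z) in *. set (g3 := G3 s y z) in *.
assert (Hsy : s * y <= s * X) by (apply Rmult_le_compat_l; lra).
assert (Hrate : hi <= rate) by (assert (0 < hi * r) by (apply Rmult_lt_0_compat; lra); unfold rate; lra).
assert (A1 : 0 <= a x z * g1 <= rate * g1).
{ split; [apply Rmult_le_pos; lra | apply Rmult_le_compat_r; lra]. }
assert (A3 : 0 <= d x z * g3 <= rate * g3).
{ split; [apply Rmult_le_pos; lra | apply Rmult_le_compat_r; lra]. }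
assert (A2 : 0 <= b x z * g2) by (apply Rmult_le_pos; lra).
assert (A4 : s * (1 + x) * (b x z * g2) <= rate * g2).
{ rewrite <- Rmult_assoc. apply Rmult_le_compat_r; [lra |].
  replace rate with (((1 + r) * 2) * hi) by (unfold rate; ring).
  apply Rmult_le_compat; [apply Rmult_le_pos; lra | lra | apply Rmult_le_compat; lra | lra]. }
repeat split.
- lra.
- assert (0 <= (1 - s * y) * (a x z * g1)) by (apply Rmult_le_pos; lra).
  assert (0 <= r * (d x z * g3)) by (apply Rmult_le_pos; lra). lra.
- assert (0 <= (1 - s * y) * (b x z * g2)) by (apply Rmult_le_pos; lra). lra.
Qed.

(** The region is cut out by nine positive functions, which are fed together to [quasipositive]: the
    lower bound for each derivative uses the positivity of the others. *)
Lemma open_region_invariant (x y z : R -> R) (T : R) :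
  clamped_solution x y z -> open_region (x 0) (y 0) (z 0) -> 0 <= T ->
  open_region (x T) (y T) (z T).
Proof.
intros Sol H0 HT.
set (dx := Derive x). set (dy := Derive y). set (dz := Derive z).
assert (HD : forall t, is_derive x t (dx t) /\ is_derive y t (dy t) /\ is_derive z t (dz t)).
{ intros t. destruct (Sol t) as (E1 & E2 & E3).
  split; [| split]; apply Derive_correct; eexists; eassumption. }
assert (Dx := fun t => proj1 (HD t)). assert (Dy := fun t => proj1 (proj2 (HD t))).
assert (Dz := fun t => proj2 (proj2 (HD t))). clear HD.
assert (Dc : forall (f : R -> R) c t l, is_derive f t l -> is_derive (fun t => c - f t) t (- l)).
{ intros f c t l Hf. evar_last.
  - apply (is_derive_minus (fun _ => c) f); [apply (is_derive_const c) | exact Hf].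
  - unfold minus, plus, opp, zero; simpl. ring. }
assert (H := quasipositive
  [(x, dx); (y, dy); (z, dz);
   (fun t => X - x t, fun t => - dx t); (fun t => X - y t, fun t => - dy t);
   (fun t => Z - z t, fun t => - dz t);
   (fun t => G1 (x t) (y t), fun t => dy t - dx t);
   (fun t => G2 r s (x t) (y t) (z t),
    fun t => dx t + r * dz t - s * (1 + x t) * dy t - s * y t * dx t);
   (fun t => G3 s (y t) (z t), fun t => dy t - dz t - s * y t * dy t)]
  rate T HT).
assert (Hconv : forall t,
  Forall (fun s => 0 < fst s t)
  [(x, dx); (y, dy); (z, dz);
   (fun t => X - x t, fun t => - dx t); (fun t => X - y t, fun t => - dy t);
   (fun t => Z - z t, fun t => - dz t);
   (fun t => G1 (x t) (y t), fun t => dy t - dx t);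
   (fun t => G2 r s (x t) (y t) (z t),
    fun t => dx t + r * dz t - s * (1 + x t) * dy t - s * y t * dx t);
   (fun t => G3 s (y t) (z t), fun t => dy t - dz t - s * y t * dy t)]
  <-> open_region (x t) (y t) (z t)).
{ intros t. rewrite !Forall_cons_iff. unfold open_region. simpl. split.
  - intros (? & ? & ? & ? & ? & ? & ? & ? & ? & _). repeat split; lra.
  - intros ((? & ? & ?) & ? & ? & ?). repeat split; try lra. constructor. }
apply Hconv. eapply Forall_impl; [| apply H with (t := T)]; [intros p [Hp _]; exact Hp | | | | lra].
- intros t _. rewrite !Forall_cons_iff. simpl.
  split; [apply Dx |]. split; [apply Dy |]. split; [apply Dz |].
  split; [apply Dc, Dx |]. split; [apply Dc, Dy |]. split; [apply Dc, Dz |].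
  split; [apply is_derive_G1; auto |]. split; [apply is_derive_G2; auto |].
  split; [apply is_derive_G3; auto | constructor].
- apply Hconv, H0.
- intros t _ Hpos. apply Hconv in Hpos.
  assert (Hm := open_monotone_region _ _ _ Hpos).
  destruct (clamped_solution_at x y z t Sol (proj1 Hm)) as (E1 & E2 & E3).
  destruct (field_derivative_bounds _ _ _ Hm) as (F1 & F2 & F3).
  apply is_derive_unique in E1, E2, E3. fold dx in E1. fold dy in E2. fold dz in E3.
  change (Derive x t) with (dx t) in E1. change (Derive y t) with (dy t) in E2.
  change (Derive z t) with (dz t) in E3.
  rewrite !Forall_cons_iff. simpl. rewrite E1, E2, E3.
  destruct Hpos as ((Bx & By & Bz) & P1 & P2 & P3).
  destruct Hm as ((Cx' & Cy' & Cz') & _). fold Z in Cz'.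
  destruct Ha as [Ba _]. destruct Hb as [Bb _]. destruct Hd as [Bd _].
  specialize (Ba _ _ Cx' Cz'). specialize (Bb _ _ Cx' Cz'). specialize (Bd _ _ Cx' Cz').
  pose proof slope_bounds as Hs. pose proof slope_X_lt_1 as HsX. pose proof X_lt_1 as HX1.
  pose proof rest_point_eq as HR. pose proof z_end_eq as HZ.
  assert (Hrate : hi <= rate) by (assert (0 < hi * r) by (apply Rmult_lt_0_compat; lra); unfold rate; lra).
  assert (Hrp : 0 < rate) by lra.
  assert (Q1 : 0 < a (x t) (z t) * G1 (x t) (y t)) by (apply Rmult_lt_0_compat; lra).
  assert (Q2 : 0 < b (x t) (z t) * G2 r s (x t) (y t) (z t)) by (apply Rmult_lt_0_compat; lra).
  assert (Q3 : 0 < d (x t) (z t) * G3 s (y t) (z t)) by (apply Rmult_lt_0_compat; lra).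
  assert (Hneg : forall u, 0 < u -> - rate * u <= 0) by (intros u Hu; nra).
  (* Serves the three distances [u] to the upper rest point: it is enough that the field is at most
     a multiple c of that distance. *)
  assert (Hq : forall q g u c, lo <= q <= hi -> 0 < u -> 0 <= c <= 2 * (1 + r) -> - g >= - (c * u) -> - rate * u <= - (q * g)).
  { intros q g u c Hq Hu Hc Hg.
    assert (q * g <= q * (c * u)) by (apply Rmult_le_compat_l; lra).
    assert (q * (c * u) <= hi * ((2 * (1 + r)) * u)).
    { apply Rmult_le_compat; [lra | apply Rmult_le_pos; lra | lra | apply Rmult_le_compat_r; lra]. }
    unfold rate. lra. }
  repeat split; try exact F1; try exact F2; try exact F3; try apply Forall_nil.
  + apply Rle_trans with 0; [apply Hneg |]; lra.
  + apply Rle_trans with 0; [apply Hneg |]; lra.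
  + apply Rle_trans with 0; [apply Hneg |]; lra.
  + apply Hq with 1; [exact Ba | lra | lra |]. unfold G1. lra.
  (* Since [G2] vanishes at the upper rest point, G2 = s (1 + x) (X - y) - (1 - s X) (X - x) - r (Z
     - z), and the last two terms are nonpositive. *)
  + apply Hq with (s * (1 + x t)); [exact Bb | lra | |].
    * replace (2 * (1 + r)) with ((1 + r) * 2) by ring. apply Rmult_range; lra.
    * assert (0 <= (1 - s * X) * (X - x t)) by (apply Rmult_le_pos; lra).
      assert (0 <= r * (Z - z t)) by (apply Rmult_le_pos; lra).
      unfold G2. apply Rle_ge. lra.
  + apply Hq with 1; [exact Bd | lra | lra |].
    assert (0 <= (1 - s / 2 * (X + y t)) * (X - y t)).
    { apply Rmult_le_pos; [| lra].
      assert (s * y t <= s * X) by (apply Rmult_le_compat_l; lra). lra. }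
    unfold G3. apply Rle_ge. lra.
Qed.

(** * Backward expansion of the transverse difference *)

(** The expression bounded is half of Q'. Each field difference is split into its linear part for s
    = 1 + r at the origin, with coefficients frozen at the first point, and a remainder of order
    X. *)
Lemma cone_derivative (x1 y1 z1 x2 y2 z2 : R) :
  in_box r X x1 y1 z1 -> in_box r X x2 y2 z2 ->
  let x := x1 - x2 in
  let g := (y1 - y2) - (x1 - x2) in
  let h := (y1 - y2) - (z1 - z2) in
  let f1 := a x1 z1 * G1 x1 y1 - a x2 z2 * G1 x2 y2 in
  let f2 := b x1 z1 * G2 r s x1 y1 z1 - b x2 z2 * G2 r s x2 y2 z2 in
  let f3 := d x1 z1 * G3 s y1 z1 - d x2 z2 * G3 s y2 z2 in
  0 <= g ^ 2 + r * h ^ 2 - lo / (4 * hi) * x ^ 2 ->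
  g * (f2 - f1) + r * h * (f2 - f3) - lo / (4 * hi) * (x * f1)
  <= - (lo / 4) * (g ^ 2 + r * h ^ 2 - lo / (4 * hi) * x ^ 2).
Proof.
intros B1 B2 x g h f1 f2 f3 HQ.
destruct (G_bounds x2 y2 z2 B2) as (g1 & g2 & g3).
destruct B1 as (Bx1 & By1 & Bz1). destruct B2 as (Bx2 & By2 & Bz2).
fold Z in Bz1, Bz2.
pose proof slope_bounds as Hs. pose proof X_lt_1. pose proof slope_X_lt_1 as HsX. pose proof slope_eq as Hse.
set (N := Rabs x + Rabs g + Rabs h).
assert (Hy : y1 - y2 = x + g) by (unfold x, g; ring).
assert (Hz : z1 - z2 = x + g - h) by (unfold x, g, h; ring).
pose proof (Rabs_pos x). pose proof (Rabs_pos g). pose proof (Rabs_pos h).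
assert (HN : 0 <= N) by (unfold N; lra).
assert (HyN : Rabs (x + g) <= N).
{ eapply Rle_trans; [apply Rabs_triang |]. unfold N. lra. }
assert (HxN : Rabs x <= N) by (unfold N; lra).
assert (HD : Rabs x + Rabs (z1 - z2) <= 2 * N).
{ rewrite Hz. unfold Rminus. assert (Rabs (x + g + - h) <= N); [| lra].
  eapply Rle_trans; [apply Rabs_triang |]. rewrite Rabs_Ropp.
  pose proof (Rabs_triang x g). unfold N. lra. }
assert (Hcf : forall q p B, coefficient_ok lo hi L X Z q -> Rabs p <= B ->
  Rabs ((q x1 z1 - q x2 z2) * p) <= 2 * L * B * N).
{ intros q p B [_ Q2] Hp. rewrite Rabs_mult. specialize (Q2 x1 z1 x2 z2 Bx1 Bz1 Bx2 Bz2). fold x in Q2.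
  replace (2 * L * B * N) with (L * (2 * N) * B) by ring.
  apply Rmult_le_compat; [apply Rabs_pos | apply Rabs_pos | | exact Hp].
  eapply Rle_trans; [exact Q2 |]. apply Rmult_le_compat_l; lra. }
(* Remainders come from varying coefficients, where a field of size O(X) is the other factor, and
   from the nonlinear terms. In [e2] the defect 1 + r - s is also O(X): it equals s (r + 2) X /
   2. *)
set (e1 := (a x1 z1 - a x2 z2) * G1 x2 y2).
set (e2 := b x1 z1 * ((1 + r - s - s * x1) * (x + g) - s * y2 * x) + (b x1 z1 - b x2 z2) * G2 r s x2 y2 z2).
set (e3 := d x1 z1 * (- (s / 2 * (y1 + y2) * (x + g))) + (d x1 z1 - d x2 z2) * G3 s y2 z2).
assert (F1 : f1 = a x1 z1 * g + e1).
{ unfold f1, e1, g, x, G1. ring. }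
assert (F2 : f2 = - b x1 z1 * (g + r * h) + e2).
{ replace f2 with (b x1 z1 * (G2 r s x1 y1 z1 - G2 r s x2 y2 z2) + (b x1 z1 - b x2 z2) * G2 r s x2 y2 z2)
    by (unfold f2; ring).
  rewrite G2_diff, Hy, Hz. fold x. unfold e2. ring. }
assert (F3 : f3 = d x1 z1 * h + e3).
{ replace f3 with (d x1 z1 * (G3 s y1 z1 - G3 s y2 z2) + (d x1 z1 - d x2 z2) * G3 s y2 z2)
    by (unfold f3; ring).
  rewrite G3_diff, Hy, Hz. unfold e3. ring. }
destruct (Ha) as [Qa _]. destruct (Hb) as [Qb _]. destruct (Hd) as [Qd _].
specialize (Qa _ _ Bx1 Bz1). specialize (Qb _ _ Bx1 Bz1). specialize (Qd _ _ Bx1 Bz1).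
(* A common bound: the largest contributions are hi (1 + r) ((r + 2) / 2 + 2) and 6 L (1 + r), both
   from [e2]. *)
set (w := (hi + L) * ((1 + r) * (r + 6)) * X).
assert (HXN : 0 <= X * N) by (apply Rmult_le_pos; lra).
assert (Hw0 : 0 <= w) by (unfold w; repeat apply Rmult_le_pos; lra).
assert (Hwk : forall A B, 0 <= A <= (1 + r) * (r + 6) -> 0 <= B <= (1 + r) * (r + 6) ->
  (hi * A + L * B) * (X * N) <= w * N).
{ intros A B HA HB. unfold w.
  replace ((hi + L) * ((1 + r) * (r + 6)) * X * N) with ((hi * ((1 + r) * (r + 6)) + L * ((1 + r) * (r + 6))) * (X * N)) by ring.
  apply Rmult_le_compat_r; [exact HXN |]. apply Rplus_le_compat; apply Rmult_le_compat_l; lra. }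
assert (Hrr : 6 * (1 + r) <= (1 + r) * (r + 6)) by nra.
replace (g * (f2 - f1) + r * h * (f2 - f3) - lo / (4 * hi) * (x * f1))
  with ((g + r * h) * f2 - g * f1 - r * h * f3 - lo / (4 * hi) * (x * f1)) by ring.
rewrite F1, F2, F3.
apply (cone_decay r lo hi _ _ _ _ _ _ _ _ _ w); try lra; fold N.
- split; [exact Hw0 | exact HXc].
- eapply Rle_trans; [apply (Hcf a _ X Ha g1) |].
  eapply Rle_trans; [| apply (Hwk 0 2); nra]. right; ring.
- unfold e2. eapply Rle_trans; [apply Rabs_triang |].
  eapply Rle_trans; [apply Rplus_le_compat; [| apply (Hcf b _ _ Hb g2)] |].
  { rewrite Rabs_mult, (Rabs_pos_eq (b x1 z1)) by lra.
    apply Rmult_le_compat with (r2 := hi) (r4 := (1 + r) * ((r + 2) / 2 + 2) * (X * N)); [lra | apply Rabs_pos | lra |].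
    unfold Rminus at 1. eapply Rle_trans; [apply Rabs_triang |]. rewrite Rabs_Ropp, !Rabs_mult.
    rewrite (Rabs_pos_eq s), (Rabs_pos_eq y2) by lra.
    assert (K1 : Rabs (1 + r - s - s * x1) <= (1 + r) * ((r + 2) / 2 + 1) * X).
    { assert (0 <= s * ((r + 2) / 2 * X) <= (1 + r) * ((r + 2) / 2 * X)).
      { apply Rmult_range; [lra |]. split; [apply Rmult_le_pos |]; lra. }
      assert (0 <= s * x1 <= (1 + r) * X) by (apply Rmult_range; lra).
      apply Rabs_le. lra. }
    assert (K2 : s * y2 <= (1 + r) * X) by (apply Rmult_le_compat; lra).
    assert (Rabs (1 + r - s - s * x1) * Rabs (x + g) <= ((1 + r) * ((r + 2) / 2 + 1) * X) * N).
    { apply Rmult_le_compat; auto using Rabs_pos. }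
    assert (s * y2 * Rabs x <= ((1 + r) * X) * N).
    { apply Rmult_le_compat; auto using Rabs_pos. apply Rmult_le_pos; lra. }
    lra. }
  eapply Rle_trans; [| apply (Hwk ((1 + r) * ((r + 2) / 2 + 2)) (6 * (1 + r)))].
  + right; ring.
  + split; [apply Rmult_le_pos; lra | apply Rmult_le_compat_l; lra].
  + lra.
- unfold e3. eapply Rle_trans; [apply Rabs_triang |].
  eapply Rle_trans; [apply Rplus_le_compat; [| apply (Hcf d _ _ Hd g3)] |].
  { rewrite Rabs_mult, (Rabs_pos_eq (d x1 z1)) by lra.
    apply Rmult_le_compat with (r2 := hi) (r4 := (1 + r) * (X * N)); [lra | apply Rabs_pos | lra |].
    rewrite Rabs_Ropp, Rabs_mult.
    assert (K : 0 <= s / 2 * (y1 + y2) <= (1 + r) / 2 * (2 * X)) by (apply Rmult_range; lra).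
    rewrite (Rabs_pos_eq _ (proj1 K)).
    replace ((1 + r) * (X * N)) with ((1 + r) / 2 * (2 * X) * N) by field.
    apply Rmult_le_compat; [lra | apply Rabs_pos | lra | exact HyN]. }
  eapply Rle_trans; [| apply (Hwk (1 + r) 4); lra].
  right; ring.
Qed.

(** Equal x at time 0 removes the negative term of Q, so the difference starts in the cone. Backward
    in time Q grows at rate lo / 2 and thereby stays positive, while in the box it is at most 4 (1 +
    r). *)
Lemma backward_expansion (x1 y1 z1 x2 y2 z2 : R -> R) (T : R) :
  clamped_solution x1 y1 z1 -> clamped_solution x2 y2 z2 -> 0 <= T ->
  (forall t, - T <= t <= 0 ->
     in_box r X (x1 t) (y1 t) (z1 t) /\ in_box r X (x2 t) (y2 t) (z2 t)) ->
  x1 0 = x2 0 ->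
  ((y1 0 - y2 0) ^ 2 + r * ((y1 0 - y2 0) - (z1 0 - z2 0)) ^ 2) * exp (lo / 2 * T)
  <= 4 * (1 + r).
Proof.
intros S1 S2 HT HB E0.
set (Q := fun t => ((y1 t - y2 t) - (x1 t - x2 t)) ^ 2 + r * ((y1 t - y2 t) - (z1 t - z2 t)) ^ 2
   - lo / (4 * hi) * (x1 t - x2 t) ^ 2).
set (Q0 := (y1 0 - y2 0) ^ 2 + r * ((y1 0 - y2 0) - (z1 0 - z2 0)) ^ 2).
assert (EQ0 : Q 0 = Q0) by (unfold Q, Q0; rewrite E0; ring).
assert (HQ0 : 0 <= Q0).
{ unfold Q0. pose proof (pow2_ge_0 (y1 0 - y2 0)).
  pose proof (pow2_ge_0 ((y1 0 - y2 0) - (z1 0 - z2 0))). nra. }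
destruct HQ0 as [HQ0 | HQ0]; [| rewrite <- HQ0, Rmult_0_l; lra].
set (dQ := fun t =>
  2 * ((y1 t - y2 t) - (x1 t - x2 t)) * ((Derive y1 t - Derive y2 t) - (Derive x1 t - Derive x2 t))
  + r * (2 * ((y1 t - y2 t) - (z1 t - z2 t)) * ((Derive y1 t - Derive y2 t) - (Derive z1 t - Derive z2 t)))
  - lo / (4 * hi) * (2 * (x1 t - x2 t) * (Derive x1 t - Derive x2 t))).
assert (HdQ : forall t, is_derive Q t (dQ t)).
{ intros q. destruct (S1 q) as (D1 & D2 & D3). destruct (S2 q) as (D4 & D5 & D6).
  unfold Q, dQ. auto_derive.
  - repeat split; eexists; eassumption.
  - eta_functions. unfold Rminus; ring. }
(* [quasipositive] with a single function and the negative constant K = - lo / 2: the growth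
   inequality is available only where Q is positive, and this is what the growth itself
   preserves. *)
assert (H' : Forall (fun p => 0 < fst p T /\ fst p 0 * exp (- - (lo / 2) * T) <= fst p T)
  [(fun t => Q (- t), fun t => - dQ (- t))]).
{ apply quasipositive with (T := T); [exact HT | | | | lra].
  - intros t _. constructor; [| constructor]. simpl. apply is_derive_comp_opp, HdQ.
  - constructor; [| constructor]. simpl. rewrite Ropp_0, EQ0. exact HQ0.
  - intros t Ht Hpos. apply Forall_cons_iff in Hpos. destruct Hpos as [Hpos _].
    constructor; [| constructor]. simpl in *.
    destruct (HB (- t)) as [B1 B2]; [lra |].
    destruct (clamped_solution_at _ _ _ (- t) S1 B1) as (D1 & D2 & D3).
    destruct (clamped_solution_at _ _ _ (- t) S2 B2) as (D4 & D5 & D6).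
    assert (C := cone_derivative _ _ _ _ _ _ B1 B2). simpl in C.
    unfold Q in Hpos. specialize (C (Rlt_le _ _ Hpos)).
    unfold dQ, Q.
    rewrite (is_derive_unique _ _ _ D1), (is_derive_unique _ _ _ D2), (is_derive_unique _ _ _ D3),
      (is_derive_unique _ _ _ D4), (is_derive_unique _ _ _ D5), (is_derive_unique _ _ _ D6).
    lra. }
apply Forall_cons_iff in H'. destruct H' as [[_ H'] _]. simpl in H'.
rewrite Ropp_0, EQ0, Ropp_involutive in H'. eapply Rle_trans; [exact H' |].
destruct (HB (- T)) as [(X1 & Y1 & Z1) (X2 & Y2 & Z2)]; [lra |].
fold Z in Z1, Z2. pose proof X_lt_1. pose proof z_end_bounds.
unfold Q.
assert (HU : forall u v, -1 <= u <= 1 -> -1 <= v <= 1 -> (u - v) ^ 2 <= 4) by (intros; nra).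
assert (U1 := HU (y1 (- T) - y2 (- T)) (x1 (- T) - x2 (- T)) ltac:(lra) ltac:(lra)).
assert (U2 := HU (y1 (- T) - y2 (- T)) (z1 (- T) - z2 (- T)) ltac:(lra) ltac:(lra)).
assert (0 <= lo / (4 * hi) * (x1 (- T) - x2 (- T)) ^ 2).
{ apply Rmult_le_pos; [apply Rdiv_le_0_compat; lra | apply pow2_ge_0]. }
assert (r * (y1 (- T) - y2 (- T) - (z1 (- T) - z2 (- T))) ^ 2 <= r * 4) by (apply Rmult_le_compat_l; lra).
lra.
Qed.

(** * Limits at infinity *)

Lemma is_lim_fields (x y z : R -> R) (p : Rbar) (lx ly lz : R) :
  is_lim x p lx -> is_lim y p ly -> is_lim z p lz ->
  is_lim (fun t => G1 (x t) (y t)) p (G1 lx ly) /\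
  is_lim (fun t => G2 r s (x t) (y t) (z t)) p (G2 r s lx ly lz) /\
  is_lim (fun t => G3 s (y t) (z t)) p (G3 s ly lz).
Proof.
intros Lx Ly Lz.
assert (Hm := fun f g l m => is_lim_mult_finite f g p l m).
assert (Hc : forall c : R, is_lim (fun _ => c) p c) by (intros; apply is_lim_const).
unfold G1, G2, G3. split; [| split].
- apply is_lim_minus'; assumption.
- apply is_lim_minus'.
  + apply is_lim_plus'; [exact Lx | apply Hm; auto].
  + apply Hm; [apply Hm; [auto | apply is_lim_plus'; auto] | exact Ly].
- apply is_lim_minus'; [apply is_lim_minus'; assumption |].
  apply Hm; [auto |]. simpl. apply Hm; [exact Ly | apply Hm; auto].
Qed.

Lemma coefficient_lower (q : R -> R -> R) (x y z : R) :
  coefficient_ok lo hi L X Z q -> in_box r X x y z -> lo <= q x z <= hi.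
Proof. intros [Hq _] (Bx & By & Bz). apply Hq; assumption. Qed.

Lemma monotone_region_derivatives (x y z : R -> R) (t : R) :
  clamped_solution x y z -> monotone_region (x t) (y t) (z t) ->
  0 <= Derive x t /\ 0 <= Derive y t /\ 0 <= Derive z t.
Proof.
intros Sol (B & H1 & H2 & H3).
destruct (clamped_solution_at x y z t Sol B) as (D1 & D2 & D3).
rewrite (is_derive_unique _ _ _ D1), (is_derive_unique _ _ _ D2), (is_derive_unique _ _ _ D3).
pose proof (coefficient_lower a _ _ _ Ha B). pose proof (coefficient_lower b _ _ _ Hb B).
pose proof (coefficient_lower d _ _ _ Hd B).
repeat split; apply Rmult_le_pos; lra.
Qed.

Lemma monotone_region_nondecreasing (x y z : R -> R) (t0 t1 : R) :
  clamped_solution x y z -> t0 <= t1 ->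
  (forall t, t0 <= t <= t1 -> monotone_region (x t) (y t) (z t)) ->
  x t0 <= x t1 /\ y t0 <= y t1 /\ z t0 <= z t1.
Proof.
intros Sol Ht Hm.
split; [| split];
  eapply is_derive_nondecreasing;
  try exact Ht;
  try (intros t Hq; apply Derive_correct; destruct (Sol t) as (D1 & D2 & D3); eexists; eassumption);
  intros t Hq; apply (monotone_region_derivatives x y z t Sol (Hm t Hq)).
Qed.

(** The limits exist by monotonicity. Each field tends to a nonnegative limit by membership in the
    region, and to a nonpositive one because its coordinate stays bounded. *)
Lemma limit_p_rest_point (x y z : R -> R) (t0 : R) :
  clamped_solution x y z ->
  (forall t, t0 <= t -> monotone_region (x t) (y t) (z t)) ->
  exists lx ly lz : R, is_lim x p_infty lx /\ is_lim y p_infty ly /\ is_lim z p_infty lz /\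
    x t0 <= lx /\ G1 lx ly = 0 /\ G2 r s lx ly lz = 0 /\ G3 s ly lz = 0.
Proof.
intros Sol Hm.
assert (Hmono : forall t t', t0 <= t <= t' -> x t <= x t' /\ y t <= y t' /\ z t <= z t').
{ intros t t' Ht. apply monotone_region_nondecreasing; [exact Sol | lra | intros; apply Hm; lra]. }
assert (HB : forall t, t0 <= t -> in_box r X (x t) (y t) (z t)) by (intros t Ht; apply (Hm t Ht)).
assert (Mx : forall t, t0 <= t -> x t <= X) by (intros t Ht; apply (HB t Ht)).
assert (My : forall t, t0 <= t -> y t <= X) by (intros t Ht; apply (HB t Ht)).
assert (Mz : forall t, t0 <= t -> z t <= Z) by (intros t Ht; apply (HB t Ht)).
destruct (nondecreasing_lim_p x t0 X) as (lx & Lx & Lx' & _); [intros; apply Hmono; assumption | exact Mx |].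
destruct (nondecreasing_lim_p y t0 X) as (ly & Ly & _ & _); [intros; apply Hmono; assumption | exact My |].
destruct (nondecreasing_lim_p z t0 Z) as (lz & Lz & _ & _); [intros; apply Hmono; assumption | exact Mz |].
exists lx, ly, lz.
destruct (is_lim_fields x y z p_infty lx ly lz Lx Ly Lz) as (L1 & L2 & L3).
assert (Hd' : forall t, t0 <= t -> _) by (intros t Ht; exact (clamped_solution_at x y z t Sol (HB t Ht))).
assert (Hq : forall q t, coefficient_ok lo hi L X Z q -> t0 <= t -> lo <= q (x t) (z t)).
{ intros q t Hq Ht. apply (coefficient_lower q _ _ _ Hq (HB t Ht)). }
do 3 (split; [assumption |]). split; [apply Lx'; lra |].
split; [| split]; apply Rle_antisym.
- apply (bounded_drift_lim_p x (fun t => G1 (x t) (y t)) (fun t => a (x t) (z t)) t0 X lo); auto.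
  intros t Ht. apply Hd', Ht.
- apply (is_lim_p_ge_0 (fun t => G1 (x t) (y t)) t0); [intros t Ht; apply (Hm t Ht) | exact L1].
- apply (bounded_drift_lim_p y (fun t => G2 r s (x t) (y t) (z t)) (fun t => b (x t) (z t)) t0 X lo); auto.
  intros t Ht. apply Hd', Ht.
- apply (is_lim_p_ge_0 (fun t => G2 r s (x t) (y t) (z t)) t0); [intros t Ht; apply (Hm t Ht) | exact L2].
- apply (bounded_drift_lim_p z (fun t => G3 s (y t) (z t)) (fun t => d (x t) (z t)) t0 Z lo); auto.
  intros t Ht. apply Hd', Ht.
- apply (is_lim_p_ge_0 (fun t => G3 s (y t) (z t)) t0); [intros t Ht; apply (Hm t Ht) | exact L3].
Qed.

Lemma limit_m_rest_point (x y z : R -> R) :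
  clamped_solution x y z ->
  (forall t, monotone_region (x t) (y t) (z t)) ->
  exists lx ly lz : R, is_lim x m_infty lx /\ is_lim y m_infty ly /\ is_lim z m_infty lz /\
    lx <= x 0 /\ G1 lx ly = 0 /\ G2 r s lx ly lz = 0 /\ G3 s ly lz = 0.
Proof.
intros Sol Hm.
assert (Hmono : forall t t', t <= t' -> x t <= x t' /\ y t <= y t' /\ z t <= z t').
{ intros t t' Ht. apply monotone_region_nondecreasing; [exact Sol | lra | intros; apply Hm; lra]. }
assert (HB : forall t, in_box r X (x t) (y t) (z t)) by (intros t; apply (Hm t)).
assert (Mx : forall t, 0 <= x t) by (intros t; apply (HB t)).
assert (My : forall t, 0 <= y t) by (intros t; apply (HB t)).
assert (Mz : forall t, 0 <= z t) by (intros t; apply (HB t)).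
destruct (nondecreasing_lim_m x 0) as (lx & Lx & Lx' & _); [intros; apply Hmono; assumption | exact Mx |].
destruct (nondecreasing_lim_m y 0) as (ly & Ly & _ & _); [intros; apply Hmono; assumption | exact My |].
destruct (nondecreasing_lim_m z 0) as (lz & Lz & _ & _); [intros; apply Hmono; assumption | exact Mz |].
exists lx, ly, lz.
destruct (is_lim_fields x y z m_infty lx ly lz Lx Ly Lz) as (L1 & L2 & L3).
assert (Hd' : forall t, _) by (intros t; exact (clamped_solution_at x y z t Sol (HB t))).
assert (Hq : forall q t, coefficient_ok lo hi L X Z q -> lo <= q (x t) (z t)).
{ intros q t Hq. apply (coefficient_lower q _ _ _ Hq (HB t)). }
do 3 (split; [assumption |]). split; [apply Lx' |].
split; [| split]; apply Rle_antisym.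
- apply (bounded_drift_lim_m x (fun t => G1 (x t) (y t)) (fun t => a (x t) (z t)) 0 lo); auto.
  intros t. apply Hd'.
- apply (is_lim_m_ge_0 (fun t => G1 (x t) (y t))); [intros t; apply (Hm t) | exact L1].
- apply (bounded_drift_lim_m y (fun t => G2 r s (x t) (y t) (z t)) (fun t => b (x t) (z t)) 0 lo); auto.
  intros t. apply Hd'.
- apply (is_lim_m_ge_0 (fun t => G2 r s (x t) (y t) (z t))); [intros t; apply (Hm t) | exact L2].
- apply (bounded_drift_lim_m z (fun t => G3 s (y t) (z t)) (fun t => d (x t) (z t)) 0 lo); auto.
  intros t. apply Hd'.
- apply (is_lim_m_ge_0 (fun t => G3 s (y t) (z t))); [intros t; apply (Hm t) | exact L3].
Qed.

(** * Approximate connecting orbits *)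

(** The point is q (1, 1 + k, 1), a slight tilt of the degenerate diagonal. The tilt k = (r + 2) X /
    8 satisfies s (1 + 4 k) = 1 + r, so that [G2] is q s times (1 + 4 k) - (1 + q) (1 + k), positive
    for small q. *)
Lemma open_region_near_zero (m : R) :
  0 < m -> exists x y z, open_region x y z /\ x + y + z <= m /\ x < X / 2.
Proof.
intros Hm.
pose proof slope_bounds as Hs. pose proof X_lt_1 as HX1. pose proof slope_X_lt_1 as HsX.
pose proof z_end_bounds as HZ. pose proof slope_eq as Hse.
set (k := X * (r + 2) / 8).
assert (Hk8 : 8 * k = X * (r + 2)) by (unfold k; field).
assert (Hk : 0 < k <= 1 / 4).
{ assert (0 < X * r) by (apply Rmult_lt_0_compat; lra). split; lra. }
set (q1 := k / (2 * (1 + r))).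
assert (Hq1 : 0 < q1) by (apply Rdiv_lt_0_compat; lra).
assert (Hq1' : 2 * (1 + r) * q1 = k) by (unfold q1; field; lra).
assert (Hq1k : q1 <= k / 2) by nra.
(* [q1] makes the quadratic term of [G3] at most half of q k; X / 16 keeps the point inside the box
   with x < X / 2; m / 4 bounds the sum, as 3 + k <= 4. *)
set (q := Rmin q1 (Rmin (X / 16) (m / 4))).
assert (H1 : q <= q1) by apply Rmin_l.
assert (H2 : q <= Rmin (X / 16) (m / 4)) by apply Rmin_r.
assert (H3 : q <= X / 16) by (eapply Rle_trans; [exact H2 | apply Rmin_l]).
assert (H4 : q <= m / 4) by (eapply Rle_trans; [exact H2 | apply Rmin_r]).
assert (Hq : 0 < q) by (repeat apply Rmin_glb_lt; lra).
clearbody q. clear H2.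
assert (Hqk : 0 < q * k <= q / 4) by (split; nra).
exists q, (q * (1 + k)), q.
assert (Hkk : (1 + q) * (1 + k) < 1 + 4 * k) by nra.
assert (E2 : s * (1 + 4 * k) = 1 + r).
{ replace (s * (1 + 4 * k)) with (s * (2 + (r + 2) * X) / 2) by (unfold k; field).
  rewrite Hse. field. }
assert (P2 : 0 < q * (s * (1 + 4 * k) - s * ((1 + q) * (1 + k)))).
{ apply Rmult_lt_0_compat; [exact Hq |].
  assert (s * ((1 + q) * (1 + k)) < s * (1 + 4 * k)) by (apply Rmult_lt_compat_l; lra). lra. }
assert (P3 : 0 < q * (k - s / 2 * q * (1 + k) ^ 2)).
{ apply Rmult_lt_0_compat; [exact Hq |].
  assert (0 <= s / 2 * q <= (1 + r) / 2 * q1) by (apply Rmult_range; lra).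
  assert (0 <= s / 2 * q * (1 + k) ^ 2 <= (1 + r) / 2 * q1 * 2) by (apply Rmult_range; [lra | split; nra]).
  nra. }
unfold open_region, G1, G2, G3. repeat split; try lra; rewrite E2 in P2; lra.
Qed.

(** The orbit starts so close to the lower rest point that x + y + z, growing at a rate of at most
    hi (2 + r), needs time [T0] before x can be X / 2. That level is reached, since the limit is a
    rest point with x > 0. Shifting this moment to 0 leaves a past of length [T0]. *)
Lemma approximate_connection (T0 : R) :
  0 <= T0 ->
  exists x y z, clamped_solution x y z /\ x 0 = X / 2 /\
  forall t, - T0 <= t -> monotone_region (x t) (y t) (z t).
Proof.
intros HT0.
set (K := hi * (2 + r)).
assert (HK : 0 < K) by (apply Rmult_lt_0_compat; lra).
destruct (open_region_near_zero (X / 4 * exp (- K * T0))) as (x0 & y0 & z0 & Hop & Hsum & Hx0).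
{ apply Rmult_lt_0_compat; [lra | apply exp_pos]. }
destruct (clamped_solution_exists x0 y0 z0) as (x & y & z & Sol & Ex & Ey & Ez).
assert (Hreg : forall t, 0 <= t -> open_region (x t) (y t) (z t)).
{ intros t Ht. apply open_region_invariant; [exact Sol | rewrite Ex, Ey, Ez; exact Hop | exact Ht]. }
assert (Hm : forall t, 0 <= t -> monotone_region (x t) (y t) (z t)).
{ intros t Ht. apply open_monotone_region, Hreg, Ht. }
assert (Hx0p : 0 < x0) by apply Hop.
destruct (limit_p_rest_point x y z 0 Sol Hm) as (lx & ly & lz & Lx & _ & _ & Hlx & R1 & R2 & R3).
rewrite Ex in Hlx.
destruct (rest_points lx ly lz R1 R2 R3) as [E | E]; [lra | subst lx].
destruct (is_lim_pos_p (fun t => x t - X / 2) (X - X / 2)) as [T1 HT1].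
{ apply is_lim_minus'; [exact Lx | apply is_lim_const]. }
{ lra. }
set (T2 := Rmax 0 T1).
assert (HT2 : 0 <= T2) by apply Rmax_l.
assert (HxT2 : X / 2 < x T2) by (specialize (HT1 T2 (Rmax_r _ _)); simpl in HT1; lra).
destruct (IVT_gen x 0 T2 (X / 2)) as [T [HT HxT]].
{ intros t. apply continuity_pt_filterlim, (ex_derive_continuous x).
  destruct (Sol t) as (D & _). eexists; exact D. }
{ rewrite Ex, Rmin_left, Rmax_right by lra. lra. }
rewrite Rmin_left, Rmax_right in HT by lra.
assert (HTT0 : T0 <= T).
(* An earlier passage would force x + y + z < X / 4 at a time when x = X / 2. *)
{ apply Rnot_lt_le. intros Hlt.
  assert (H : - (x 0 + y 0 + z 0) * exp (- - K * (T - 0)) <= - (x T + y T + z T)).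
  { apply (exp_growth_lower (fun t => - (x t + y t + z t))
      (fun t => - (Derive x t + Derive y t + Derive z t))); [lra | |].
    - intros t _. destruct (Sol t) as (D1 & D2 & D3).
      apply (is_derive_opp (fun t => x t + y t + z t)).
      apply (is_derive_plus (fun t => x t + y t) z).
      + apply (is_derive_plus x y); apply Derive_correct; eexists; eassumption.
      + apply Derive_correct; eexists; eassumption.
    - intros t Ht. assert (Hmt := Hm t ltac:(lra)). destruct (Hmt) as (B & P1 & P2 & P3).
      destruct (clamped_solution_at x y z t Sol B) as (D1 & D2 & D3).
      rewrite (is_derive_unique _ _ _ D1), (is_derive_unique _ _ _ D2), (is_derive_unique _ _ _ D3).
      pose proof (coefficient_lower a _ _ _ Ha B). pose proof (coefficient_lower b _ _ _ Hb B).
      pose proof (coefficient_lower d _ _ _ Hd B).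
      destruct B as (Bx & By & Bz). fold Z in Bz. pose proof slope_bounds.
      assert (M1 : a (x t) (z t) * G1 (x t) (y t) <= hi * y t).
      { apply Rmult_le_compat; [lra | lra | lra | unfold G1; lra]. }
      assert (M2 : b (x t) (z t) * G2 r s (x t) (y t) (z t) <= hi * (x t + r * z t)).
      { apply Rmult_le_compat; [lra | lra | lra |]. unfold G2.
        assert (0 <= s * (1 + x t) * y t) by (apply Rmult_le_pos; [apply Rmult_le_pos |]; lra). lra. }
      assert (M3 : d (x t) (z t) * G3 s (y t) (z t) <= hi * y t).
      { apply Rmult_le_compat; [lra | lra | lra |]. unfold G3.
        assert (0 <= s / 2 * y t ^ 2) by (apply Rmult_le_pos; [lra | apply pow2_ge_0]). lra. }
      assert (0 <= hi * (x t + 2 * z t + r * x t + r * y t)).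
      { apply Rmult_le_pos; [lra |]. nra. }
      unfold K. lra. }
  rewrite Ropp_involutive, Rminus_0_r, Ex, Ey, Ez in H.
  destruct (Hm T ltac:(lra)) as ((_ & By & Bz) & _).
  assert (Hs : (x0 + y0 + z0) * exp (K * T) <= X / 4 * exp (- K * T0) * exp (K * T)).
  { apply Rmult_le_compat_r; [left; apply exp_pos | exact Hsum]. }
  rewrite Rmult_assoc, <- exp_plus in Hs.
  assert (He : exp (- K * T0 + K * T) < 1).
  { rewrite <- exp_0. apply exp_increasing. nra. }
  assert (X / 4 * exp (- K * T0 + K * T) < X / 4 * 1) by (apply Rmult_lt_compat_l; lra).
  lra. }
exists (fun t => x (t + T)), (fun t => y (t + T)), (fun t => z (t + T)).
split; [apply clamped_shift, Sol |]. split; [rewrite Rplus_0_l; exact HxT |].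
intros t Ht. apply Hm. lra.
Qed.

(** * The connecting orbit: uniqueness, existence, strict monotonicity *)

(** Both orbits stay in the box for all past times, so backward expansion may be used with
    arbitrarily large T; this forces the transverse difference at time 0 to vanish. *)
Lemma box_solution_unique (x1 y1 z1 x2 y2 z2 : R -> R) (t : R) :
  clamped_solution x1 y1 z1 -> clamped_solution x2 y2 z2 ->
  (forall t, in_box r X (x1 t) (y1 t) (z1 t)) -> (forall t, in_box r X (x2 t) (y2 t) (z2 t)) ->
  x1 0 = x2 0 -> x1 t = x2 t /\ y1 t = y2 t /\ z1 t = z2 t.
Proof.
intros S1 S2 B1 B2 E0.
set (u := y1 0 - y2 0). set (v := u - (z1 0 - z2 0)).
pose proof (pow2_ge_0 u) as Hu. pose proof (pow2_ge_0 v) as Hv.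
assert (Hq : u ^ 2 + r * v ^ 2 <= 0).
{ apply Rnot_lt_le. intros Hp.
  destruct (exp_growth_unbounded (lo / 2) (4 * (1 + r) / (u ^ 2 + r * v ^ 2)) ltac:(lra)) as [n Hn].
  assert (H := backward_expansion x1 y1 z1 x2 y2 z2 (INR n) S1 S2 (pos_INR n) (fun t _ => conj (B1 t) (B2 t)) E0).
  fold u in H. fold v in H.
  apply (Rmult_lt_compat_l (u ^ 2 + r * v ^ 2)) in Hn; [| exact Hp].
  replace ((u ^ 2 + r * v ^ 2) * (4 * (1 + r) / (u ^ 2 + r * v ^ 2))) with (4 * (1 + r)) in Hn by (field; lra).
  lra. }
assert (0 <= r * v ^ 2) by (apply Rmult_le_pos; lra).
assert (Hu0 : u ^ 2 = 0) by lra.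
assert (Hv0 : v ^ 2 = 0).
{ assert (E : r * v ^ 2 = 0) by lra. apply Rmult_integral in E. destruct E; [lra | assumption]. }
assert (u = 0) by (apply Rsqr_0_uniq; unfold Rsqr; lra).
assert (v = 0) by (apply Rsqr_0_uniq; unfold Rsqr; lra).
apply clamped_unique with (t0 := 0); try assumption; unfold v, u in *; lra.
Qed.

(** Only the data at time 0 are shown to converge. Continuous dependence for the clamped system,
    which needs no prior knowledge that the limit orbit stays in the box, gives convergence at every
    other time. *)
Lemma connection_weak :
  exists x y z, clamped_solution x y z /\ x 0 = X / 2 /\
  forall t, monotone_region (x t) (y t) (z t).
Proof.
destruct (functional_choice (fun (n : nat) (w : (R -> R) * (R -> R) * (R -> R)) =>
  clamped_solution (fst (fst w)) (snd (fst w)) (snd w) /\ fst (fst w) 0 = X / 2 /\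
  forall t, - INR n <= t -> monotone_region (fst (fst w) t) (snd (fst w) t) (snd w t))) as [w Hw].
{ intros n. destruct (approximate_connection (INR n) (pos_INR n)) as (x & y & z & H).
  exists (x, y, z). exact H. }
set (xs := fun n => fst (fst (w n))). set (ys := fun n => snd (fst (w n))). set (zs := fun n => snd (w n)).
assert (Sol : forall n, clamped_solution (xs n) (ys n) (zs n)) by (intros n; apply Hw).
assert (E0 : forall n, xs n 0 = X / 2) by (intros n; apply Hw).
assert (Hm : forall n t, - INR n <= t -> monotone_region (xs n t) (ys n t) (zs n t)) by (intros n; apply Hw).
clearbody xs ys zs. clear Hw w.
assert (Hcau : forall eps : R, 0 < eps -> exists N, forall n m, (N <= n)%nat -> (N <= m)%nat ->
  Rabs (ys n 0 - ys m 0) < eps /\ Rabs ((ys n 0 - ys m 0) - (zs n 0 - zs m 0)) < eps).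
{ intros eps Heps.
  (* The smaller weight of u^2 + r v^2, so that a small value of the form bounds both u and v. *)
  set (c := Rmin 1 r). assert (Hc : 0 < c) by (apply Rmin_glb_lt; lra).
  assert (Hc1 : c <= 1) by apply Rmin_l. assert (Hcr : c <= r) by apply Rmin_r.
  destruct (exp_growth_unbounded (lo / 2) (4 * (1 + r) / (c * (eps * eps))) ltac:(lra)) as [N HN].
  exists N. intros n m Hn Hm'.
  apply le_INR in Hn, Hm'.
  assert (H := backward_expansion (xs n) (ys n) (zs n) (xs m) (ys m) (zs m) (INR N) (Sol n) (Sol m) (pos_INR N)).
  specialize (H ltac:(intros t Ht; split; apply Hm; lra) ltac:(rewrite !E0; reflexivity)).
  set (u := ys n 0 - ys m 0) in *. set (v := u - (zs n 0 - zs m 0)) in *.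
  assert (Hce : 0 < c * (eps * eps)) by (repeat apply Rmult_lt_0_compat; assumption).
  apply (Rmult_lt_compat_l (c * (eps * eps))) in HN; [| exact Hce].
  replace (c * (eps * eps) * (4 * (1 + r) / (c * (eps * eps)))) with (4 * (1 + r)) in HN
    by (field; split; lra).
  assert (Hlt : u ^ 2 + r * v ^ 2 < c * (eps * eps)).
  { apply (Rmult_lt_reg_r (exp (lo / 2 * INR N))); [apply exp_pos | lra]. }
  pose proof (pow2_ge_0 u). pose proof (pow2_ge_0 v).
  assert (Hq : forall q, c * q ^ 2 < c * (eps * eps) -> Rabs q < eps).
  { intros q Hq. apply Rmult_lt_reg_l in Hq; [| exact Hc].
    rewrite <- (Rabs_pos_eq eps) by lra. apply Rsqr_lt_abs_0. unfold Rsqr. lra. }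
  assert (0 <= r * v ^ 2) by (apply Rmult_le_pos; lra).
  assert (c * u ^ 2 <= 1 * u ^ 2) by (apply Rmult_le_compat_r; lra).
  assert (c * v ^ 2 <= r * v ^ 2) by (apply Rmult_le_compat_r; lra).
  split; apply Hq; lra. }
assert (Ly : ex_finite_lim_seq (fun n => ys n 0)).
{ apply ex_lim_seq_cauchy_corr. intros eps. destruct (Hcau eps (cond_pos eps)) as [N HN].
  exists N. intros n m Hn Hm'. apply (HN n m Hn Hm'). }
assert (Lz : ex_finite_lim_seq (fun n => zs n 0)).
{ apply ex_lim_seq_cauchy_corr. intros eps.
  destruct (Hcau (eps / 2) ltac:(pose proof (cond_pos eps); lra)) as [N HN].
  exists N. intros n m Hn Hm'. destruct (HN n m Hn Hm') as [H1 H2].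
  apply Rabs_def2 in H1, H2. apply Rabs_def1; lra. }
destruct Ly as [ly Ly]. destruct Lz as [lz Lz].
destruct (clamped_solution_exists (X / 2) ly lz) as (x & y & z & S0 & Ex & Ey & Ez).
exists x, y, z. split; [exact S0 |]. split; [exact Ex |]. intros t.
set (e := fun n => ((ys n 0 - ly) ^ 2 + (zs n 0 - lz) ^ 2) * exp (6 * lip * Rabs t)).
assert (He : is_lim_seq e 0).
{ replace (Finite 0) with (Finite (((ly - ly) ^ 2 + (lz - lz) ^ 2) * exp (6 * lip * Rabs t))) by (f_equal; ring).
  apply is_lim_seq_mult'; [| apply is_lim_seq_const].
  assert (Hsq : forall u (l : R), is_lim_seq u l -> is_lim_seq (fun n => (u n - l) ^ 2) ((l - l) ^ 2)).
  { intros u l Hl. simpl. assert (is_lim_seq (fun n => u n - l) (l - l)).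
    { apply is_lim_seq_minus'; [exact Hl | apply is_lim_seq_const]. }
    apply is_lim_seq_mult'; [assumption |]. apply is_lim_seq_mult'; [assumption | apply is_lim_seq_const]. }
  apply is_lim_seq_plus'; apply Hsq; assumption. }
assert (Hdep : forall n, (xs n t - x t) ^ 2 + (ys n t - y t) ^ 2 + (zs n t - z t) ^ 2 <= e n).
{ intros n. eapply Rle_trans; [apply (clamped_dependence _ _ _ _ _ _ t (Sol n) S0) |].
  unfold e. rewrite E0, Ex, Ey, Ez. right. ring. }
assert (Cx' : is_lim_seq (fun n => xs n t) (x t)).
{ apply is_lim_seq_of_sqr_bound with e; [| exact He]. intros n. specialize (Hdep n).
  pose proof (pow2_ge_0 (ys n t - y t)). pose proof (pow2_ge_0 (zs n t - z t)). lra. }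
assert (Cy' : is_lim_seq (fun n => ys n t) (y t)).
{ apply is_lim_seq_of_sqr_bound with e; [| exact He]. intros n. specialize (Hdep n).
  pose proof (pow2_ge_0 (xs n t - x t)). pose proof (pow2_ge_0 (zs n t - z t)). lra. }
assert (Cz' : is_lim_seq (fun n => zs n t) (z t)).
{ apply is_lim_seq_of_sqr_bound with e; [| exact He]. intros n. specialize (Hdep n).
  pose proof (pow2_ge_0 (xs n t - x t)). pose proof (pow2_ge_0 (ys n t - y t)). lra. }
(* From index [N] on, t lies in the controlled past of the approximations. The conditions of the
   region are closed, hence pass to the limit. *)
destruct (INR_unbounded (- t)) as [N HN].
assert (Hmt : forall n, (N <= n)%nat -> monotone_region (xs n t) (ys n t) (zs n t)).
{ intros n Hn. apply Hm. apply le_INR in Hn. lra. }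
assert (Hc : forall c : R, is_lim_seq (fun _ => c) c) by (intros; apply is_lim_seq_const).
assert (Hge : forall u (l : R), is_lim_seq u l -> (forall n, monotone_region (xs n t) (ys n t) (zs n t) -> 0 <= u n) -> 0 <= l).
{ intros u l Hu H. apply is_lim_seq_ge_0 with u N; [intros n Hn; apply H, Hmt, Hn | exact Hu]. }
unfold monotone_region, in_box.
assert (Hup : forall c l, 0 <= c - l -> l <= c) by (intros; lra).
assert (Bx : forall n, monotone_region (xs n t) (ys n t) (zs n t) -> _) by (intros n Hn; exact (proj1 Hn)).
unfold in_box in Bx.
split; [split; [| split] | split; [| split]]; try split.
- apply (Hge _ _ Cx'). intros n Hn. apply (Bx n Hn).
- apply Hup, (Hge (fun n => X - xs n t)); [apply is_lim_seq_minus'; auto |].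
  intros n Hn. pose proof (Bx n Hn). lra.
- apply (Hge _ _ Cy'). intros n Hn. apply (Bx n Hn).
- apply Hup, (Hge (fun n => X - ys n t)); [apply is_lim_seq_minus'; auto |].
  intros n Hn. pose proof (Bx n Hn). lra.
- apply (Hge _ _ Cz'). intros n Hn. apply (Bx n Hn).
- apply Hup, (Hge (fun n => z_end r X - zs n t)); [apply is_lim_seq_minus'; auto |].
  intros n Hn. pose proof (Bx n Hn). lra.
- apply (Hge (fun n => G1 (xs n t) (ys n t))); [| intros n Hn; apply Hn].
  apply is_lim_seq_minus'; auto.
- apply (Hge (fun n => G2 r s (xs n t) (ys n t) (zs n t))); [| intros n Hn; apply Hn].
  unfold G2. apply is_lim_seq_minus'.
  + apply is_lim_seq_plus'; [exact Cx' | apply is_lim_seq_mult'; auto].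
  + apply is_lim_seq_mult'; [apply is_lim_seq_mult'; [auto | apply is_lim_seq_plus'; auto] | exact Cy'].
- apply (Hge (fun n => G3 s (ys n t) (zs n t))); [| intros n Hn; apply Hn].
  unfold G3. apply is_lim_seq_minus'; [apply is_lim_seq_minus'; assumption |].
  apply is_lim_seq_mult'; [auto |]. simpl.
  apply is_lim_seq_mult'; [exact Cy' | apply is_lim_seq_mult'; auto].
Qed.

(** An orbit meeting a rest point coincides with the constant orbit there, but x = X / 2 at time 0
    is the coordinate of no rest point. *)
Lemma no_rest_point (x y z : R -> R) (t : R) :
  clamped_solution x y z -> (forall t, monotone_region (x t) (y t) (z t)) -> x 0 = X / 2 ->
  G1 (x t) (y t) = 0 -> G2 r s (x t) (y t) (z t) = 0 -> G3 s (y t) (z t) = 0 -> False.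
Proof.
intros Sol Hm E0 H1 H2 H3.
assert (Sc : clamped_solution (fun _ => x t) (fun _ => y t) (fun _ => z t)).
{ destruct (Hm t) as ((Bx & By & Bz) & _). fold Z in Bz.
  intros q. simpl. rewrite !clamp_id by assumption. rewrite H1, H2, H3, !Rmult_0_r.
  split; [| split]; [apply (is_derive_const (x t)) | apply (is_derive_const (y t)) | apply (is_derive_const (z t))]. }
destruct (clamped_unique x y z _ _ _ t 0 Sol Sc eq_refl eq_refl eq_refl) as [Ex _].
rewrite E0 in Ex.
destruct (rest_points _ _ _ H1 H2 H3) as [E | E]; lra.
Qed.

(** A field that vanishes at t vanishes identically before t, together with its derivative. That
    derivative is then a combination, with positive weights, of the fields coupled to it, so they
    vanish too. Zeros of [G1] and [G3] spread to [G2], and a zero of [G2] to both others, which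
    yields a rest point. *)
Lemma connection_strict (x y z : R -> R) :
  clamped_solution x y z -> (forall t, monotone_region (x t) (y t) (z t)) -> x 0 = X / 2 ->
  forall t, 0 < G1 (x t) (y t) /\ 0 < G2 r s (x t) (y t) (z t) /\ 0 < G3 s (y t) (z t).
Proof.
intros Sol Hm E0.
set (dx := fun t => a (x t) (z t) * G1 (x t) (y t)).
set (dy := fun t => b (x t) (z t) * G2 r s (x t) (y t) (z t)).
set (dz := fun t => d (x t) (z t) * G3 s (y t) (z t)).
assert (HD : forall t, is_derive x t (dx t) /\ is_derive y t (dy t) /\ is_derive z t (dz t)).
{ intros t. apply clamped_solution_at; [exact Sol | apply Hm]. }
assert (Hf := fun t => field_derivative_bounds _ _ _ (Hm t)). simpl in Hf.
assert (V1 := fun t0 t => vanishing_backward (fun t => G1 (x t) (y t)) (fun t => dy t - dx t) rate t0 t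
  (fun t => is_derive_G1 x y t _ _ (proj1 (HD t)) (proj1 (proj2 (HD t))))
  (fun t => proj1 (Hf t)) (fun t => proj1 (proj2 (Hm t)))).
assert (V2 := fun t0 t => vanishing_backward (fun t => G2 r s (x t) (y t) (z t)) _ rate t0 t
  (fun t => is_derive_G2 x y z t _ _ _ (proj1 (HD t)) (proj1 (proj2 (HD t))) (proj2 (proj2 (HD t))))
  (fun t => proj1 (proj2 (Hf t))) (fun t => proj1 (proj2 (proj2 (Hm t))))).
assert (V3 := fun t0 t => vanishing_backward (fun t => G3 s (y t) (z t)) _ rate t0 t
  (fun t => is_derive_G3 y z t _ _ (proj1 (proj2 (HD t))) (proj2 (proj2 (HD t))))
  (fun t => proj2 (proj2 (Hf t))) (fun t => proj2 (proj2 (proj2 (Hm t))))).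
simpl in V1, V2, V3.
assert (Hq : forall q t, coefficient_ok lo hi L X Z q -> lo <= q (x t) (z t) <= hi).
{ intros q t Hq. apply (coefficient_lower q _ _ _ Hq (proj1 (Hm t))). }
assert (Hsy : forall t, 0 < 1 - s * y t).
{ intros t. destruct (Hm t) as ((_ & By & _) & _). pose proof slope_bounds. pose proof slope_X_lt_1.
  assert (s * y t <= s * X) by (apply Rmult_le_compat_l; lra). lra. }
assert (H0 : forall c q : R, 0 < c -> c * q = 0 -> q = 0).
{ intros c q Hc H. apply Rmult_integral in H. destruct H; [lra | assumption]. }
(* The time t - 1 is just some earlier time, where the derivative is known to vanish. *)
assert (Z2 : forall t, G2 r s (x t) (y t) (z t) = 0 -> False).
{ intros t H. destruct (V2 t (t - 1) H ltac:(lra)) as [H2 Hd2].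
  pose proof (Hq a (t - 1) Ha) as Qa. pose proof (Hq d (t - 1) Hd) as Qd.
  specialize (Hsy (t - 1)). destruct (Hm (t - 1)) as (_ & P1 & _ & P3).
  assert (Edy : dy (t - 1) = 0) by (unfold dy; rewrite H2; ring).
  rewrite Edy, Rmult_0_r, Rminus_0_r in Hd2. unfold dx, dz in Hd2.
  assert (K1 : 0 <= ((1 - s * y (t - 1)) * a (x (t - 1)) (z (t - 1))) * G1 (x (t - 1)) (y (t - 1))).
  { apply Rmult_le_pos; [apply Rmult_le_pos; lra | exact P1]. }
  assert (K3 : 0 <= (r * d (x (t - 1)) (z (t - 1))) * G3 s (y (t - 1)) (z (t - 1))).
  { apply Rmult_le_pos; [apply Rmult_le_pos; lra | exact P3]. }
  apply (no_rest_point x y z (t - 1) Sol Hm E0); [| exact H2 |].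
  - eapply H0; [| apply Rle_antisym; [| exact K1]]; [apply Rmult_lt_0_compat; lra | lra].
  - eapply H0; [| apply Rle_antisym; [| exact K3]]; [apply Rmult_lt_0_compat; lra | lra]. }
intros t. destruct (Hm t) as (_ & P1 & P2 & P3).
split; [| split].
- destruct P1 as [P1 | P1]; [exact P1 | exfalso].
  destruct (V1 t (t - 1) (eq_sym P1) ltac:(lra)) as [H1 Hd1]. unfold dx, dy in Hd1.
  rewrite H1, Rmult_0_r, Rminus_0_r in Hd1.
  apply (Z2 (t - 1)). apply H0 in Hd1; [exact Hd1 |]. pose proof (Hq b (t - 1) Hb). lra.
- destruct P2 as [P2 | P2]; [exact P2 | exfalso]. apply (Z2 t). symmetry; exact P2.
- destruct P3 as [P3 | P3]; [exact P3 | exfalso].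
  destruct (V3 t (t - 1) (eq_sym P3) ltac:(lra)) as [H3 Hd3]. unfold dy, dz in Hd3.
  rewrite H3, Rmult_0_r, Rminus_0_r in Hd3.
  apply (Z2 (t - 1)).
  apply (H0 ((1 - s * y (t - 1)) * b (x (t - 1)) (z (t - 1)))).
  + pose proof (Hq b (t - 1) Hb). specialize (Hsy (t - 1)). apply Rmult_lt_0_compat; lra.
  + lra.
Qed.

Lemma rest_point_coordinates (x y z : R) :
  G1 x y = 0 -> G3 s y z = 0 -> y = x /\ z = x - s * x ^ 2 / 2.
Proof.
unfold G1, G3. intros H1 H3. assert (y = x) by lra. subst y. split; [reflexivity |]. lra.
Qed.

(** For uniqueness a competitor has to stay in the box and to have the right limits of its x
    component: these provide a time at which x' = X / 2, and translating it to 0 fixes the phase. *)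
Lemma normalised_connection :
  exists x y z, normalised_solution r X a b d x y z /\
  (forall t, in_box r X (x t) (y t) (z t)) /\
  (forall t, 0 < G1 (x t) (y t) /\ 0 < G2 r s (x t) (y t) (z t) /\ 0 < G3 s (y t) (z t)) /\
  (is_lim x m_infty 0 /\ is_lim y m_infty 0 /\ is_lim z m_infty 0) /\
  (is_lim x p_infty X /\ is_lim y p_infty X /\ is_lim z p_infty Z) /\
  forall x' y' z', normalised_solution r X a b d x' y' z' ->
  (forall t, in_box r X (x' t) (y' t) (z' t)) ->
  is_lim x' m_infty 0 -> is_lim x' p_infty X ->
  exists h, forall t, x' t = x (t + h) /\ y' t = y (t + h) /\ z' t = z (t + h).
Proof.
destruct connection_weak as (x & y & z & Sol & E0 & Hm).
assert (HB : forall t, in_box r X (x t) (y t) (z t)) by (intros t; apply (Hm t)).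
exists x, y, z.
split; [intros t; apply clamped_solution_at; [exact Sol | apply HB] |].
split; [exact HB |].
split; [apply connection_strict; assumption |].
split; [| split].
- destruct (limit_m_rest_point x y z Sol Hm) as (lx & ly & lz & Lx & Ly & Lz & Hl & R1 & R2 & R3).
  destruct (rest_point_coordinates _ _ _ R1 R3) as [-> ->].
  destruct (rest_points _ _ _ R1 R2 R3) as [-> | ->]; [| lra].
  replace (0 - s * 0 ^ 2 / 2) with 0 in Lz by field. auto.
- destruct (limit_p_rest_point x y z 0 Sol (fun t _ => Hm t)) as (lx & ly & lz & Lx & Ly & Lz & Hl & R1 & R2 & R3).
  destruct (rest_point_coordinates _ _ _ R1 R3) as [-> ->].
  destruct (rest_points _ _ _ R1 R2 R3) as [-> | ->]; [lra |]. auto.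
- intros x' y' z' Sn' B' Lm Lp.
  assert (Sol' := clamped_of_normalised x' y' z' Sn' B').
  destruct (is_lim_pos_p (fun t => x' t - X / 2) (X - X / 2)) as [T1 HT1].
  { apply is_lim_minus'; [exact Lp | apply is_lim_const]. }
  { lra. }
  destruct (is_lim_pos_p (fun t => X / 2 - x' (- t)) (X / 2 - 0)) as [T2 HT2].
  { apply is_lim_minus'; [apply is_lim_const | apply (is_lim_opp_arg_p x' 0), Lm]. }
  { lra. }
  specialize (HT1 T1 (Rle_refl _)). specialize (HT2 T2 (Rle_refl _)). simpl in HT1, HT2.
  destruct (IVT_gen x' (- T2) T1 (X / 2)) as [q [_ Hq]].
  { intros t. apply continuity_pt_filterlim, (ex_derive_continuous x').
    destruct (Sol' t) as (D & _). eexists; exact D. }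
  { rewrite Rmin_left, Rmax_right by lra. lra. }
  exists (- q). intros t.
  assert (H := box_solution_unique (fun t => x' (t + q)) (fun t => y' (t + q)) (fun t => z' (t + q)) x y z (t + - q)).
  simpl in H. rewrite Rplus_0_l in H. replace (t + - q + q) with t in H by ring.
  apply H; [apply clamped_shift, Sol' | exact Sol | intros; apply B' | exact HB | lra].
Qed.

End Normalised.

(** * The profile problem as a first-order system *)

(** The three balances integrated from the base state [s0] and solved for the derivatives. From the
    energy balance u times the integrated momentum balance has been subtracted; this cancels the
    viscous work and leaves the quadratic term in the velocity. *)
Definition first_order (Rg gamma : R) (tau mu kappa : R -> R) (sigma : R) (s0 : state)
    (W : R -> state) : Prop :=
  (forall x, physical (W x)) /\
  (forall x, is_derive (fun y => vol (W y)) x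
     (vol (W x) / tau (temp (W x)) *
      (- sigma * (vol (W x) - vol s0) - (vel (W x) - vel s0)))) /\
  (forall x, is_derive (fun y => vel (W y)) x
     (vol (W x) / mu (temp (W x)) *
      (- sigma * (vel (W x) - vel s0) + (pressure Rg (W x) - pressure Rg s0)))) /\
  (forall x, is_derive (fun y => temp (W y)) x
     (vol (W x) / kappa (temp (W x)) *
      (- sigma * (Rg / (gamma - 1)) * (temp (W x) - temp s0)
       + pressure Rg s0 * (vel (W x) - vel s0) + sigma / 2 * (vel (W x) - vel s0) ^ 2))).

(** C^1 on the line, with the derivative as an explicit witness so that closure under algebra and
    composition is direct. It drives the regularity bootstrap for profiles. *)
Definition continuously_derivable (f : R -> R) : Prop :=
  exists df : R -> R, (forall x, is_derive f x (df x)) /\ forall x, continuous df x.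

Lemma C2_at_of_derivative (f g : R -> R) (x : R) :
  (forall x, is_derive f x (g x)) -> continuously_derivable g -> C2_at f x.
Proof.
intros Hf (dg & Hg & Hc).
assert (E1 : forall y, Derive f y = g y) by (intros y; apply is_derive_unique, Hf).
assert (E2 : forall y, Derive (Derive f) y = dg y).
{ intros y. rewrite (Derive_ext _ _ y E1). apply is_derive_unique, Hg. }
split.
- intros k Hk. destruct k as [| [| [| k]]]; [exact I | | | lia].
  + eexists. apply Hf.
  + exists (dg x). apply (is_derive_ext g); [intros y; symmetry; apply E1 | apply Hg].
- apply (continuous_ext dg); [intros y; symmetry; apply E2 | apply Hc].
Qed.

Lemma continuously_derivable_const (c : R) : continuously_derivable (fun _ => c).
Proof.
exists (fun _ => 0). split; intros x; [apply (is_derive_const c) | apply continuous_const].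
Qed.

Lemma continuously_derivable_plus (f g : R -> R) :
  continuously_derivable f -> continuously_derivable g ->
  continuously_derivable (fun x => f x + g x).
Proof.
intros (df & Hf & Cf) (dg & Hg & Cg). exists (fun x => df x + dg x). split; intros x.
- apply (is_derive_plus f g); auto.
- apply (continuous_plus df dg); auto.
Qed.

Lemma continuously_derivable_continuous (f : R -> R) (x : R) :
  continuously_derivable f -> continuous f x.
Proof. intros (df & Hf & _). apply (ex_derive_continuous f). eexists; apply Hf. Qed.

Lemma continuously_derivable_mult (f g : R -> R) :
  continuously_derivable f -> continuously_derivable g ->
  continuously_derivable (fun x => f x * g x).
Proof.
intros Kf Kg. assert (C0f := fun x => continuously_derivable_continuous f x Kf).
assert (C0g := fun x => continuously_derivable_continuous g x Kg).
destruct Kf as (df & Hf & Cf). destruct Kg as (dg & Hg & Cg).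
exists (fun x => df x * g x + f x * dg x). split; intros x.
- apply (is_derive_mult f g); auto. intros; apply Rmult_comm.
- apply (continuous_plus (fun x => df x * g x) (fun x => f x * dg x)).
  + apply (continuous_mult df g); auto.
  + apply (continuous_mult f dg); auto.
Qed.

Lemma continuous_Rinv (x : R) : x <> 0 -> continuous Rinv x.
Proof. intros Hx. apply (ex_derive_continuous Rinv). auto_derive. exact Hx. Qed.

Lemma continuously_derivable_inv (f : R -> R) :
  continuously_derivable f -> (forall x, f x <> 0) -> continuously_derivable (fun x => / f x).
Proof.
intros Kf Hn. assert (C0f := fun x => continuously_derivable_continuous f x Kf).
destruct Kf as (df & Hf & Cf).
exists (fun x => - df x * / (f x * f x)). split; intros x.
- evar_last; [apply (is_derive_inv f); auto |]. field. apply Hn.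
- apply (continuous_mult (fun x => - df x) (fun x => / (f x * f x))).
  + apply (continuous_opp df), Cf.
  + apply (continuous_comp (fun x => f x * f x) Rinv); [apply (continuous_mult f f); auto |].
    apply continuous_Rinv, Rmult_integral_contrapositive_currified; apply Hn.
Qed.

Lemma positive_C2_derive (f : R -> R) (x : R) :
  positive_C2 f -> 0 < x -> 0 < f x /\ is_derive f x (Derive f x) /\ continuous (Derive f) x.
Proof.
intros Hf Hx. destruct (Hf x Hx) as [Hp [Hd _]]. split; [exact Hp |].
split; [apply Derive_correct, (Hd 1%nat); lia |].
apply (ex_derive_continuous (Derive f)), (Hd 2%nat); lia.
Qed.

Lemma continuously_derivable_comp (f th : R -> R) :
  positive_C2 f -> continuously_derivable th -> (forall x, 0 < th x) ->
  continuously_derivable (fun x => f (th x)).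
Proof.
intros Hf Kt Hp. assert (C0t := fun x => continuously_derivable_continuous th x Kt).
destruct Kt as (dth & Ht & Ct).
exists (fun x => dth x * Derive f (th x)). split; intros x;
  destruct (positive_C2_derive f (th x) Hf (Hp x)) as (_ & Hd & Hc).
- apply (is_derive_comp f th x); auto.
- apply (continuous_mult dth (fun x => Derive f (th x))); [apply Ct |].
  apply (continuous_comp th (Derive f)); auto.
Qed.

Lemma continuously_derivable_minus (f g : R -> R) :
  continuously_derivable f -> continuously_derivable g ->
  continuously_derivable (fun x => f x - g x).
Proof.
intros (df & Hf & Cf) (dg & Hg & Cg). exists (fun x => df x - dg x). split; intros x.
- apply (is_derive_minus f g); auto.
- apply (continuous_minus df dg); auto.
Qed.

Lemma flux_constant (f : R -> R) :
  (forall x, is_derive f x 0) -> forall x y, f x = f y.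
Proof.
intros Hf. assert (Hle : forall x y, x <= y -> f x = f y).
{ intros x y [Hxy | ->]; [| reflexivity]. apply (eq_is_derive f x y); [intros; apply Hf | exact Hxy]. }
intros x y. destruct (Rle_lt_dec x y); [apply Hle; assumption | symmetry; apply Hle; lra].
Qed.

Lemma lim_derivative_nonpos_p (f g : R -> R) (l k : R) :
  (forall x, is_derive f x (g x)) -> is_lim f p_infty l -> is_lim g p_infty k -> k <= 0.
Proof.
intros Hd Hf Hg. apply is_lim_spec in Hf.
destruct (Hf (mkposreal 1 Rlt_0_1)) as [T HT].
apply (bounded_drift_lim_p f g (fun _ => 1) (T + 1) (l + 1) 1); auto; try lra.
- intros t _. rewrite Rmult_1_l. apply Hd.
- intros; lra.
- intros t Ht. specialize (HT t ltac:(lra)). simpl in HT. apply Rabs_def2 in HT. lra.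
Qed.

Lemma lim_derivative_zero_m (f g : R -> R) (l k : R) :
  (forall x, is_derive f x (g x)) -> is_lim f m_infty l -> is_lim g m_infty k -> k = 0.
Proof.
intros Hd Hf Hg. apply is_lim_opp_arg_p in Hf, Hg.
assert (Hd' : forall x, is_derive (fun t => f (- t)) x (- g (- x))).
{ intros x. apply is_derive_comp_opp, Hd. }
apply Rle_antisym.
- apply (lim_derivative_nonpos_p (fun t => - f (- t)) (fun t => g (- t)) (- l)); auto.
  + intros x. evar_last; [apply (is_derive_opp (fun t => f (- t))), Hd' |].
    unfold opp; simpl. ring.
  + apply (is_lim_opp _ _ _ Hf).
- apply Ropp_le_cancel. rewrite Ropp_0.
  apply (lim_derivative_nonpos_p (fun t => f (- t)) (fun t => - g (- t)) l); auto.
  apply (is_lim_opp _ _ _ Hg).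
Qed.

Lemma is_lim_inv_finite (f : R -> R) (p : Rbar) (l : R) :
  is_lim f p l -> l <> 0 -> is_lim (fun t => / f t) p (/ l).
Proof. intros Hf Hl. apply (is_lim_comp_continuous f Rinv p l Hf), continuous_Rinv, Hl. Qed.

Section Profile.

Variables (Rg gamma : R) (tau mu kappa : R -> R).
Hypothesis Htau : positive_C2 tau.
Hypothesis Hmu : positive_C2 mu.
Hypothesis Hkappa : positive_C2 kappa.

(** The brackets [g1], [g2], [g3] are the mass, momentum and heat fluxes, and the viscous work flux
    is u times [g2]; differentiating these identities returns the second-order equations. *)
Lemma profile_of_first_order (sigma : R) (sm sp : state) (W : R -> state) :
  sigma = shock_speed Rg sm sp -> gamma <> 1 ->
  first_order Rg gamma tau mu kappa sigma sm W -> connects W sm sp ->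
  profile_solution Rg gamma tau mu kappa sm sp W.
Proof.
intros Es Hg (Hph & Dv & Du & Dth) Hc.
set (v := fun x => vol (W x)) in *. set (u := fun x => vel (W x)) in *.
set (th := fun x => temp (W x)) in *.
assert (Hv : forall x, 0 < v x) by (intros x; apply Hph).
assert (Hth : forall x, 0 < th x) by (intros x; apply Hph).
assert (Hexv : forall x, ex_derive v x) by (intros x; eexists; apply Dv).
assert (Hexu : forall x, ex_derive u x) by (intros x; eexists; apply Du).
assert (Hexth : forall x, ex_derive th x) by (intros x; eexists; apply Dth).
assert (Cv0 : forall x, continuous v x) by (intros x; apply (ex_derive_continuous v), Hexv).
assert (Cu0 : forall x, continuous u x) by (intros x; apply (ex_derive_continuous u), Hexu).
assert (Cth0 : forall x, continuous th x) by (intros x; apply (ex_derive_continuous th), Hexth).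
assert (Hcf : forall f x, positive_C2 f -> continuous (fun x => v x / f (th x)) x).
{ intros f x Hf. destruct (positive_C2_derive f (th x) Hf (Hth x)) as (Hp & Hd & _).
  apply (continuous_mult v (fun x => / f (th x))); [apply Cv0 |].
  apply (continuous_comp (fun x => f (th x)) Rinv); [| apply continuous_Rinv; lra].
  apply (continuous_comp th f); [apply Cth0 |]. apply (ex_derive_continuous f). eexists; exact Hd. }
set (g1 := fun x => - sigma * (v x - vol sm) - (u x - vel sm)).
set (g2 := fun x => - sigma * (u x - vel sm) + (Rg * th x / v x - pressure Rg sm)).
set (g3 := fun x => - sigma * (Rg / (gamma - 1)) * (th x - temp sm)
   + pressure Rg sm * (u x - vel sm) + sigma / 2 * (u x - vel sm) ^ 2).
assert (Dv' : forall x, is_derive v x (v x / tau (th x) * g1 x)) by exact Dv.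
assert (Du' : forall x, is_derive u x (v x / mu (th x) * g2 x)) by exact Du.
assert (Dth' : forall x, is_derive th x (v x / kappa (th x) * g3 x)) by exact Dth.
clear Dv Du Dth.
assert (Eg1 : forall x, is_derive g1 x (- sigma * Derive v x - Derive u x)).
{ intros x. unfold g1. auto_derive; [repeat split; auto |]. eta_functions. ring. }
assert (Hdp : forall x, ex_derive (fun x => Rg * th x / v x) x).
{ intros x. auto_derive. repeat split; auto. apply Rgt_not_eq, Hv. }
assert (Eg2 : forall x, is_derive g2 x (- sigma * Derive u x + Derive (fun x => Rg * th x / v x) x)).
{ intros x. unfold g2.
  apply (is_derive_plus (fun x => - sigma * (u x - vel sm)) (fun x => Rg * th x / v x - pressure Rg sm)).
  - auto_derive; [repeat split; auto |]. eta_functions. ring.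
  - evar_last.
    + apply (is_derive_minus (fun x => Rg * th x / v x) (fun _ => pressure Rg sm));
        [apply Derive_correct, Hdp | apply (is_derive_const (pressure Rg sm))].
    + unfold minus, plus, opp, zero; simpl. ring. }
(* Bootstrap: continuous right-hand sides make the components C^1, hence the right-hand sides C^1
   and the components C^2. *)
assert (Hcd : forall (f h g : R -> R), (forall x, is_derive f x (v x / h (th x) * g x)) ->
  positive_C2 h -> (forall x, continuous g x) -> continuously_derivable f).
{ intros f h g Hf Hh Hgc. exists (fun x => v x / h (th x) * g x). split; [exact Hf |].
  intros x. apply (continuous_mult (fun x => v x / h (th x)) g); auto. }
assert (Kv : continuously_derivable v).
{ apply (Hcd v tau g1); auto. intros x. apply (ex_derive_continuous g1). eexists; apply Eg1. }
assert (Ku : continuously_derivable u).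
{ apply (Hcd u mu g2); auto. intros x. apply (ex_derive_continuous g2). eexists; apply Eg2. }
assert (Kth : continuously_derivable th).
{ apply (Hcd th kappa g3); auto. intros x. apply (ex_derive_continuous g3). unfold g3. auto_derive. auto. }
assert (Hne : forall f, positive_C2 f -> forall x, f (th x) <> 0).
{ intros f Hf x. destruct (positive_C2_derive f (th x) Hf (Hth x)). lra. }
assert (Kq : forall f, positive_C2 f -> continuously_derivable (fun x => v x / f (th x))).
{ intros f Hf. apply (continuously_derivable_mult v (fun x => / f (th x))); [exact Kv |].
  apply (continuously_derivable_inv (fun x => f (th x))); [| apply Hne, Hf].
  apply continuously_derivable_comp; auto. }
assert (Kd : forall f c, continuously_derivable f -> continuously_derivable (fun x => f x - c)).
{ intros f c Hf. apply continuously_derivable_minus; [exact Hf | apply continuously_derivable_const]. }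
assert (Kc : forall f c, continuously_derivable f -> continuously_derivable (fun x => c * f x)).
{ intros f c Hf. apply continuously_derivable_mult; [apply continuously_derivable_const | exact Hf]. }
assert (Kg1 : continuously_derivable g1).
{ apply (continuously_derivable_minus (fun x => - sigma * (v x - vol sm)) (fun x => u x - vel sm)); auto. }
assert (Kg2 : continuously_derivable g2).
{ apply (continuously_derivable_plus (fun x => - sigma * (u x - vel sm)) (fun x => Rg * th x / v x - pressure Rg sm)); [auto |].
  apply (Kd (fun x => Rg * th x / v x)).
  apply (continuously_derivable_mult (fun x => Rg * th x) (fun x => / v x)); [apply Kc, Kth |].
  apply continuously_derivable_inv; [exact Kv | intros x; apply Rgt_not_eq, Hv]. }
assert (Kg3 : continuously_derivable g3).
{ apply (continuously_derivable_plus
    (fun x => - sigma * (Rg / (gamma - 1)) * (th x - temp sm) + pressure Rg sm * (u x - vel sm))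
    (fun x => sigma / 2 * (u x - vel sm) ^ 2)).
  - apply (continuously_derivable_plus (fun x => - sigma * (Rg / (gamma - 1)) * (th x - temp sm))
      (fun x => pressure Rg sm * (u x - vel sm))); auto.
  - apply (Kc (fun x => (u x - vel sm) ^ 2)).
    apply (continuously_derivable_mult (fun x => u x - vel sm) (fun x => (u x - vel sm) ^ 1)); auto.
    apply (continuously_derivable_mult (fun x => u x - vel sm) (fun _ => 1)); auto.
    apply continuously_derivable_const. }
assert (Ev := fun x => is_derive_unique _ _ _ (Dv' x)).
assert (Eu := fun x => is_derive_unique _ _ _ (Du' x)).
assert (Eth := fun x => is_derive_unique _ _ _ (Dth' x)).
unfold profile_solution. rewrite <- Es. cbv zeta. fold v u th.
split; [exact Hph |].
split.
{ intros x. split; [| split].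
  - apply (C2_at_of_derivative v _ x Dv'), (continuously_derivable_mult (fun x => v x / tau (th x)) g1); auto.
  - apply (C2_at_of_derivative u _ x Du'), (continuously_derivable_mult (fun x => v x / mu (th x)) g2); auto.
  - apply (C2_at_of_derivative th _ x Dth'), (continuously_derivable_mult (fun x => v x / kappa (th x)) g3); auto. }
assert (F1 : forall y, tau (th y) * (Derive v y / v y) = g1 y).
{ intros y. rewrite Ev. field. split; [apply Hne; auto | apply Rgt_not_eq, Hv]. }
assert (F2 : forall y, mu (th y) * (Derive u y / v y) = g2 y).
{ intros y. rewrite Eu. field. split; [apply Hne; auto | apply Rgt_not_eq, Hv]. }
split; [| split; [| split; [| exact Hc]]]; intros x.
- rewrite <- (is_derive_unique _ _ _ (Eg1 x)). apply Derive_ext. intros y. symmetry. apply F1.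
- change (- sigma * Derive u x + Derive (fun x => Rg * th x / v x) x
    = Derive (fun y => mu (th y) * (Derive u y / v y)) x).
  rewrite <- (is_derive_unique _ _ _ (Eg2 x)). apply Derive_ext. intros y. symmetry. apply F2.
- assert (Hex3 : forall x, ex_derive g3 x).
  { intros y. destruct Kg3 as (dg & Hdg & _). eexists; apply Hdg. }
  assert (Hex2 : forall x, ex_derive g2 x) by (intros y; eexists; apply Eg2).
  set (P := fun x => Rg * th x / v x).
  change (- sigma * Derive (fun y => Rg / (gamma - 1) * th y + u y ^ 2 / 2) x
    + Derive (fun y => P y * u y) x
    = Derive (fun y => kappa (th y) * (Derive th y / v y)) x
      + Derive (fun y => mu (th y) * (u y * Derive u y / v y)) x).
  rewrite (Derive_ext (fun y => kappa (th y) * (Derive th y / v y)) g3).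
  2:{ intros y. rewrite Eth. field. split; [apply Hne; auto | apply Rgt_not_eq, Hv]. }
  rewrite (Derive_ext (fun y => mu (th y) * (u y * Derive u y / v y)) (fun y => u y * g2 y)).
  2:{ intros y. rewrite <- F2. field. apply Rgt_not_eq, Hv. }
  assert (HexP : forall x, ex_derive P x) by exact Hdp.
  rewrite (Derive_mult P u) by auto. rewrite (Derive_mult u g2) by auto.
  rewrite (is_derive_unique _ _ _ (Eg2 x)). fold P.
  assert (D3 : is_derive g3 x (- sigma * (Rg / (gamma - 1)) * Derive th x
     + pressure Rg sm * Derive u x + sigma * (u x - vel sm) * Derive u x)).
  { unfold g3. auto_derive; [auto |]. eta_functions. field. lra. }
  rewrite (is_derive_unique _ _ _ D3).
  assert (DE : is_derive (fun y => Rg / (gamma - 1) * th y + u y ^ 2 / 2) x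
    (Rg / (gamma - 1) * Derive th x + u x * Derive u x)).
  { auto_derive; [auto |]. eta_functions. field. lra. }
  assert (DE' : Derive (fun y : R => Rg / (gamma - 1) * th y + u y ^ 2 / 2) x
    = Rg / (gamma - 1) * Derive th x + u x * Derive u x) by exact (is_derive_unique _ _ _ DE).
  rewrite DE'.
  unfold g2. fold (P x). ring.
Qed.

(** Integration leaves one constant per equation. Nothing is assumed about derivatives at infinity;
    the constants are determined because each flux then has a limit at minus infinity, which the
    convergence of the component itself forces to be 0. *)
Lemma first_order_of_profile (sigma : R) (sm sp : state) (W : R -> state) :
  sigma = shock_speed Rg sm sp -> gamma <> 1 -> physical sm ->
  profile_solution Rg gamma tau mu kappa sm sp W ->
  first_order Rg gamma tau mu kappa sigma sm W /\ connects W sm sp.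
Proof.
intros Es Hg Hsm HW. unfold profile_solution in HW. rewrite <- Es in HW. cbv zeta in HW.
destruct HW as (Hph & HC2 & H1 & H2 & H3 & Hc).
split; [| exact Hc].
set (v := fun x => vol (W x)) in *. set (u := fun x => vel (W x)) in *.
set (th := fun x => temp (W x)) in *.
set (P := fun x => Rg * th x / v x).
set (En := fun y => Rg / (gamma - 1) * th y + u y ^ 2 / 2).
assert (H1' : forall x, - sigma * Derive v x - Derive u x
  = Derive (fun y => tau (th y) * (Derive v y / v y)) x) by exact H1.
assert (H2' : forall x, - sigma * Derive u x + Derive P x
  = Derive (fun y => mu (th y) * (Derive u y / v y)) x) by exact H2.
assert (H3' : forall x, - sigma * Derive En x + Derive (fun y => P y * u y) x
  = Derive (fun y => kappa (th y) * (Derive th y / v y)) x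
    + Derive (fun y => mu (th y) * (u y * Derive u y / v y)) x) by exact H3.
clear H1 H2 H3. rename H1' into H1. rename H2' into H2. rename H3' into H3.
assert (Hv : forall x, 0 < v x) by (intros x; apply Hph).
assert (Hv' : forall x, v x <> 0) by (intros x; apply Rgt_not_eq, Hv).
assert (Hth : forall x, 0 < th x) by (intros x; apply Hph).
assert (Hexv : forall x, ex_derive v x) by (intros x; apply (proj1 (proj1 (HC2 x)) 1%nat); lia).
assert (Hexu : forall x, ex_derive u x) by (intros x; apply (proj1 (proj1 (proj2 (HC2 x))) 1%nat); lia).
assert (Hexth : forall x, ex_derive th x) by (intros x; apply (proj1 (proj2 (proj2 (HC2 x))) 1%nat); lia).
assert (Hexv2 : forall x, ex_derive (Derive v) x) by (intros x; apply (proj1 (proj1 (HC2 x)) 2%nat); lia).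
assert (Hexu2 : forall x, ex_derive (Derive u) x) by (intros x; apply (proj1 (proj1 (proj2 (HC2 x))) 2%nat); lia).
assert (Hexth2 : forall x, ex_derive (Derive th) x) by (intros x; apply (proj1 (proj2 (proj2 (HC2 x))) 2%nat); lia).
assert (HexP : forall x, ex_derive P x).
{ intros x. unfold P. auto_derive. repeat split; auto. }
assert (HexE : forall x, ex_derive En x).
{ intros x. unfold En. auto_derive. repeat split; auto. }
assert (Hfl : forall f w x, positive_C2 f -> (forall x, ex_derive w x) ->
  ex_derive (fun y => f (th y) * (w y / v y)) x).
{ intros f w x Hf Hw. destruct (positive_C2_derive f (th x) Hf (Hth x)) as (_ & Hd & _).
  apply (ex_derive_mult (fun y => f (th y)) (fun y => w y / v y)).
  - apply (ex_derive_comp f th); [eexists; exact Hd | apply Hexth].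
  - apply (ex_derive_div w v); auto. }
set (A1 := fun y => tau (th y) * (Derive v y / v y)) in *.
set (A2 := fun y => mu (th y) * (Derive u y / v y)) in *.
set (A3 := fun y => kappa (th y) * (Derive th y / v y)) in *.
set (B3 := fun y => mu (th y) * (u y * Derive u y / v y)) in *.
assert (HA1 : forall x, ex_derive A1 x) by (intros x; apply Hfl; auto).
assert (HA2 : forall x, ex_derive A2 x) by (intros x; apply Hfl; auto).
assert (HA3 : forall x, ex_derive A3 x) by (intros x; apply Hfl; auto).
assert (EB3 : forall y, B3 y = u y * A2 y) by (intros y; unfold B3, A2; field; apply Hv').
assert (HB3 : forall x, ex_derive B3 x).
{ intros x. apply (ex_derive_ext (fun y => u y * A2 y)); [intros; symmetry; apply EB3 |].
  apply (ex_derive_mult u A2); auto. }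
destruct Hc as ((Lv & Lu & Lth) & _). fold v in Lv. fold u in Lu. fold th in Lth.
destruct Hsm as [Hvm Htm].
assert (Lc : forall c : R, is_lim (fun _ => c) m_infty c) by (intros; apply is_lim_const).
assert (Hq : forall f, positive_C2 f -> is_lim (fun x => v x * / f (th x)) m_infty (vol sm * / f (temp sm))).
{ intros f Hf. destruct (positive_C2_derive f (temp sm) Hf Htm) as (Hp & Hd & _).
  apply is_lim_mult_finite; [exact Lv |]. apply is_lim_inv_finite; [| lra].
  apply (is_lim_comp_continuous th f); [exact Lth |]. apply (ex_derive_continuous f). eexists; exact Hd. }
assert (LP : is_lim P m_infty (pressure Rg sm)).
{ unfold P, pressure. apply is_lim_mult_finite; [apply is_lim_mult_finite; auto |].
  apply is_lim_inv_finite; [exact Lv | lra]. }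
(* A flux with a limit at -oo forces the derivative to converge, hence to 0. *)
assert (Hflux : forall (f h A : R -> R) (k : R), positive_C2 h ->
  (forall x, ex_derive f x) -> (forall y, A y = h (th y) * (Derive f y / v y)) ->
  is_lim A m_infty k -> (exists l : R, is_lim f m_infty l) -> k = 0).
{ intros f h A k Hh Hf HA Lk [l Ll].
  assert (E : vol sm * / h (temp sm) * k = 0).
  { apply (lim_derivative_zero_m f (fun x => v x * / h (th x) * A x) l).
    - intros x. replace (v x * / h (th x) * A x) with (Derive f x); [apply Derive_correct, Hf |].
      destruct (positive_C2_derive h (th x) Hh (Hth x)) as (Hp & _). rewrite HA. field. split; [apply Hv' | lra].
    - exact Ll.
    - apply is_lim_mult_finite; [apply Hq, Hh | exact Lk]. }
  destruct (positive_C2_derive h (temp sm) Hh Htm) as (Hp & _).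
  apply Rmult_integral in E. destruct E as [E | E]; [exfalso | exact E].
  assert (0 < vol sm * / h (temp sm)); [| lra].
  apply Rmult_lt_0_compat; [exact Hvm | apply Rinv_0_lt_compat, Hp]. }
assert (Hsolve : forall (f h A : R -> R) x, positive_C2 h -> (forall x, ex_derive f x) ->
  (forall y, A y = h (th y) * (Derive f y / v y)) -> is_derive f x (v x / h (th x) * A x)).
{ intros f h A x Hh Hf HA.
  replace (v x / h (th x) * A x) with (Derive f x); [apply Derive_correct, Hf |].
  destruct (positive_C2_derive h (th x) Hh (Hth x)) as (Hp & _). rewrite HA. field. split; [apply Hv' | lra]. }
assert (I1 : forall x, A1 x = - sigma * (v x - vol sm) - (u x - vel sm)).
{ assert (K := flux_constant (fun y => A1 y + sigma * v y + u y)).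
  assert (Z : forall x, is_derive (fun y => A1 y + sigma * v y + u y) x 0).
  { intros x. auto_derive; [repeat split; auto |]. eta_functions. specialize (H1 x). lra. }
  specialize (K Z). set (k := A1 0 + sigma * v 0 + u 0) in *.
  assert (E : forall x, A1 x = k - sigma * v x - u x) by (intros x; specialize (K x 0); simpl in K; fold k in K; lra).
  assert (k - sigma * vol sm - vel sm = 0).
  { apply (Hflux v tau A1); auto; [| exists (vol sm); exact Lv].
    apply is_lim_ext with (fun x => k - sigma * v x - u x); [intros; symmetry; apply E |].
    apply is_lim_minus'; [apply is_lim_minus'; [apply Lc | apply is_lim_mult_finite; auto] | exact Lu]. }
  intros x. rewrite E. lra. }
assert (I2 : forall x, A2 x = - sigma * (u x - vel sm) + (P x - pressure Rg sm)).
{ assert (K := flux_constant (fun y => A2 y + sigma * u y - P y)).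
  assert (Z : forall x, is_derive (fun y => A2 y + sigma * u y - P y) x 0).
  { intros x. auto_derive; [repeat split; auto |]. eta_functions. specialize (H2 x). lra. }
  specialize (K Z). set (k := A2 0 + sigma * u 0 - P 0) in *.
  assert (E : forall x, A2 x = k - sigma * u x + P x) by (intros x; specialize (K x 0); simpl in K; fold k in K; lra).
  assert (k - sigma * vel sm + pressure Rg sm = 0).
  { apply (Hflux u mu A2); auto; [| exists (vel sm); exact Lu].
    apply is_lim_ext with (fun x => k - sigma * u x + P x); [intros; symmetry; apply E |].
    apply is_lim_plus'; [apply is_lim_minus'; [apply Lc | apply is_lim_mult_finite; auto] | exact LP]. }
  intros x. rewrite E. lra. }
assert (LA2 : is_lim A2 m_infty 0).
{ apply is_lim_ext with (fun x => - sigma * (u x - vel sm) + (P x - pressure Rg sm)); [intros; symmetry; apply I2 |].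
  replace (Finite 0) with (Finite (- sigma * (vel sm - vel sm) + (pressure Rg sm - pressure Rg sm))) by (f_equal; ring).
  apply is_lim_plus'; [apply is_lim_mult_finite; [apply Lc |] |]; apply is_lim_minus'; auto. }
assert (I3 : forall x, A3 x = - sigma * (Rg / (gamma - 1)) * (th x - temp sm)
       + pressure Rg sm * (u x - vel sm) + sigma / 2 * (u x - vel sm) ^ 2).
{ assert (K := flux_constant (fun y => A3 y + B3 y + sigma * En y - P y * u y)).
  assert (Z : forall x, is_derive (fun y => A3 y + B3 y + sigma * En y - P y * u y) x 0).
  { intros x.
    assert (HPu : ex_derive (fun y => P y * u y) x) by (apply (ex_derive_mult P u); auto).
    replace 0 with (Derive A3 x + Derive B3 x + sigma * Derive En x - Derive (fun y => P y * u y) x)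
      by (specialize (H3 x); lra).
    apply (is_derive_minus (fun y => A3 y + B3 y + sigma * En y) (fun y => P y * u y)); [| apply Derive_correct, HPu].
    apply (is_derive_plus (fun y => A3 y + B3 y) (fun y => sigma * En y)).
    - apply (is_derive_plus A3 B3); apply Derive_correct; auto.
    - apply is_derive_scal, Derive_correct, HexE. }
  specialize (K Z). set (k := A3 0 + B3 0 + sigma * En 0 - P 0 * u 0) in *.
  assert (E : forall x, A3 x = k - u x * A2 x - sigma * En x + P x * u x).
  { intros x. specialize (K x 0). simpl in K. fold k in K. rewrite EB3 in K. lra. }
  assert (Ek : k - vel sm * 0 - sigma * energy Rg gamma sm + pressure Rg sm * vel sm = 0).
  { apply (Hflux th kappa A3); auto; [| exists (temp sm); exact Lth].
    apply is_lim_ext with (fun x => k - u x * A2 x - sigma * En x + P x * u x); [intros; symmetry; apply E |].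
    apply is_lim_plus'; [| apply is_lim_mult_finite; auto].
    apply is_lim_minus'; [apply is_lim_minus'; [apply Lc | apply is_lim_mult_finite; auto] |].
    apply is_lim_mult_finite; [apply Lc |]. unfold En, energy.
    apply is_lim_plus'; [apply is_lim_mult_finite; auto |].
    apply is_lim_mult_finite; [| apply Lc]. simpl.
    apply is_lim_mult_finite; [exact Lu | apply is_lim_mult_finite; auto]. }
  intros x. rewrite E, I2. unfold En. unfold energy in Ek. 
  replace k with (sigma * (Rg / (gamma - 1) * temp sm + vel sm ^ 2 / 2) - pressure Rg sm * vel sm) by lra.
  field. lra. }
split; [exact Hph |]. split; [| split]; intros x.
- change (is_derive v x (v x / tau (th x) * (- sigma * (v x - vol sm) - (u x - vel sm)))).
  rewrite <- I1. apply Hsolve; auto.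
- change (is_derive u x (v x / mu (th x) * (- sigma * (u x - vel sm) + (P x - pressure Rg sm)))).
  rewrite <- I2. apply Hsolve; auto.
- change (is_derive th x (v x / kappa (th x) * (- sigma * (Rg / (gamma - 1)) * (th x - temp sm)
       + pressure Rg sm * (u x - vel sm) + sigma / 2 * (u x - vel sm) ^ 2))).
  rewrite <- I3. apply Hsolve; auto.
Qed.

End Profile.

(** * Shocks of positive speed *)

Definition jump_conditions (Rg gamma sigma : R) (sm sp : state) : Prop :=
  - sigma * (vol sp - vol sm) - (vel sp - vel sm) = 0 /\
  - sigma * (vel sp - vel sm) + pressure Rg sp - pressure Rg sm = 0 /\
  - sigma * (energy Rg gamma sp - energy Rg gamma sm)
    + pressure Rg sp * vel sp - pressure Rg sm * vel sm = 0.

(** The right state is determined by X: the momentum jump gives its pressure, the energy jump its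
    temperature, and consistency with the gas law fixes sigma^2, which tends to the squared sound
    speed gamma p_- / v_- as X tends to 0. *)
Lemma jump_normalised (Rg gamma sigma : R) (sm sp : state) :
  0 < Rg -> 1 < gamma -> 0 < sigma -> physical sm -> physical sp -> vol sm < vol sp ->
  jump_conditions Rg gamma sigma sm sp ->
  let X := (vol sp - vol sm) / vol sm in
  sigma ^ 2 * vol sm / pressure Rg sm = slope (gamma - 1) X /\
  vel sp = vel sm - sigma * vol sm * X /\
  temp sp = temp sm * (1 - (gamma - 1) * z_end (gamma - 1) X).
Proof.
intros HR Hg Hsig [Hvm Htm] [Hvp Htp] Hv (J1 & J2 & J3) X.
destruct sm as [v0 u0 t0]. destruct sp as [v1 u1 t1]. unfold energy in J3. unfold pressure in *. simpl in *.
assert (HX : 0 < X) by (apply Rdiv_lt_0_compat; lra).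
assert (Ev : v1 = v0 * (1 + X)) by (unfold X; field; lra).
clearbody X. subst v1.
set (r := gamma - 1) in *. assert (Hr : 0 < r) by (unfold r; lra).
set (p0 := Rg * t0 / v0) in *.
assert (Hp0 : 0 < p0) by (unfold p0; apply Rdiv_lt_0_compat; [apply Rmult_lt_0_compat |]; lra).
assert (Et0 : Rg * t0 = p0 * v0) by (unfold p0; field; lra).
assert (Eu : u1 = u0 - sigma * v0 * X) by lra. subst u1.
set (S := sigma ^ 2 * v0 / p0).
assert (ES : sigma ^ 2 * v0 = S * p0) by (unfold S; field; lra).
assert (Ep : Rg * t1 = v0 * (1 + X) * (p0 * (1 - S * X))).
{ replace (Rg * t1) with (v0 * (1 + X) * (Rg * t1 / (v0 * (1 + X)))) by (field; nra).
  f_equal. replace (p0 * (1 - S * X)) with (p0 - (S * p0) * X) by ring. rewrite <- ES. lra. }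
assert (Et : Rg * t1 = p0 * v0 * (1 + r * (- X + S * X ^ 2 / 2))).
{ assert (E : Rg / r * (t1 - t0) = - p0 * v0 * X + S * p0 * v0 * X ^ 2 / 2).
  { apply (Rmult_eq_reg_l sigma); [| lra]. rewrite <- ES.
    assert (Ep1 : Rg * t1 / (v0 * (1 + X)) = p0 - sigma ^ 2 * v0 * X) by lra.
    rewrite Ep1 in J3. lra. }
  replace (Rg * t1) with (r * (Rg / r * (t1 - t0)) + Rg * t0) by (field; lra).
  rewrite E, Et0. field. }
assert (ESl : S * (2 + (r + 2) * X) = 2 * (1 + r)).
{ rewrite Et in Ep.
  assert (E : (p0 * v0 * X) * (S * (2 + (r + 2) * X) - 2 * (1 + r)) = 0) by lra.
  apply Rmult_integral in E. destruct E as [E | E]; [| lra].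
  assert (0 < p0 * v0 * X) by (apply Rmult_lt_0_compat; [apply Rmult_lt_0_compat |]; assumption). lra. }
assert (ESs : S = slope r X).
{ unfold slope. apply (Rmult_eq_reg_r (2 + (r + 2) * X)); [| nra]. rewrite ESl. field. nra. }
split; [exact ESs |]. split; [reflexivity |].
apply (Rmult_eq_reg_l Rg); [| lra]. rewrite Et, <- Rmult_assoc, Et0. unfold z_end. rewrite <- ESs. field.
Qed.

(** Extrema of [f] on the compact interval give the bounds; the mean value theorem with the maximum
    of |f'| gives the Lipschitz constant. *)
Lemma inverse_bounds (f : R -> R) (al be : R) :
  positive_C2 f -> 0 < al <= be ->
  exists m M K, 0 < m /\ m <= M /\ 0 <= K /\
  (forall q, al <= q <= be -> m <= / f q <= M) /\
  forall p q, al <= p <= be -> al <= q <= be -> Rabs (/ f p - / f q) <= K * Rabs (p - q).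
Proof.
intros Hf [Hal Hbe].
assert (Hp : forall q, al <= q <= be -> 0 < f q) by (intros q Hq; apply Hf; lra).
assert (Hc : forall q, al <= q <= be -> continuity_pt f q).
{ intros q Hq. destruct (positive_C2_derive f q Hf) as (_ & D & _); [lra |].
  apply continuity_pt_filterlim, (ex_derive_continuous f). eexists; exact D. }
destruct (continuity_ab_maj f al be Hbe Hc) as (qM & HM & HqM).
destruct (continuity_ab_min f al be Hbe Hc) as (qm & Hm & Hqm).
set (df := fun q => Rabs (Derive f q)).
destruct (continuity_ab_maj df al be Hbe) as (qD & HD & HqD).
{ intros q Hq. destruct (positive_C2_derive f q Hf) as (_ & _ & D); [lra |].
  apply continuity_pt_filterlim, (continuous_comp (Derive f) Rabs); [exact D |]. apply continuous_Rabs. }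
assert (Hpm := Hp qm Hqm). assert (HpM := Hp qM HqM).
exists (/ f qM), (/ f qm), (df qD * (/ f qm * / f qm)).
assert (Hinv : forall q, al <= q <= be -> / f qM <= / f q <= / f qm).
{ intros q Hq. split; apply Rinv_le_contravar; auto. }
assert (0 < / f qM) by (apply Rinv_0_lt_compat; assumption).
assert (0 < / f qm) by (apply Rinv_0_lt_compat; assumption).
split; [assumption |]. split; [apply (Hinv qM HqM) |].
split; [repeat apply Rmult_le_pos; try lra; apply Rabs_pos |].
split; [exact Hinv |].
intros p q Hpp Hqq.
destruct (MVT_gen f q p (Derive f)) as (c & Hc' & Ec).
{ intros x Hx. apply positive_C2_derive; [exact Hf |].
  assert (al <= Rmin q p) by (apply Rmin_glb; lra). lra. }
{ intros x Hx. apply Hc. assert (al <= Rmin q p) by (apply Rmin_glb; lra).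
  assert (Rmax q p <= be) by (apply Rmax_lub; lra). lra. }
assert (Hcc : al <= c <= be).
{ assert (al <= Rmin q p) by (apply Rmin_glb; lra).
  assert (Rmax q p <= be) by (apply Rmax_lub; lra). lra. }
assert (Hfp := Hp p Hpp). assert (Hfq := Hp q Hqq).
replace (/ f p - / f q) with (- (f p - f q) * (/ f p * / f q)) by (field; lra).
rewrite Ec, Rabs_mult, Rabs_Ropp, Rabs_mult. fold (df c).
assert (Ii : 0 <= / f p * / f q <= / f qm * / f qm).
{ pose proof (Hinv p Hpp). pose proof (Hinv q Hqq). apply Rmult_range; lra. }
rewrite (Rabs_pos_eq _ (proj1 Ii)).
assert (0 <= df c <= df qD) by (split; [apply Rabs_pos | apply HD, Hcc]).
assert (Hdd : 0 <= df c * (/ f p * / f q) <= df qD * (/ f qm * / f qm)) by (apply Rmult_range; lra).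
replace (df c * Rabs (p - q) * (/ f p * / f q)) with (df c * (/ f p * / f q) * Rabs (p - q)) by ring.
apply Rmult_le_compat_r; [apply Rabs_pos | lra].
Qed.

Lemma coefficient_weaken (lo hi L lo' hi' L' X Z : R) (q : R -> R -> R) :
  lo' <= lo -> hi <= hi' -> L <= L' ->
  coefficient_ok lo hi L X Z q -> coefficient_ok lo' hi' L' X Z q.
Proof.
intros H1 H2 H3 [Q1 Q2]. split.
- intros x z Hx Hz. specialize (Q1 x z Hx Hz). lra.
- intros x z x' z' Hx Hz Hx' Hz'. eapply Rle_trans; [apply Q2; assumption |].
  apply Rmult_le_compat_r; [| exact H3].
  pose proof (Rabs_pos (x - x')). pose proof (Rabs_pos (z - z')). lra.
Qed.

(* [e] is 0 or 1: the coefficients carry the factor [v = v0 (1 + x)] or not. *)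
Lemma coefficient_of_transport (f : R -> R) (al be m M K A A1 A2 t0 r e X Z : R) :
  (forall q, al <= q <= be -> m <= / f q <= M) ->
  (forall p q, al <= p <= be -> al <= q <= be -> Rabs (/ f p - / f q) <= K * Rabs (p - q)) ->
  0 < m -> m <= M -> 0 <= K -> 0 < A1 -> A1 <= A <= A2 -> 2 * al <= t0 <= be -> 0 < al -> 0 < r ->
  0 <= e <= 1 -> X <= 1 -> r * Z <= 1 / 2 ->
  coefficient_ok (A1 * m) (A2 * (2 * M)) (A2 * (2 * (K * (be * r)) + M)) X Z
    (fun x z => A * (1 + e * x) * / f (t0 * (1 - r * z))).
Proof.
intros Hb Hl Hm HmM HK HA1 HA Ht Hal Hr He HX HrZ.
assert (Hth : forall z, 0 <= z <= Z -> al <= t0 * (1 - r * z) <= be).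
{ intros z Hz. assert (0 <= r * z <= 1 / 2) by (split; [apply Rmult_le_pos; lra |];
    apply Rle_trans with (r * Z); [apply Rmult_le_compat_l |]; lra). split; nra. }
assert (Hex : forall x, 0 <= x <= X -> 0 <= e * x <= 1 * 1) by (intros x Hx; apply Rmult_range; lra).
split.
- intros x z Hx Hz. specialize (Hb _ (Hth z Hz)). specialize (Hex x Hx).
  split.
  + apply Rmult_le_compat; [lra | lra | nra | lra].
  + replace (A2 * (2 * M)) with (A2 * 2 * M) by ring. apply Rmult_le_compat; [nra | lra | nra | lra].
- intros x z x' z' Hx Hz Hx' Hz'.
  set (g := / f (t0 * (1 - r * z))). set (g' := / f (t0 * (1 - r * z'))).
  assert (Hg' : m <= g' <= M) by apply (Hb _ (Hth z' Hz')).
  assert (Hgg : Rabs (g - g') <= K * (be * r) * Rabs (z - z')).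
  { eapply Rle_trans; [apply Hl; apply Hth; assumption |]. rewrite Rmult_assoc.
    apply Rmult_le_compat_l; [exact HK |].
    replace (t0 * (1 - r * z) - t0 * (1 - r * z')) with (- (t0 * r * (z - z'))) by ring.
    rewrite Rabs_Ropp, Rabs_mult, (Rabs_pos_eq (t0 * r)) by (apply Rmult_le_pos; lra).
    apply Rmult_le_compat_r; [apply Rabs_pos |]. apply Rmult_le_compat_r; lra. }
  replace (A * (1 + e * x) * g - A * (1 + e * x') * g') with (A * ((1 + e * x) * g - (1 + e * x') * g')) by ring.
  rewrite Rabs_mult, (Rabs_pos_eq A), Rmult_assoc by lra.
  apply Rmult_le_compat; [lra | apply Rabs_pos | lra |].
  eapply Rle_trans; [apply Rabs_prod_diff |].
  specialize (Hex x Hx). rewrite (Rabs_pos_eq (1 + e * x)), (Rabs_pos_eq g') by lra.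
  replace (1 + e * x - (1 + e * x')) with (e * (x - x')) by ring.
  rewrite Rabs_mult, (Rabs_pos_eq e) by lra.
  pose proof (Rabs_pos (x - x')) as Px. pose proof (Rabs_pos (z - z')) as Pz. pose proof (Rabs_pos (g - g')) as Pg.
  assert (T1 : (1 + e * x) * Rabs (g - g') <= 2 * (K * (be * r) * Rabs (z - z'))) by (apply Rmult_le_compat; lra).
  assert (T2 : e * Rabs (x - x') * g' <= (1 * Rabs (x - x')) * M).
  { apply Rmult_le_compat; [apply Rmult_le_pos; lra | lra | apply Rmult_le_compat_r; lra | lra]. }
  assert (0 <= K * (be * r)) by (apply Rmult_le_pos; [lra | apply Rmult_le_pos; lra]).
  assert (0 <= K * (be * r) * Rabs (x - x')) by (apply Rmult_le_pos; lra).
  assert (0 <= M * Rabs (z - z')) by (apply Rmult_le_pos; lra).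
  lra.
Qed.

(** The signs of the derivatives are expressed relative to the jumps, so that one formula covers
    both shock families and is preserved by reflection. *)
Definition unique_connection (Rg gamma : R) (tau mu kappa : R -> R) (sigma : R)
    (sm sp : state) : Prop :=
  exists W : R -> state,
  first_order Rg gamma tau mu kappa sigma sm W /\ connects W sm sp /\
  (forall x, 0 < (vol sp - vol sm) * Derive (fun y => vol (W y)) x /\
             0 < (vel sp - vel sm) * Derive (fun y => vel (W y)) x /\
             0 < (temp sp - temp sm) * Derive (fun y => temp (W y)) x) /\
  forall W' : R -> state,
  first_order Rg gamma tau mu kappa sigma sm W' -> connects W' sm sp ->
  monotone_components W' -> exists h : R, forall x, W' x = W (x + h).

(** Monotonicity of a competing profile enters the uniqueness argument here: it confines the profile
    to the box between the rest points. *)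
Lemma monotone_between (f : R -> R) (l k : R) :
  monotone f -> is_lim f m_infty l -> is_lim f p_infty k -> l <= k ->
  forall t, l <= f t <= k.
Proof.
assert (Hp : forall (g : R -> R) (m c T : R), is_lim g p_infty m -> (forall t, T <= t -> c <= g t) -> c <= m).
{ intros g m c T Hg Hge. apply Rnot_lt_le. intros Hlt.
  destruct (is_lim_pos_p (fun t => c - g t) (c - m)) as [T' HT'].
  - apply is_lim_minus'; [apply is_lim_const | exact Hg].
  - lra.
  - specialize (HT' (Rmax T T') (Rmax_r _ _)). specialize (Hge (Rmax T T') (Rmax_l _ _)). lra. }
assert (Hp' : forall (g : R -> R) (m c T : R), is_lim g p_infty m -> (forall t, T <= t -> g t <= c) -> m <= c).
{ intros g m c T Hg Hge. apply Ropp_le_cancel.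
  apply (Hp (fun t => - g t) (- m) (- c) T); [apply (is_lim_opp g p_infty m), Hg |].
  intros t Ht. apply Ropp_le_contravar, Hge, Ht. }
intros [Hm | Hm] Hl Hk Hlk t; apply is_lim_opp_arg_p in Hl.
- split.
  + apply (Hp' (fun t => f (- t)) l (f t) (- t)); [exact Hl | intros q Hq; apply Hm; lra].
  + apply (Hp f k (f t) t); [exact Hk | intros q Hq; apply Hm; lra].
(* A nonincreasing [f] with l <= k has to be constant, and the bounds still hold. *)
- assert (f t <= l) by (apply (Hp (fun t => f (- t)) l (f t) (- t)); [exact Hl | intros q Hq; apply Hm; lra]).
  assert (k <= f t) by (apply (Hp' f k (f t) t); [exact Hk | intros q Hq; apply Hm; lra]).
  lra.
Qed.

(** Cruder than square roots but rational: either s >= 1 or s >= s^2, and s <= 1 + s^2. *)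
Lemma sqrt_free_bounds (s A B : R) : 0 < s -> 0 < A -> A <= s ^ 2 <= B -> Rmin 1 A <= s <= 1 + B.
Proof.
intros Hs HA [H1 H2]. pose proof (Rmin_l 1 A). pose proof (Rmin_r 1 A). split; nra.
Qed.

(** * Change of variables between profiles and the normalised system *)

Section Normalisation.

Variables (Rg gamma : R) (tau mu kappa : R -> R) (sigma X : R) (sm : state).
Hypothesis HR : 0 < Rg.
Hypothesis Hgamma : 1 < gamma.
Hypothesis Htau : positive_C2 tau.
Hypothesis Hmu : positive_C2 mu.
Hypothesis Hkappa : positive_C2 kappa.
Hypothesis Hsm : physical sm.
Hypothesis Hsigma : 0 < sigma.

Let r := gamma - 1.
Let v0 := vol sm.
Let u0 := vel sm.
Let t0 := temp sm.
Let p0 := pressure Rg sm.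

Hypothesis Hslope : sigma ^ 2 * v0 / p0 = slope r X.

(** The redundant factors 1 and 0 of x match the pattern 1 + e x of the coefficient estimate. In
    [coef_b] the specific volume is cancelled by the denominator of the pressure, hence e = 0. *)
Definition coef_a (x z : R) : R := sigma * v0 * (1 + 1 * x) * / tau (t0 * (1 - r * z)).
Definition coef_b (x z : R) : R := p0 / sigma * (1 + 0 * x) * / mu (t0 * (1 - r * z)).
Definition coef_d (x z : R) : R := Rg / r * (sigma * v0) * (1 + 1 * x) * / kappa (t0 * (1 - r * z)).

Lemma base_positive : 0 < r /\ 0 < v0 /\ 0 < t0 /\ 0 < p0.
Proof.
destruct Hsm as [Hv Ht]. repeat split; try assumption; [unfold r; lra |].
unfold p0, pressure. apply Rdiv_lt_0_compat; [apply Rmult_lt_0_compat |]; assumption.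
Qed.

Lemma first_order_of_normalised (x y z : R -> R) :
  normalised_solution r X coef_a coef_b coef_d x y z ->
  (forall t, 0 < 1 + x t /\ 0 < 1 - r * z t) ->
  first_order Rg gamma tau mu kappa sigma sm
    (fun t => State (v0 * (1 + x t)) (u0 - sigma * v0 * y t) (t0 * (1 - r * z t))).
Proof.
destruct base_positive as (Hr & Hv & Ht & Hp).
assert (EP : Rg * t0 = p0 * v0) by (unfold p0, pressure, t0, v0 in *; field; lra).
intros Sol Hpos.
assert (Hth : forall t, 0 < t0 * (1 - r * z t)) by (intros t; apply Rmult_lt_0_compat; [lra | apply Hpos]).
split; [| split; [| split]]; intros t; destruct (Sol t) as (D1 & D2 & D3);
  destruct (Hpos t) as [Hx Hz]; rewrite <- Hslope in *.
- split; simpl; [apply Rmult_lt_0_compat; lra | apply Hth].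
- change (is_derive (fun t => v0 * (1 + x t)) t (v0 * (1 + x t) / tau (t0 * (1 - r * z t))
    * (- sigma * (v0 * (1 + x t) - v0) - (u0 - sigma * v0 * y t - u0)))).
  destruct (positive_C2_derive tau _ Htau (Hth t)) as [Hf _].
  evar_last.
  + apply (is_derive_scal (fun t => 1 + x t)). apply (is_derive_plus (fun _ => 1) x); [apply (is_derive_const 1) | exact D1].
  + unfold coef_a, G1, plus, zero; simpl. field. lra.
- destruct (positive_C2_derive mu _ Hmu (Hth t)) as [Hf _].
  change (is_derive (fun t => u0 - sigma * v0 * y t) t (v0 * (1 + x t) / mu (t0 * (1 - r * z t))
    * (- sigma * (u0 - sigma * v0 * y t - u0)
       + (Rg * (t0 * (1 - r * z t)) / (v0 * (1 + x t)) - p0)))).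
  evar_last.
  + apply (is_derive_minus (fun _ => u0) (fun t => sigma * v0 * y t)); [apply (is_derive_const u0) |].
    apply (is_derive_scal y). exact D2.
  + unfold coef_b, G2, minus, plus, opp, zero; simpl.
    replace (Rg * (t0 * (1 - r * z t)) / (v0 * (1 + x t))) with (p0 * (1 - r * z t) / (1 + x t)).
    2:{ replace (Rg * (t0 * (1 - r * z t))) with (p0 * v0 * (1 - r * z t)) by (rewrite <- EP; ring). field. lra. }
    field. repeat split; lra.
- destruct (positive_C2_derive kappa _ Hkappa (Hth t)) as [Hf _].
  change (is_derive (fun t => t0 * (1 - r * z t)) t (v0 * (1 + x t) / kappa (t0 * (1 - r * z t))
    * (- sigma * (Rg / r) * (t0 * (1 - r * z t) - t0) + p0 * (u0 - sigma * v0 * y t - u0)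
       + sigma / 2 * (u0 - sigma * v0 * y t - u0) ^ 2))).
  evar_last.
  + apply (is_derive_scal (fun t => 1 - r * z t)).
    apply (is_derive_minus (fun _ => 1) (fun t => r * z t)); [apply (is_derive_const 1) |].
    apply (is_derive_scal z). exact D3.
  + unfold coef_d, G3, minus, plus, opp, zero; simpl.
    assert (Et0 : t0 = p0 * v0 / Rg) by (rewrite <- EP; field; lra).
    set (k := kappa (t0 * (1 - r * z t))) in *. clearbody k.
    rewrite Et0. field. repeat split; lra.
Qed.

Lemma normalised_of_first_order (W : R -> state) :
  first_order Rg gamma tau mu kappa sigma sm W ->
  normalised_solution r X coef_a coef_b coef_d
    (fun t => vol (W t) / v0 - 1) (fun t => (u0 - vel (W t)) / (sigma * v0))
    (fun t => (1 - temp (W t) / t0) / r).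
Proof.
destruct base_positive as (Hr & Hv & Ht & Hp).
assert (EP : Rg * t0 = p0 * v0) by (unfold p0, pressure, t0, v0 in *; field; lra).
intros (Hph & Dv & Du & Dth) t. specialize (Dv t). specialize (Du t). specialize (Dth t).
destruct (Hph t) as [Pv Pt].
unfold coef_a, coef_b, coef_d.
replace (t0 * (1 - r * ((1 - temp (W t) / t0) / r))) with (temp (W t)) by (field; lra).
fold v0 u0 in Dv. fold u0 p0 in Du. fold u0 p0 t0 r in Dth. rewrite <- Hslope.
set (v := vol (W t)) in *. set (u := vel (W t)) in *. set (th := temp (W t)) in *.
split; [| split].
- destruct (positive_C2_derive tau _ Htau Pt) as [Hf _]. evar_last.
  + apply (is_derive_minus (fun t => vol (W t) / v0) (fun _ => 1)); [| apply (is_derive_const 1)].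
    apply (is_derive_ext (fun t => / v0 * vol (W t))).
    { intros q. change (/ v0 * vol (W q) = vol (W q) / v0). field. lra. }
    apply is_derive_scal. exact Dv.
  + unfold G1, minus, plus, opp, zero; simpl. field. lra.
- destruct (positive_C2_derive mu _ Hmu Pt) as [Hf _]. evar_last.
  + apply (is_derive_ext (fun t => / (sigma * v0) * (u0 - vel (W t)))).
    { intros q. change (/ (sigma * v0) * (u0 - vel (W q)) = (u0 - vel (W q)) / (sigma * v0)). field. lra. }
    apply is_derive_scal. apply (is_derive_minus (fun _ => u0) (fun t => vel (W t))); [apply (is_derive_const u0) |].
    exact Du.
  + unfold G2, minus, plus, opp, zero; simpl. unfold pressure at 1. fold v th.
    assert (ER : Rg = p0 * v0 / t0) by (rewrite <- EP; field; lra). rewrite ER.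
    field. repeat split; lra.
- destruct (positive_C2_derive kappa _ Hkappa Pt) as [Hf _]. evar_last.
  + apply (is_derive_ext (fun t => / r * (1 - / t0 * temp (W t)))).
    { intros q. change (/ r * (1 - / t0 * temp (W q)) = (1 - temp (W q) / t0) / r). field. lra. }
    apply is_derive_scal. apply (is_derive_minus (fun _ => 1) (fun t => / t0 * temp (W t))); [apply (is_derive_const 1) |].
    apply is_derive_scal. exact Dth.
  + unfold G3, minus, plus, opp, zero; simpl.
    assert (ER : Rg = p0 * v0 / t0) by (rewrite <- EP; field; lra). rewrite ER.
    field. repeat split; lra.
Qed.

End Normalisation.

(** * Weak shocks of positive speed: the normalised result transferred *)

Lemma monotone_opp (f : R -> R) : monotone f -> monotone (fun t => - f t).
Proof.
intros [H | H]; [right | left]; intros x y Hxy; apply Ropp_le_contravar, H, Hxy.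
Qed.

Lemma monotone_between_rev (f : R -> R) (l k : R) :
  monotone f -> is_lim f m_infty l -> is_lim f p_infty k -> k <= l ->
  forall t, k <= f t <= l.
Proof.
intros Hm Hl Hk Hkl t.
assert (H := monotone_between (fun t => - f t) (- l) (- k) (monotone_opp f Hm)
  (is_lim_opp f _ _ Hl) (is_lim_opp f _ _ Hk) ltac:(lra) t). simpl in H. lra.
Qed.

Lemma is_lim_affine (f : R -> R) (p : Rbar) (l A B : R) :
  is_lim f p l -> is_lim (fun t => A + B * f t) p (A + B * l).
Proof.
intros Hf. apply is_lim_plus'; [apply is_lim_const |].
apply is_lim_mult_finite; [apply is_lim_const | exact Hf].
Qed.

(** The factor 2 in the bound on X gives r Z <= 1/2, which keeps the temperature 1 - r z, relative
    to the base state, positive throughout the box. *)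
Lemma connection_of_coefficients (Rg gamma : R) (tau mu kappa : R -> R) (sigma lo hi L : R) (sm sp : state) :
  0 < Rg -> 1 < gamma -> positive_C2 tau -> positive_C2 mu -> positive_C2 kappa ->
  physical sm -> physical sp -> 0 < sigma -> jump_conditions Rg gamma sigma sm sp ->
  vol sm < vol sp -> 0 < lo -> lo <= hi -> 0 <= L ->
  let r := gamma - 1 in
  let X := (vol sp - vol sm) / vol sm in
  2 * (1 + r) * X <= 1 ->
  (hi + L) * ((1 + r) * (r + 6)) * X <= cone_threshold r lo hi ->
  coefficient_ok lo hi L X (z_end r X) (coef_a gamma tau sigma sm) ->
  coefficient_ok lo hi L X (z_end r X) (coef_b Rg gamma mu sigma sm) ->
  coefficient_ok lo hi L X (z_end r X) (coef_d Rg gamma kappa sigma sm) ->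
  unique_connection Rg gamma tau mu kappa sigma sm sp.
Proof.
intros HR Hg Htau Hmu Hkappa Hsm Hsp Hsig HJ Hv Hlo Hhi HL r X HX Hthr Ka Kb Kd.
assert (Hr : 0 < r) by (unfold r; lra).
destruct (Hsm) as [Hv0 Ht0].
assert (HX0 : 0 < X) by (apply Rdiv_lt_0_compat; lra).
assert (HX1 : (1 + r) * X <= 1) by nra.
destruct (jump_normalised Rg gamma sigma sm sp HR Hg Hsig Hsm Hsp Hv HJ) as (ES & Eu & Et).
fold r X in ES, Et. fold X in Eu.
destruct (normalised_connection r lo hi L X _ _ _ Hr Hlo Hhi HL HX0 HX1 Hthr Ka Kb Kd)
  as (x & y & z & Sol & HB & HG & (Mx & My & Mz) & (Px & Py & Pz) & Huniq).
assert (HZ := z_end_bounds r X Hr HX0 HX1).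
assert (HrZ : r * z_end r X <= 1 / 2) by nra.
assert (Evp : vol sp = vol sm * (1 + X)) by (unfold X; field; lra).
assert (Hpos : forall t, 0 < 1 + x t /\ 0 < 1 - r * z t).
{ intros t. destruct (HB t) as (Bx & By & Bz). split; [lra |].
  assert (r * z t <= r * z_end r X) by (apply Rmult_le_compat_l; lra). lra. }
set (W := fun t => State (vol sm * (1 + x t)) (vel sm - sigma * vol sm * y t) (temp sm * (1 - r * z t))).
assert (HW : first_order Rg gamma tau mu kappa sigma sm W)
  by exact (first_order_of_normalised Rg gamma tau mu kappa sigma X sm HR Hg Htau Hmu Hkappa Hsm Hsig ES x y z Sol Hpos).
exists W. split; [exact HW |].
assert (Lv : forall p l, is_lim x p (Finite l) -> is_lim (fun t => vol (W t)) p (vol sm * (1 + l))).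
{ intros p l Hl. replace (vol sm * (1 + l)) with (vol sm + vol sm * l) by ring.
  apply (is_lim_ext (fun t => vol sm + vol sm * x t)); [intros t; simpl; ring | apply is_lim_affine, Hl]. }
assert (Lu : forall p l, is_lim y p (Finite l) -> is_lim (fun t => vel (W t)) p (vel sm - sigma * vol sm * l)).
{ intros p l Hl. replace (vel sm - sigma * vol sm * l) with (vel sm + (- sigma * vol sm) * l) by ring.
  apply (is_lim_ext (fun t => vel sm + (- sigma * vol sm) * y t)); [intros t; simpl; ring | apply is_lim_affine, Hl]. }
assert (Lt : forall p l, is_lim z p (Finite l) -> is_lim (fun t => temp (W t)) p (temp sm * (1 - r * l))).
{ intros p l Hl. replace (temp sm * (1 - r * l)) with (temp sm + (- temp sm * r) * l) by ring.
  apply (is_lim_ext (fun t => temp sm + (- temp sm * r) * z t)); [intros t; simpl; ring | apply is_lim_affine, Hl]. }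
assert (Hcon : connects W sm sp).
{ split; split; [| split | | split].
  - replace (vol sm) with (vol sm * (1 + 0)) by ring. apply Lv, Mx.
  - replace (vel sm) with (vel sm - sigma * vol sm * 0) by ring. apply Lu, My.
  - replace (temp sm) with (temp sm * (1 - r * 0)) by ring. apply Lt, Mz.
  - rewrite Evp. apply Lv, Px.
  - rewrite Eu. apply Lu, Py.
  - rewrite Et. apply Lt, Pz. }
split; [exact Hcon |]. split.
- intros t. destruct (HG t) as (P1 & P2 & P3). destruct (Sol t) as (D1 & D2 & D3).
  assert (Ka' := coefficient_lower r lo hi L X _ _ _ _ Ka (HB t)).
  assert (Kb' := coefficient_lower r lo hi L X _ _ _ _ Kb (HB t)).
  assert (Kd' := coefficient_lower r lo hi L X _ _ _ _ Kd (HB t)).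
  assert (Q1 : 0 < coef_a gamma tau sigma sm (x t) (z t) * G1 (x t) (y t)) by (apply Rmult_lt_0_compat; lra).
  assert (Q2 : 0 < coef_b Rg gamma mu sigma sm (x t) (z t) * G2 r (slope r X) (x t) (y t) (z t)) by (apply Rmult_lt_0_compat; lra).
  assert (Q3 : 0 < coef_d Rg gamma kappa sigma sm (x t) (z t) * G3 (slope r X) (y t) (z t)) by (apply Rmult_lt_0_compat; lra).
  apply is_derive_unique in D1, D2, D3. rewrite <- D1 in Q1. rewrite <- D2 in Q2. rewrite <- D3 in Q3.
  assert (Xx : ex_derive x t) by (destruct (Sol t) as (D & _ & _); eexists; exact D).
  assert (Xy : ex_derive y t) by (destruct (Sol t) as (_ & D & _); eexists; exact D).
  assert (Xz : ex_derive z t) by (destruct (Sol t) as (_ & _ & D); eexists; exact D).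
  assert (E1 : Derive (fun q => vol (W q)) t = vol sm * Derive x t).
  { apply is_derive_unique. simpl. auto_derive; [exact Xx | eta_functions; ring]. }
  assert (E2 : Derive (fun q => vel (W q)) t = - (sigma * vol sm) * Derive y t).
  { apply is_derive_unique. simpl. auto_derive; [exact Xy | eta_functions; ring]. }
  assert (E3 : Derive (fun q => temp (W q)) t = - (temp sm * r) * Derive z t).
  { apply is_derive_unique. simpl. auto_derive; [exact Xz | eta_functions; ring]. }
  rewrite E1, E2, E3, Eu, Et.
  assert (0 < sigma * vol sm) by (apply Rmult_lt_0_compat; lra).
  assert (0 < temp sm * r) by (apply Rmult_lt_0_compat; lra).
  split; [| split].
  + apply Rmult_lt_0_compat; [lra |]. apply Rmult_lt_0_compat; lra.
  + replace ((vel sm - sigma * vol sm * X - vel sm) * (- (sigma * vol sm) * Derive y t))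
      with ((sigma * vol sm * X) * ((sigma * vol sm) * Derive y t)) by ring.
    apply Rmult_lt_0_compat; apply Rmult_lt_0_compat; lra.
  + replace ((temp sm * (1 - r * z_end r X) - temp sm) * (- (temp sm * r) * Derive z t))
      with ((temp sm * r * z_end r X) * ((temp sm * r) * Derive z t)) by ring.
    apply Rmult_lt_0_compat; apply Rmult_lt_0_compat; lra.
- intros W' HW' ((M1 & M2 & M3) & (N1 & N2 & N3)) (Hm1 & Hm2 & Hm3).
  assert (Sol' := normalised_of_first_order Rg gamma tau mu kappa sigma X sm HR Hg Htau Hmu Hkappa Hsm Hsig ES W' HW').
  assert (Hsv : 0 < sigma * vol sm) by (apply Rmult_lt_0_compat; lra).
  assert (Htr : 0 < temp sm * r) by (apply Rmult_lt_0_compat; lra).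
  assert (B1 := monotone_between _ _ _ Hm1 M1 N1 (Rlt_le _ _ Hv)).
  assert (B2 := monotone_between_rev _ _ _ Hm2 M2 N2).
  assert (B3 := monotone_between_rev _ _ _ Hm3 M3 N3).
  assert (0 < sigma * vol sm * X) by (apply Rmult_lt_0_compat; lra).
  assert (0 < temp sm * r * z_end r X) by (apply Rmult_lt_0_compat; lra).
  assert (Et' : temp sp = temp sm - temp sm * r * z_end r X) by (rewrite Et; unfold r; ring).
  specialize (B2 ltac:(lra)). specialize (B3 ltac:(lra)). simpl in B1, B2, B3.
  destruct (Huniq _ _ _ Sol') as (h & Hh).
  + intros t. specialize (B1 t). specialize (B2 t). specialize (B3 t).
    assert (Hdiv : forall n k c, 0 < c -> 0 <= n <= c * k -> 0 <= n / c <= k).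
    { intros n k c Hc [Hn1 Hn2]. split; [apply Rdiv_le_0_compat; lra |].
      apply (Rmult_le_reg_l c); [exact Hc |]. replace (c * (n / c)) with n by (field; lra). exact Hn2. }
    split; [| split].
    * replace (vol (W' t) / vol sm - 1) with ((vol (W' t) - vol sm) / vol sm) by (field; lra).
      apply Hdiv; lra.
    * apply Hdiv; lra.
    * replace ((1 - temp (W' t) / temp sm) / (gamma - 1)) with ((temp sm - temp (W' t)) / (temp sm * r))
        by (unfold r; field; split; unfold r in Hr; lra).
      apply Hdiv; [exact Htr |]. lra.
  + replace (Finite 0) with (Finite (-1 + / vol sm * vol sm)) by (f_equal; field; lra).
    apply (is_lim_ext (fun t => -1 + / vol sm * vol (W' t))); [intros; field; lra | apply is_lim_affine, M1].
  + replace (Finite X) with (Finite (-1 + / vol sm * vol sp)) by (f_equal; unfold X; field; lra).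
    apply (is_lim_ext (fun t => -1 + / vol sm * vol (W' t))); [intros; field; lra | apply is_lim_affine, N1].
  + exists h. intros t. destruct (Hh t) as (E1 & E2 & E3).
    unfold W. rewrite <- E1, <- E2, <- E3. destruct (W' t) as [a b c]. simpl.
    f_equal; unfold r; field; repeat split; unfold r in Hr; lra.
Qed.

(** The threshold is uniform over base states within a factor 2 of the reference values: after
    reflection the base state of a 1-shock is its right state, which varies while the threshold must
    depend on the left state alone. *)
Lemma positive_speed_connection (Rg gamma : R) (tau mu kappa : R -> R) (vr tr : R) :
  0 < Rg -> 1 < gamma -> positive_C2 tau -> positive_C2 mu -> positive_C2 kappa ->
  0 < vr -> 0 < tr ->
  exists eps0, 0 < eps0 /\ forall (sigma : R) (sm sp : state),
  physical sm -> physical sp -> 0 < sigma -> jump_conditions Rg gamma sigma sm sp ->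
  vr / 2 <= vol sm <= 2 * vr -> tr / 2 <= temp sm <= 2 * tr ->
  0 < vol sp - vol sm < eps0 ->
  unique_connection Rg gamma tau mu kappa sigma sm sp.
Proof.
intros HR Hg Htau Hmu Hkappa Hvr Htr.
set (r := gamma - 1). assert (Hr : 0 < r) by (unfold r; lra).
(* Temperatures in the box lie between half the base temperature and the base temperature itself,
   hence in [tr / 4, 2 tr]. *)
destruct (inverse_bounds tau (tr / 4) (2 * tr) Htau ltac:(lra)) as (m1 & M1 & K1 & T1 & T2 & T3 & T4 & T5).
destruct (inverse_bounds mu (tr / 4) (2 * tr) Hmu ltac:(lra)) as (m2 & M2 & K2 & U1 & U2 & U3 & U4 & U5).
destruct (inverse_bounds kappa (tr / 4) (2 * tr) Hkappa ltac:(lra)) as (m3 & M3 & K3 & V1 & V2 & V3 & V4 & V5).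
(* Chain of uniform bounds: [P1], [P2] for the base pressure p0; [B1], [B2] for sigma^2 = slope p0 /
   v0, with the slope between (1 + r) / 2 and 1 + r; [s1], [s2] for sigma; [A1], [A2] for sigma v0;
   [C1], [C2] for p0 / sigma. *)
set (P1 := Rg * (tr / 2) / (2 * vr)). set (P2 := Rg * (2 * tr) / (vr / 2)).
assert (HP1 : 0 < P1) by (apply Rdiv_lt_0_compat; [apply Rmult_lt_0_compat |]; lra).
assert (HP2 : 0 < P2) by (apply Rdiv_lt_0_compat; [apply Rmult_lt_0_compat |]; lra).
set (B1 := (1 + r) / 2 * P1 / (2 * vr)). set (B2 := (1 + r) * P2 / (vr / 2)).
assert (HB1 : 0 < B1) by (apply Rdiv_lt_0_compat; [apply Rmult_lt_0_compat |]; lra).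
assert (HB2 : 0 < B2) by (apply Rdiv_lt_0_compat; [apply Rmult_lt_0_compat |]; lra).
set (s1 := Rmin 1 B1). set (s2 := 1 + B2).
assert (Hs1 : 0 < s1) by (apply Rmin_glb_lt; lra).
assert (Hs2 : 0 < s2) by (unfold s2; lra).
set (c := Rg / r). assert (Hc : 0 < c) by (apply Rdiv_lt_0_compat; lra).
set (A1 := s1 * (vr / 2)). set (A2 := s2 * (2 * vr)).
assert (HA1 : 0 < A1) by (apply Rmult_lt_0_compat; lra).
assert (HA2 : 0 < A2) by (apply Rmult_lt_0_compat; lra).
set (C1 := P1 / s2). set (C2 := P2 / s1).
assert (HC1 : 0 < C1) by (apply Rdiv_lt_0_compat; lra).
assert (HC2 : 0 < C2) by (apply Rdiv_lt_0_compat; lra).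
assert (HD1 : 0 < c * A1) by (apply Rmult_lt_0_compat; lra).
assert (HD2 : 0 < c * A2) by (apply Rmult_lt_0_compat; lra).
set (lo := Rmin (A1 * m1) (Rmin (C1 * m2) (c * A1 * m3))).
assert (Hlo : 0 < lo) by (repeat apply Rmin_glb_lt; apply Rmult_lt_0_compat; assumption).
assert (Hl1 : lo <= A1 * m1) by apply Rmin_l.
assert (Hl2 : lo <= C1 * m2) by (eapply Rle_trans; [apply Rmin_r | apply Rmin_l]).
assert (Hl3 : lo <= c * A1 * m3) by (eapply Rle_trans; [apply Rmin_r | apply Rmin_r]).
set (h1 := A2 * (2 * M1)). set (h2 := C2 * (2 * M2)). set (h3 := c * A2 * (2 * M3)).
assert (Hh1 : 0 < h1) by (apply Rmult_lt_0_compat; lra).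
assert (Hh2 : 0 < h2) by (apply Rmult_lt_0_compat; lra).
assert (Hh3 : 0 < h3) by (apply Rmult_lt_0_compat; lra).
assert (HL' : forall A K M, 0 < A -> 0 <= K -> 0 < M -> 0 < A * (2 * (K * (2 * tr * r)) + M)).
{ intros A K M HA HK HM. apply Rmult_lt_0_compat; [exact HA |].
  assert (0 <= K * (2 * tr * r)) by (apply Rmult_le_pos; [lra | apply Rmult_le_pos; lra]). lra. }
set (L1 := A2 * (2 * (K1 * (2 * tr * r)) + M1)). set (L2 := C2 * (2 * (K2 * (2 * tr * r)) + M2)).
set (L3 := c * A2 * (2 * (K3 * (2 * tr * r)) + M3)).
assert (HL1 : 0 < L1) by (apply HL'; lra). assert (HL2 : 0 < L2) by (apply HL'; lra).
assert (HL3 : 0 < L3) by (apply HL'; lra).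
set (hi := lo + h1 + h2 + h3). set (L := L1 + L2 + L3).
assert (Hhi : lo <= hi) by (unfold hi; lra).
assert (HL : 0 <= L) by (unfold L; lra).
set (thr := cone_threshold r lo hi).
assert (Hthr : 0 < thr) by (apply cone_threshold_pos; lra).
set (cc := (hi + L) * ((1 + r) * (r + 6))).
assert (Hcc : 0 < cc).
{ apply Rmult_lt_0_compat; [unfold hi, L; lra | apply Rmult_lt_0_compat; lra]. }
(* Bound for the relative jump X: the first entry keeps temperatures positive, the second meets the
   cone condition. The factor vr / 2 below converts it to a bound on the jump of the volume. *)
set (eta := Rmin (1 / (2 * (1 + r))) (thr / cc)).
assert (Heta : 0 < eta).
{ apply Rmin_glb_lt; apply Rdiv_lt_0_compat; lra. }
exists (eta * (vr / 2)). split; [apply Rmult_lt_0_compat; lra |].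
intros sigma sm sp Hsm Hsp Hsig HJ Hv Ht Hd.
destruct (Hsm) as [Hv0 Ht0].
assert (Hvlt : vol sm < vol sp) by lra.
set (X := (vol sp - vol sm) / vol sm).
assert (HX0 : 0 < X) by (apply Rdiv_lt_0_compat; lra).
assert (EX : vol sm * X = vol sp - vol sm) by (unfold X; field; lra).
assert (HXe : X <= eta).
{ apply Rnot_lt_le. intros Hlt.
  assert (eta * (vr / 2) <= X * vol sm) by (apply Rmult_le_compat; lra). lra. }
assert (HX1 : 2 * (1 + r) * X <= 1).
{ assert (X <= 1 / (2 * (1 + r))) by (eapply Rle_trans; [exact HXe | apply Rmin_l]).
  apply Rle_trans with (2 * (1 + r) * (1 / (2 * (1 + r)))); [apply Rmult_le_compat_l; lra | right; field; lra]. }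
assert (HX2 : cc * X <= thr).
{ assert (X <= thr / cc) by (eapply Rle_trans; [exact HXe | apply Rmin_r]).
  apply Rle_trans with (cc * (thr / cc)); [apply Rmult_le_compat_l; lra | right; field; lra]. }
destruct (jump_normalised Rg gamma sigma sm sp HR Hg Hsig Hsm Hsp Hvlt HJ) as (ES & _ & _).
fold r X in ES.
assert (HX3 : (1 + r) * X <= 1) by nra.
set (p0 := pressure Rg sm) in *.
assert (Hp0 : P1 <= p0 <= P2).
{ assert (Rg * (tr / 2) <= Rg * temp sm <= Rg * (2 * tr)) by (split; apply Rmult_le_compat_l; lra).
  assert (0 < Rg * (tr / 2)) by (apply Rmult_lt_0_compat; lra).
  unfold P1, P2, p0, pressure, Rdiv.
  split; apply Rmult_le_compat; try lra; try (left; apply Rinv_0_lt_compat; lra);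
    apply Rinv_le_contravar; lra. }
assert (HS : (1 + r) / 2 <= slope r X <= 1 + r).
{ assert (HS := slope_bounds r X Hr HX0). assert (HE := slope_eq r X Hr HX0).
  split; [| lra].
  assert (slope r X * ((r + 2) * X) <= slope r X * 2) by (apply Rmult_le_compat_l; nra). lra. }
assert (Hsig2 : sigma ^ 2 = slope r X * p0 / vol sm) by (rewrite <- ES; field; lra).
assert (Hsb : s1 <= sigma <= s2).
{ apply sqrt_free_bounds; [exact Hsig | exact HB1 |]. rewrite Hsig2. unfold B1, B2, Rdiv at 2 3 5.
  assert (0 < / vol sm) by (apply Rinv_0_lt_compat; lra).
  assert (H1 : (1 + r) / 2 * P1 <= slope r X * p0) by (apply Rmult_le_compat; lra).
  assert (H2 : slope r X * p0 <= (1 + r) * P2) by (apply Rmult_le_compat; lra).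
  assert (0 < (1 + r) / 2 * P1) by (apply Rmult_lt_0_compat; lra).
  split; unfold Rdiv; apply Rmult_le_compat; try lra; try (left; apply Rinv_0_lt_compat; lra);
    apply Rinv_le_contravar; lra. }
assert (HA : A1 <= sigma * vol sm <= A2) by (split; apply Rmult_le_compat; lra).
assert (HC : C1 <= p0 / sigma <= C2).
{ unfold C1, C2, Rdiv.
  split; apply Rmult_le_compat; try lra; try (left; apply Rinv_0_lt_compat; lra);
    apply Rinv_le_contravar; lra. }
assert (HD : c * A1 <= c * (sigma * vol sm) <= c * A2) by (split; apply Rmult_le_compat_l; lra).
assert (HZ := z_end_bounds r X Hr HX0 HX3).
assert (HrZ : r * z_end r X <= 1 / 2) by nra.
assert (HX4 : X <= 1) by nra.
apply (connection_of_coefficients Rg gamma tau mu kappa sigma lo hi L sm sp); try assumption.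
- apply (coefficient_weaken (A1 * m1) h1 L1); [lra | unfold hi; lra | unfold L; lra |].
  exact (coefficient_of_transport tau (tr / 4) (2 * tr) m1 M1 K1 _ A1 A2 (temp sm) r 1 X _ T4 T5 T1 T2 T3 HA1 HA
    ltac:(lra) ltac:(lra) Hr ltac:(lra) HX4 HrZ).
- apply (coefficient_weaken (C1 * m2) h2 L2); [lra | unfold hi; lra | unfold L; lra |].
  exact (coefficient_of_transport mu (tr / 4) (2 * tr) m2 M2 K2 _ C1 C2 (temp sm) r 0 X _ U4 U5 U1 U2 U3 HC1 HC
    ltac:(lra) ltac:(lra) Hr ltac:(lra) HX4 HrZ).
- apply (coefficient_weaken (c * A1 * m3) h3 L3); [lra | unfold hi; lra | unfold L; lra |].
  exact (coefficient_of_transport kappa (tr / 4) (2 * tr) m3 M3 K3 _ (c * A1) (c * A2) (temp sm) r 1 X _ V4 V5 V1 V2 V3 HD1 HD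
    ltac:(lra) ltac:(lra) Hr ltac:(lra) HX4 HrZ).
Qed.

(** * Reflection: 1-shocks as 3-shocks *)

Definition flip (s : state) : state := State (vol s) (- vel s) (temp s).

Lemma flip_involutive (s : state) : flip (flip s) = s.
Proof. destruct s. unfold flip. simpl. rewrite Ropp_involutive. reflexivity. Qed.

Lemma jump_conditions_flip (Rg gamma sigma : R) (sm sp : state) :
  jump_conditions Rg gamma sigma sm sp ->
  jump_conditions Rg gamma (- sigma) (flip sp) (flip sm).
Proof.
unfold jump_conditions, energy, pressure. intros (J1 & J2 & J3). simpl in *.
split; [| split]; lra.
Qed.

(** Reflection exchanges the end states, so the base state of the integrated system changes. The
    jump conditions say precisely that the integrated fluxes are the same from either end. *)
Lemma first_order_flip (Rg gamma : R) (tau mu kappa : R -> R) (sigma : R) (sm sp : state) (W : R -> state) :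
  jump_conditions Rg gamma sigma sm sp ->
  first_order Rg gamma tau mu kappa sigma sm W ->
  first_order Rg gamma tau mu kappa (- sigma) (flip sp) (fun x => flip (W (- x))).
Proof.
intros (J1 & J2 & J3) (Hph & Dv & Du & Dth). unfold energy in J3.
split; [intros x; apply Hph |].
split; [| split]; intros x.
- evar_last; [apply (is_derive_comp_opp (fun y => vol (W y))), Dv |]. simpl.
  replace (- - sigma * (vol (W (- x)) - vol sp) - (- vel (W (- x)) - - vel sp))
    with (- (- sigma * (vol (W (- x)) - vol sm) - (vel (W (- x)) - vel sm))) by lra.
  ring.
- evar_last; [apply (is_derive_opp (fun y => vel (W (- y)))), (is_derive_comp_opp (fun y => vel (W y))), Du |].
  unfold opp; simpl.
  change (pressure Rg (flip (W (- x)))) with (pressure Rg (W (- x))).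
  change (pressure Rg (flip sp)) with (pressure Rg sp).
  replace (- - sigma * (- vel (W (- x)) - - vel sp) + (pressure Rg (W (- x)) - pressure Rg sp))
    with (- sigma * (vel (W (- x)) - vel sm) + (pressure Rg (W (- x)) - pressure Rg sm)) by lra.
  ring.
- evar_last; [apply (is_derive_comp_opp (fun y => temp (W y))), Dth |].
  change (pressure Rg (flip sp)) with (pressure Rg sp). cbn [flip vol vel temp].
  set (u := vel (W (- x))). set (th := temp (W (- x))).
  replace (- - sigma * (Rg / (gamma - 1)) * (th - temp sp) + pressure Rg sp * (- u - - vel sp)
     + - sigma / 2 * (- u - - vel sp) ^ 2)
    with (- (- sigma * (Rg / (gamma - 1)) * (th - temp sm) + pressure Rg sm * (u - vel sm)
     + sigma / 2 * (u - vel sm) ^ 2)).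
  { ring. }
  assert (Ep : pressure Rg sp = pressure Rg sm + sigma * (vel sp - vel sm)) by lra.
  rewrite Ep in J3 |- *.
  symmetry. apply Rminus_diag_uniq.
  (* Once the pressure jump is substituted, the two forms of the energy bracket differ by the left
     side of the energy jump condition. *)
  match goal with |- ?l = 0 => replace l with
    (- sigma * (Rg / (gamma - 1) * temp sp + vel sp ^ 2 / 2 - (Rg / (gamma - 1) * temp sm + vel sm ^ 2 / 2)) +
      (pressure Rg sm + sigma * (vel sp - vel sm)) * vel sp - pressure Rg sm * vel sm) end; [exact J3 |].
  set (c := Rg / (gamma - 1)). field.
Qed.

Lemma connects_flip (sm sp : state) (W : R -> state) :
  connects W sm sp -> connects (fun x => flip (W (- x))) (flip sp) (flip sm).
Proof.
intros ((Mv & Mu & Mt) & (Pv & Pu & Pt)). split; (split; [| split]).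
- apply (is_lim_opp_arg_m' (fun x => vol (W x))), Pv.
- apply (is_lim_opp (fun x => vel (W (- x)))  _ (vel sp)), (is_lim_opp_arg_m' (fun x => vel (W x))), Pu.
- apply (is_lim_opp_arg_m' (fun x => temp (W x))), Pt.
- apply (is_lim_opp_arg_p (fun x => vol (W x))), Mv.
- apply (is_lim_opp (fun x => vel (W (- x))) _ (vel sm)), (is_lim_opp_arg_p (fun x => vel (W x))), Mu.
- apply (is_lim_opp_arg_p (fun x => temp (W x))), Mt.
Qed.

Lemma monotone_opp_arg (f : R -> R) : monotone f -> monotone (fun x => f (- x)).
Proof. intros [H | H]; [right | left]; intros x y Hxy; apply H; lra. Qed.

Lemma unique_connection_flip (Rg gamma : R) (tau mu kappa : R -> R) (sigma : R) (sm sp : state) :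
  jump_conditions Rg gamma sigma sm sp ->
  unique_connection Rg gamma tau mu kappa (- sigma) (flip sp) (flip sm) ->
  unique_connection Rg gamma tau mu kappa sigma sm sp.
Proof.
intros HJ (W & HW & HC & HD & HU).
exists (fun x => flip (W (- x))).
assert (HJ' := jump_conditions_flip _ _ _ _ _ HJ).
assert (HW' := first_order_flip _ _ _ _ _ _ _ _ _ HJ' HW).
assert (HC' := connects_flip _ _ _ HC).
rewrite !flip_involutive in HC'. rewrite flip_involutive, Ropp_involutive in HW'.
split; [exact HW' |]. split; [exact HC' |]. split.
- intros x. destruct (HD (- x)) as (D1 & D2 & D3). simpl in D1, D2, D3.
  destruct HW as (_ & Ev & Eu & Et).
  assert (X1 : ex_derive (fun y => vol (W y)) (- x)) by (eexists; apply Ev).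
  assert (X2 : ex_derive (fun y => vel (W y)) (- x)) by (eexists; apply Eu).
  assert (X3 : ex_derive (fun y => temp (W y)) (- x)) by (eexists; apply Et).
  assert (F1 : Derive (fun y => vol (flip (W (- y)))) x = - Derive (fun y => vol (W y)) (- x)).
  { apply is_derive_unique, (is_derive_comp_opp (fun y => vol (W y))), Derive_correct, X1. }
  assert (F2 : Derive (fun y => vel (flip (W (- y)))) x = - - Derive (fun y => vel (W y)) (- x)).
  { apply is_derive_unique, (is_derive_opp (fun y => vel (W (- y)))),
      (is_derive_comp_opp (fun y => vel (W y))), Derive_correct, X2. }
  assert (F3 : Derive (fun y => temp (flip (W (- y)))) x = - Derive (fun y => temp (W y)) (- x)).
  { apply is_derive_unique, (is_derive_comp_opp (fun y => temp (W y))), Derive_correct, X3. }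
  rewrite F1, F2, F3. repeat split; lra.
- intros W' HW1 HC1 (M1 & M2 & M3).
  destruct (HU (fun x => flip (W' (- x)))) as (h & Hh).
  + apply (first_order_flip _ _ _ _ _ _ sm); assumption.
  + apply connects_flip, HC1.
  + split; [| split].
    * apply (monotone_opp_arg (fun x => vol (W' x))), M1.
    * apply (monotone_opp (fun x => vel (W' (- x)))), (monotone_opp_arg (fun x => vel (W' x))), M2.
    * apply (monotone_opp_arg (fun x => temp (W' x))), M3.
  + exists (- h). intros x. specialize (Hh (- x)). rewrite Ropp_involutive in Hh.
    apply (f_equal flip) in Hh. rewrite flip_involutive in Hh. rewrite Hh.
    do 2 f_equal. ring.
Qed.

(** * Identification of the shock speed, and conclusion for both families *)

(** The first two jump conditions give sigma^2; the mass jump and the decrease of the velocity give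
    sigma the sign of the volume jump. *)
Lemma shock_speed_of_jump (Rg gamma sigma : R) (sm sp : state) :
  jump_conditions Rg gamma sigma sm sp -> vel sp < vel sm -> vol sp <> vol sm ->
  sigma = shock_speed Rg sm sp /\ 0 < sigma * (vol sp - vol sm).
Proof.
intros (J1 & J2 & _) Hu Hv.
assert (Hs : 0 < sigma * (vol sp - vol sm)) by lra.
split; [| exact Hs].
assert (E : - ((pressure Rg sp - pressure Rg sm) / (vol sp - vol sm)) = Rsqr sigma).
{ replace (pressure Rg sp - pressure Rg sm) with (- (Rsqr sigma * (vol sp - vol sm))).
  - field. lra.
  - unfold Rsqr. assert (vel sp - vel sm = - sigma * (vol sp - vol sm)) as Eu by lra. rewrite Eu in J2. lra. }
unfold shock_speed. rewrite E, sqrt_Rsqr_abs.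
destruct (Rlt_dec (vol sp) (vol sm)) as [Hlt | Hge].
- rewrite Rabs_left; [ring | nra].
- rewrite Rabs_pos_eq; [reflexivity | nra].
Qed.

Lemma monotone_of_derivative_sign (f : R -> R) (j : R) :
  (forall x, ex_derive f x) -> (forall x, 0 < j * Derive f x) -> monotone f.
Proof.
intros Hex Hj.
assert (Hd : forall x, is_derive f x (Derive f x)) by (intros x; apply Derive_correct, Hex).
destruct (Rle_lt_dec 0 j) as [H | H].
- left. intros x y Hxy. apply (is_derive_nondecreasing f (Derive f)); [exact Hxy | intros; apply Hd |].
  intros t _. specialize (Hj t). apply Rnot_lt_le. intros Hlt. nra.
- right. intros x y Hxy. apply Ropp_le_cancel.
  apply (is_derive_nondecreasing (fun t => - f t) (fun t => - Derive f t)); [exact Hxy | |].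
  + intros t _. apply (is_derive_opp f), Hd.
  + intros t _. specialize (Hj t). apply Rnot_lt_le. intros Hlt. nra.
Qed.

Theorem theorem1p1 :
  forall (Rg gamma : R) (tau mu kappa : R -> R),
  0 < Rg -> 1 < gamma ->
  positive_C2 tau -> positive_C2 mu -> positive_C2 kappa ->
  forall sm : state, physical sm ->
  exists eps0 : R, 0 < eps0 /\
  forall sp : state, physical sp ->
  Rankine_Hugoniot Rg gamma sm sp -> Lax sm sp ->
  0 < Rabs (vol sm - vol sp) < eps0 ->
  exists W : R -> state,
    profile_solution Rg gamma tau mu kappa sm sp W /\
    monotone_components W /\
    (forall W' : R -> state,
       profile_solution Rg gamma tau mu kappa sm sp W' ->
       monotone_components W' ->
       exists h : R, forall x : R, W' x = W (x + h)) /\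
    (vol sm > vol sp -> forall x : R,
       Derive (fun y => vol (W y)) x < 0 /\
       Derive (fun y => vel (W y)) x < 0 /\
       Derive (fun y => temp (W y)) x > 0) /\
    (vol sm < vol sp -> forall x : R,
       Derive (fun y => vol (W y)) x > 0 /\
       Derive (fun y => vel (W y)) x < 0 /\
       Derive (fun y => temp (W y)) x < 0).
Proof.
intros Rg gamma tau mu kappa HR Hg Htau Hmu Hkappa sm Hsm.
destruct (Hsm) as [Hv0 Ht0].
destruct (positive_speed_connection Rg gamma tau mu kappa (vol sm) (temp sm) HR Hg Htau Hmu Hkappa Hv0 Ht0)
  as (eps1 & Heps1 & Hconn).
(* The second entry matters for 1-shocks: it keeps the right state, the base state after reflection,
   within a factor 2 of the left state. *)
set (eps0 := Rmin eps1 (vol sm / (4 * gamma))).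
assert (Hq : 0 < vol sm / (4 * gamma)) by (apply Rdiv_lt_0_compat; lra).
exists eps0. split; [apply Rmin_glb_lt; assumption |].
intros sp Hsp (sigma & HJ) HLax Heps.
assert (Hj : jump_conditions Rg gamma sigma sm sp) by exact HJ. clear HJ.
assert (He1 : eps0 <= eps1) by apply Rmin_l.
assert (He2 : eps0 <= vol sm / (4 * gamma)) by apply Rmin_r.
assert (He2' : 4 * gamma * (vol sm / (4 * gamma)) = vol sm) by (field; lra).
assert (Hq2 : vol sm / (4 * gamma) <= vol sm / 4) by nra.
assert (Hu : vel sp < vel sm) by (destruct HLax as [H | H]; lra).
assert (Hvne : vol sp <> vol sm) by (destruct HLax as [H | H]; lra).
destruct (shock_speed_of_jump Rg gamma sigma sm sp Hj Hu Hvne) as [Es Hss].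
assert (HUC : unique_connection Rg gamma tau mu kappa sigma sm sp).
{ destruct HLax as [(Lv & Lu & Lt) | (Lv & Lu & Lt)].
  - rewrite Rabs_pos_eq in Heps by lra.
    apply unique_connection_flip; [exact Hj |].
    assert (Hj' := jump_conditions_flip _ _ _ _ _ Hj).
    assert (Hneg : 0 < - sigma) by nra.
    destruct (Hsp) as [Hv1 Ht1].
    assert (Hps : physical (flip sm)) by exact Hsm.
    assert (Hpp : physical (flip sp)) by exact Hsp.
    (* Used for the temperature ratio: with gamma X <= 1/2 it gives theta_+ <= 2 theta_-. *)
    destruct (jump_normalised Rg gamma (- sigma) (flip sp) (flip sm) HR Hg Hneg Hpp Hps Lv Hj') as (_ & _ & Et).
    simpl in Et.
    set (X := (vol sm - vol sp) / vol sp) in *.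
    assert (EX : vol sp * X = vol sm - vol sp) by (unfold X; field; lra).
    assert (HX0 : 0 < X) by (apply Rdiv_lt_0_compat; lra).
    assert (HXg : gamma * X <= 1 / 2).
    { apply (Rmult_le_reg_l (vol sp)); [exact Hv1 |].
      replace (vol sp * (gamma * X)) with (gamma * (vol sm - vol sp)) by (rewrite <- EX; ring).
      assert (gamma * (vol sm - vol sp) <= gamma * (vol sm / (4 * gamma))) by (apply Rmult_le_compat_l; lra).
      lra. }
    destruct (z_end_bounds (gamma - 1) X ltac:(lra) HX0 ltac:(lra)) as [HZ1 HZ2].
    assert (HrZ : 0 <= (gamma - 1) * z_end (gamma - 1) X <= 1 / 2) by (split; nra).
    apply Hconn; try assumption; simpl.
    + lra.
    + split; [lra |]. rewrite Et. nra.
    + lra.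
  - rewrite Rabs_left in Heps by lra.
    apply Hconn; try assumption; try lra. nra. }
destruct HUC as (W & HW & HC & HD & HU).
assert (Hgn : gamma <> 1) by lra.
assert (Hex : forall x, ex_derive (fun y => vol (W y)) x /\ ex_derive (fun y => vel (W y)) x /\ ex_derive (fun y => temp (W y)) x).
{ intros x. destruct HW as (_ & Ev & Eu & Et).
  split; [| split]; eexists; [apply Ev | apply Eu | apply Et]. }
exists W.
split; [apply (profile_of_first_order Rg gamma tau mu kappa Htau Hmu Hkappa sigma); assumption |].
split.
{ split; [| split].
  - apply (monotone_of_derivative_sign _ (vol sp - vol sm)); [intros x; apply Hex | intros x; apply HD].
  - apply (monotone_of_derivative_sign _ (vel sp - vel sm)); [intros x; apply Hex | intros x; apply HD].
  - apply (monotone_of_derivative_sign _ (temp sp - temp sm)); [intros x; apply Hex | intros x; apply HD]. }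
split.
{ intros W' HW' HM'.
  destruct (first_order_of_profile Rg gamma tau mu kappa Htau Hmu Hkappa sigma sm sp W' Es Hgn Hsm HW') as [F C].
  apply HU; assumption. }
assert (Hsign : forall j q, 0 < j * q -> (j < 0 -> q < 0) /\ (0 < j -> q > 0)) by (intros; split; nra).
split; intros Hv x; destruct (HD x) as (D1 & D2 & D3);
  apply Hsign in D1, D2, D3; destruct D1 as [D1 D1'], D2 as [D2 _], D3 as [D3 D3'].
- assert (temp sm < temp sp) by (destruct HLax; lra).
  split; [apply D1; lra | split; [apply D2; lra | apply D3'; lra]].
- assert (temp sp < temp sm) by (destruct HLax; lra).
  split; [apply D1'; lra | split; [apply D2; lra | apply D3; lra]].
Qed.
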